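(* Let $\rho_1,\rho_2\ge1$ and $\mu_1,\mu_2\in(0,1)$. Suppose that $\psi:[p_1,p_2]\to\mathbb{R}$ satisfies Assumption $(P_{\rho_1,\rho_2,1})$ and $U:(p_1,p_2)\to\mathbb{C}$ satisfies Assumption $(A_{\mu_1,\mu_2,1})$. Fix $q\in(p_1,p_2)$ and let $\varphi_j,s_j,k_j,\Lambda^{(j)}$ be as in the context. For $j=1,2$ and $\omega>0$ define $$A^{(j)}(\omega):=e^{i\omega\psi(p_j)}\,k_j(0)\,\Theta^{(j)}(\rho_j,\mu_j)\,\omega^{-\frac{\mu_j}{\rho_j}},$$ $$R_1^{(j)}(\omega,q):=(-1)^je^{i\omega\psi(p_j)}\int_0^{s_j}\phi^{(j)}(s,\omega,\rho_j,\mu_j)\,(k_j)'(s)\,ds,$$ $$R_2^{(j)}(\omega,q):=(-1)^j\,i\,\frac{\mu_j-\rho_j}{\rho_j}\,e^{i\omega\psi(p_j)}\,k_j(s_j)\int_{\Lambda^{(j)}(s_j)}z^{\mu_j-\rho_j-1}e^{(-1)^{j+1}i\omega z^{\rho_j}}\,dz\;\omega^{-1},$$ where $$\Theta^{(j)}(\rho_j,\mu_j):=\frac{(-1)^{j+1}}{\rho_j}\Gamma\!\left(\frac{\mu_j}{\rho_j}\right)e^{(-1)^{j+1}i\frac\pi2\frac{\mu_j}{\rho_j}},\qquad \phi^{(j)}(s,\omega,\rho_j,\mu_j):=-\int_{\Lambda^{(j)}(s)}z^{\mu_j-1}e^{(-1)^{j+1}i\omega z^{\rho_j}}\,dz .$$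 Then for all $\omega>0$, $$\int_{p_1}^{p_2}U(p)e^{i\omega\psi(p)}\,dp=\sum_{j=1,2}\left(A^{(j)}(\omega)+R_1^{(j)}(\omega,q)+R_2^{(j)}(\omega,q)\right),$$ and for $j=1,2$, $$\left|R_1^{(j)}(\omega,q)\right|\le\frac1{\rho_j}\Gamma\!\left(\frac1{\rho_j}\right)\int_0^{s_j}s^{\mu_j-1}\left|(k_j)'(s)\right|ds\;\omega^{-\frac1{\rho_j}},$$ $$\left|R_2^{(j)}(\omega,q)\right|\le\frac{\rho_j-\mu_j}{\rho_j}\,\Gamma\!\left(\frac1{\rho_j}\right)\left|U(q)\,(\varphi_j)'(q)^{-1}\right|\varphi_j(q)^{-\rho_j}\,\omega^{-\left(1+\frac1{\rho_j}\right)}.$$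
   Context: $p_1<p_2$ are finite real numbers. Complex powers are principal branches (on $\mathbb{C}\setminus(-\infty,0]$). Assumption $(P_{\rho_1,\rho_2,1})$ ($\rho_1,\rho_2\ge1$): $\psi\in\mathcal{C}^1([p_1,p_2],\mathbb{R})$ and there is a positive function $\tilde\psi\in\mathcal{C}^1([p_1,p_2],\mathbb{R})$ with $\psi'(p)=(p-p_1)^{\rho_1-1}(p_2-p)^{\rho_2-1}\tilde\psi(p)$ for all $p\in[p_1,p_2]$. Assumption $(A_{\mu_1,\mu_2,1})$ ($\mu_1,\mu_2\in(0,1]$): there is $\tilde u\in\mathcal{C}^1([p_1,p_2],\mathbb{C})$ with $U(p)=(p-p_1)^{\mu_1-1}(p_2-p)^{\mu_2-1}\tilde u(p)$ for $p\in(p_1,p_2)$, and $\tilde u(p_j)\ne0$ if $\mu_j\ne1$ ($j=1,2$). For $q\in(p_1,p_2)$: $\varphi_1(p):=(\psi(p)-\psi(p_1))^{1/\rho_1}$ on $I_1:=[p_1,q]$, $\varphi_2(p):=(\psi(p_2)-\psi(p))^{1/\rho_2}$ on $I_2:=[q,p_2]$, $s_1:=\varphi_1(q)$, $s_2:=\varphi_2(q)$. For $j=1,2$, $k_j(s):=U(\varphi_j^{-1}(s))\,s^{1-\mu_j}\,(\varphi_j^{-1})'(s)$ on $(0,s_j]$, which extends to a $\mathcal{C}^1$ function on $[0,s_j]$ (still denoted $k_j$). For $s>0$, $\Lambda^{(j)}(s):=\{s+te^{(-1)^{j+1}i\frac\pi{2\rho_j}}\mid t\ge0\}$, oriented by increasing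 $t$.
   Formalization: In R_2^{(j)} the prefactor (-1)^j i is replaced by -i for both j (a change for j=2 only); with the printed sign the expansion is false, e.g. for ψ(p)=p on [0,1], ρ_j=1, μ_j=1/2, U=p^{-1/2}(1-p)^{-1/2}, q=1/2. *)

(* Defs.v *)
From Stdlib Require Export Reals.
From Coquelicot Require Export Coquelicot.
Open Scope R_scope.

(** Real powers of a base [x >= 0].  The standard library's [Rpower] is
    [exp (a * ln x)] with the junk value [ln 0 = 0], so [Rpower 0 a = 1];
    here [0 ^ 0 = 1] and [0 ^ a = 0] for [a <> 0].  Only exponents [a >= 0]
    are ever used at [x = 0]. *)
Definition rpow (x a : R) : R :=
  if Req_EM_T x 0 then (if Req_EM_T a 0 then 1 else 0) else Rpower x a.

Definition Cexp (z : C) : C :=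
  (exp (Re z) * cos (Im z), exp (Re z) * sin (Im z)).

Definition Carg (z : C) : R :=
  iota (T := R_CompleteNormedModule) (fun t : R =>
    - PI < t <= PI /\ z = (Cmod z * cos t, Cmod z * sin t)).

Definition Clog (z : C) : C := (ln (Cmod z), Carg z).

Definition Cpower (z : C) (a : R) : C := Cexp (RtoC a * Clog z)%C.

(** Improper integrals over [(a, b)] and [(0, +oo)]; they agree with the
    ordinary Riemann integral when the latter exists. *)
Definition int_oo {V : CompleteNormedModule R_AbsRing} (f : R -> V) (a b : R) : V :=
  RInt_gen f (at_right a) (at_left b).

Definition Gamma (x : R) : R :=
  RInt_gen (V := R_CompleteNormedModule)
    (fun t => Rpower t (x - 1) * exp (- t)) (at_right 0) (Rbar_locally p_infty).

Definition segment (a b x : R) : Prop := a <= x <= b.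

(** Derivative of a function on [D] (one-sided at the end points of an
    interval); with [D] the whole line this is [is_derive]. *)
Definition is_derive_on {V : NormedModule R_AbsRing} (D : R -> Prop)
    (f : R -> V) (x : R) (l : V) : Prop :=
  filterdiff f (within D (locally x)) (fun h : R => scal h l).

Definition Derive_on {V : CompleteNormedModule R_AbsRing} (D : R -> Prop)
    (f : R -> V) (x : R) : V :=
  iota (is_derive_on D f x).

Definition C1_on {V : NormedModule R_AbsRing} (a b : R) (f : R -> V) : Prop :=
  exists f' : R -> V,
    (forall x, segment a b x -> is_derive_on (segment a b) f x (f' x)) /\
    continuous_on (segment a b) f'.

Definition assumption_P (p1 p2 rho1 rho2 : R) (psi : R -> R) : Prop :=
  C1_on (V := R_NormedModule) p1 p2 psi /\
  exists psit : R -> R,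
    C1_on (V := R_NormedModule) p1 p2 psit /\
    (forall p, p1 <= p <= p2 -> 0 < psit p) /\
    (forall p, p1 <= p <= p2 ->
       is_derive_on (V := R_NormedModule) (segment p1 p2) psi p
         (rpow (p - p1) (rho1 - 1) * rpow (p2 - p) (rho2 - 1) * psit p)).

Definition assumption_A (p1 p2 mu1 mu2 : R) (U : R -> C) : Prop :=
  exists ut : R -> C,
    C1_on (V := C_R_NormedModule) p1 p2 ut /\
    (forall p, p1 < p < p2 ->
       U p = (RtoC (rpow (p - p1) (mu1 - 1) * rpow (p2 - p) (mu2 - 1)) * ut p)%C) /\
    (mu1 <> 1 -> ut p1 <> RtoC 0) /\
    (mu2 <> 1 -> ut p2 <> RtoC 0).

(** The index [j = 1, 2]; families such as [p_j], [rho_j], [mu_j] are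
    functions on it. *)
Inductive index : Set := one | two.

Definition pair_of {T : Type} (x1 x2 : T) (j : index) : T :=
  match j with one => x1 | two => x2 end.

(** [sgn j = (-1)^(j+1)], so that [- sgn j = (-1)^j]. *)
Definition sgn (j : index) : R := pair_of 1 (-1) j.

Definition on_I (p : index -> R) (q : R) (j : index) : R -> Prop :=
  pair_of (segment (p one) q) (segment q (p two)) j.

Definition phi (p : index -> R) (psi : R -> R) (rho : index -> R)
    (j : index) (x : R) : R :=
  rpow (pair_of (psi x - psi (p one)) (psi (p two) - psi x) j) (/ rho j).

Definition s_end (p : index -> R) (psi : R -> R) (rho : index -> R) (q : R)
    (j : index) : R :=
  phi p psi rho j q.

(** Inverse of [phi j : I_j -> [0, s_j]]. *)
Definition phi_inv (p : index -> R) (psi : R -> R) (rho : index -> R) (q : R)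
    (j : index) (s : R) : R :=
  iota (T := R_CompleteNormedModule)
    (fun x : R => on_I p q j x /\ phi p psi rho j x = s).

Definition k_pos (p : index -> R) (psi : R -> R) (U : R -> C)
    (rho mu : index -> R) (q : R) (j : index) (s : R) : C :=
  (U (phi_inv p psi rho q j s) * RtoC (rpow s (1 - mu j))
   * RtoC (Derive_on (V := R_CompleteNormedModule)
             (segment 0 (s_end p psi rho q j)) (phi_inv p psi rho q j) s))%C.

(** [k_pos], which makes sense on [(0, s_j]], extended by continuity to [0]. *)
Definition k (p : index -> R) (psi : R -> R) (U : R -> C)
    (rho mu : index -> R) (q : R) (j : index) (s : R) : C :=
  if Req_EM_T s 0 then
    iota (T := C_R_CompleteNormedModule) (fun l : C =>
      filterlim (k_pos p psi U rho mu q j) (at_right 0) (locally l))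
  else k_pos p psi U rho mu q j s.

Definition k' (p : index -> R) (psi : R -> R) (U : R -> C)
    (rho mu : index -> R) (q : R) (j : index) (s : R) : C :=
  Derive_on (V := C_R_CompleteNormedModule)
    (segment 0 (s_end p psi rho q j)) (k p psi U rho mu q j) s.

(** Integral of [f] along the half-line
    [{ s + t e^((-1)^(j+1) i pi / (2 rho_j)) | t >= 0 }]. *)
Definition int_Lambda (rho : index -> R) (j : index) (s : R) (f : C -> C) : C :=
  let e := Cexp (RtoC (sgn j) * Ci * RtoC (PI / (2 * rho j)))%C in
  RInt_gen (V := C_R_CompleteNormedModule)
    (fun t : R => (f (RtoC s + RtoC t * e) * e)%C)
    (at_point 0) (Rbar_locally p_infty).

(** [e^((-1)^(j+1) i omega z^(rho_j))] *)
Definition osc (rho : index -> R) (j : index) (omega : R) (z : C) : C :=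
  Cexp (RtoC (sgn j) * Ci * RtoC omega * Cpower z (rho j))%C.

Definition Theta (rho mu : index -> R) (j : index) : C :=
  (RtoC (sgn j / rho j * Gamma (mu j / rho j))
   * Cexp (RtoC (sgn j) * Ci * RtoC (PI / 2 * (mu j / rho j))))%C.

Definition phi_osc (rho mu : index -> R) (j : index) (s omega : R) : C :=
  (- int_Lambda rho j s (fun z => Cpower z (mu j - 1) * osc rho j omega z))%C.

(** [e^(i omega psi(x))] *)
Definition e_psi (psi : R -> R) (omega x : R) : C :=
  Cexp (Ci * RtoC omega * RtoC (psi x))%C.

Definition A_term (p : index -> R) (psi : R -> R) (U : R -> C)
    (rho mu : index -> R) (q : R) (j : index) (omega : R) : C :=
  (e_psi psi omega (p j) * k p psi U rho mu q j 0 * Theta rho mu j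
   * RtoC (Rpower omega (- (mu j / rho j))))%C.

Definition R1_term (p : index -> R) (psi : R -> R) (U : R -> C)
    (rho mu : index -> R) (q : R) (j : index) (omega : R) : C :=
  (RtoC (- sgn j) * e_psi psi omega (p j)
   * int_oo (V := C_R_CompleteNormedModule)
       (fun s => phi_osc rho mu j s omega * k' p psi U rho mu q j s)
       0 (s_end p psi rho q j))%C.

(** The boundary term at [s_j] is [(-1)^j k_j(s_j)] times the integral of
    [z^(mu-1) e^((-1)^(j+1) i omega z^rho)] over the half-line.  Integrating
    that by parts gives the factor [- 1 / ((-1)^(j+1) i)], hence
    [(-1)^j * (- 1 / ((-1)^(j+1) i)) = - i] for both values of [j].  A factor
    [(-1)^j i], which differs for [j = 2] only, would make the expansion of
    the integral false. *)
Definition R2_term (p : index -> R) (psi : R -> R) (U : R -> C)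
    (rho mu : index -> R) (q : R) (j : index) (omega : R) : C :=
  (- Ci * RtoC ((mu j - rho j) / rho j) * e_psi psi omega (p j)
   * k p psi U rho mu q j (s_end p psi rho q j)
   * int_Lambda rho j (s_end p psi rho q j)
       (fun z => Cpower z (mu j - rho j - 1) * osc rho j omega z)
   * RtoC (/ omega))%C.

(* Main.v *)
Require Import Defs.
From Stdlib Require Import Lra.
From mathcomp Require Import ssreflect.
Open Scope R_scope.

(** Near the end point [p_j] one substitutes [s = phi_j(p)], which turns the
    integrand into [k_j(s) s^(mu_j - 1) e^(+- i omega s^rho_j)].  The integral of
    [z^(mu_j - 1) e^(+- i omega z^rho_j)] along [Lambda^(j)(s)] is a primitive in
    [s] of minus its integrand at [s] (Cauchy's theorem), it is of size
    [s^(mu_j - 1) omega^(-1/rho_j)] because [|e^(+- i omega z^rho_j)| <= e^(-omega t^rho_j)]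
    at [z = s + t e^(+- i pi/(2 rho_j))], and as [s -> 0] it tends to a Gamma
    integral.  Integrating by parts in [s] gives [A^(j)], [R_1^(j)] and a boundary term
    at [q]; a second integration by parts along the half-line splits that term into
    [R_2^(j)] and a quantity [+- U(q) e^(i omega psi(q)) / (i omega psi'(q))], which
    cancels between [j = 1] and [j = 2]. *)

(** * Complex exponential, logarithm and powers along curves *)

(** The decay along the half-lines holds for every real rho_j >= 1 because, at fixed t, +- Im
    z^rho_j does not decrease with s, and at s = 0 it is exactly t^rho_j: the power turns the angle
    pi/(2 rho_j) into a right angle. Cauchy's theorem is proved by hand: the integrand depends only
    on s + t e, so its s-derivative times e is a t-derivative, and a truncated integral varies with
    s only through the values at its two ends. The obstacle is s = 0, where k_j is a product of
    factors that are singular one by one. In the distance y from p_j one has +- (psi - psi(p_j)) =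
    y^rho_j r(y), where r has a positive limit and a bounded derivative at 0; all powers of y then
    cancel in k_j. A limit and a bounded derivative of k_j at 0+ suffice for the integration by
    parts, since s^(mu_j - 1) is integrable. One computation serves both ends: y reverses the
    orientation at p_2, and the reversal survives only as a factor (-1)^(j+1) in k_j. *)

Lemma is_derive_C_pair (f : R -> C) (x : R) (l : C) :
  is_derive (V := C_R_NormedModule) f x l <->
  is_derive (fun t => Re (f t)) x (Re l) /\ is_derive (fun t => Im (f t)) x (Im l).
Proof.
split => [H | [H1 H2]].
- split.
  + exact: (filterdiff_comp' f (fun z : C_R_NormedModule => Re z) x _ _ H
      (filterdiff_linear _ is_linear_fst)).
  + exact: (filterdiff_comp' f (fun z : C_R_NormedModule => Im z) x _ _ H
      (filterdiff_linear _ is_linear_snd)).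
- have K : is_derive (V := C_R_NormedModule) (fun t => (Re (f t), Im (f t))) x l.
    have Hid : filterdiff (fun t : C_R_NormedModule => (fst t, snd t) : C_R_NormedModule)
       (locally (Re (f x), Im (f x))) (fun t => (fst t, snd t)).
      apply: (filterdiff_ext (fun t => t)); first by case.
      apply: (filterdiff_ext_lin _ (fun t => t)); last by case.
      exact: filterdiff_id.
    apply: (filterdiff_ext_lin _ _ _ (filterdiff_comp'_2 (fun t => Re (f t)) (fun t => Im (f t))
       (fun u v => (u, v) : C_R_NormedModule) x _ _ _ H1 H2 Hid)).
    by move=> y; case: l H1 H2 {Hid}.
  by apply: is_derive_ext K => t; case: (f t).
Qed.

Lemma is_derive_Cmult (f g : R -> C) (x : R) (df dg : C) :
  is_derive (V := C_R_NormedModule) f x df ->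
  is_derive (V := C_R_NormedModule) g x dg ->
  is_derive (V := C_R_NormedModule) (fun t => f t * g t)%C x (df * g x + f x * dg)%C.
Proof.
move=> /is_derive_C_pair [f1 f2] /is_derive_C_pair [g1 g2].
apply/is_derive_C_pair; split; rewrite /Re /Im /=.
- evar_last.
    apply: is_derive_minus; apply: is_derive_mult; eauto; exact: Rmult_comm.
  rewrite /minus /plus /opp /mult /= /Re /Im; ring.
- evar_last.
    apply: is_derive_plus; apply: is_derive_mult; eauto; exact: Rmult_comm.
  rewrite /minus /plus /opp /mult /= /Re /Im; ring.
Qed.

Lemma is_derive_Cmult_l (c : C) (g : R -> C) (x : R) (dg : C) :
  is_derive (V := C_R_NormedModule) g x dg ->
  is_derive (V := C_R_NormedModule) (fun t => c * g t)%C x (c * dg)%C.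
Proof.
move=> Hg; evar_last.
  apply: is_derive_Cmult Hg; exact: is_derive_const.
change (RtoC 0 * g x + c * dg = c * dg)%C; ring.
Qed.

Lemma is_derive_Cplus (f g : R -> C) (x : R) (df dg : C) :
  is_derive (V := C_R_NormedModule) f x df ->
  is_derive (V := C_R_NormedModule) g x dg ->
  is_derive (V := C_R_NormedModule) (fun t => f t + g t)%C x (df + dg)%C.
Proof. exact: is_derive_plus. Qed.

Lemma is_derive_RtoC (f : R -> R) (x df : R) :
  is_derive f x df ->
  is_derive (V := C_R_NormedModule) (fun t => RtoC (f t)) x (RtoC df).
Proof.
move=> H; apply/is_derive_C_pair; split => //=; exact: is_derive_const.
Qed.

Lemma Cmod_Cexp (z : C) : Cmod (Cexp z) = exp (Re z).
Proof.
rewrite /Cmod /Cexp /=.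
replace (_ + _) with (Rsqr (exp (Re z))).
  apply: sqrt_Rsqr; exact/Rlt_le/exp_pos.
have := sin2_cos2 (Im z); rewrite /Rsqr => H.
transitivity (exp (Re z) * exp (Re z) * (sin (Im z) * sin (Im z) + cos (Im z) * cos (Im z))).
  rewrite H; ring.
ring.
Qed.

Lemma Cexp_plus (z w : C) : Cexp (z + w)%C = (Cexp z * Cexp w)%C.
Proof.
rewrite /Cexp /Cmult /=; congr (_, _); rewrite /Re /Im exp_plus ?cos_plus ?sin_plus; ring.
Qed.

Lemma Cexp_RtoC (x : R) : Cexp (RtoC x) = RtoC (exp x).
Proof. by rewrite /Cexp /RtoC /= cos_0 sin_0 Rmult_1_r Rmult_0_r. Qed.

Lemma is_derive_Cexp (g : R -> C) (x : R) (dg : C) :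
  is_derive (V := C_R_NormedModule) g x dg ->
  is_derive (V := C_R_NormedModule) (fun t => Cexp (g t)) x (dg * Cexp (g x))%C.
Proof.
move=> /is_derive_C_pair [H1 H2]; apply/is_derive_C_pair.
rewrite /Cexp; split; cbn [Re Im fst snd].
- evar_last.
    apply: is_derive_mult; last exact: Rmult_comm.
    + apply: (is_derive_comp exp); [exact: is_derive_exp | exact: H1].
    + apply: (is_derive_comp cos); [exact: is_derive_cos | exact: H2].
  rewrite /plus /mult /scal /= /mult /= /Re /Im; ring.
- evar_last.
    apply: is_derive_mult; last exact: Rmult_comm.
    + apply: (is_derive_comp exp); [exact: is_derive_exp | exact: H1].
    + apply: (is_derive_comp sin); [exact: is_derive_sin | exact: H2].
  rewrite /plus /mult /scal /= /mult /= /Re /Im; ring.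
Qed.

(** The complement of [(-oo, 0]]. *)
Definition slit (z : C) : Prop := 0 < Cmod z + Re z.

Lemma slit_Im (z : C) : Im z <> 0 -> slit z.
Proof.
move=> H; rewrite /slit.
have H1 : (Re z) ^ 2 < Cmod z ^ 2.
  have := Cmod2_alt z; have := pow2_gt_0 _ H; lra.
have H2 := Cmod_ge_0 z.
nra.
Qed.

Lemma slit_Re (z : C) : 0 < Re z -> slit z.
Proof. move=> H; rewrite /slit; have := Cmod_ge_0 z; lra. Qed.

Lemma slit_Cmod (z : C) : slit z -> 0 < Cmod z.
Proof.
rewrite /slit => H; have := re_le_Cmod z; have := Rle_abs (Re z); lra.
Qed.

Lemma slit_neq_0 (z : C) : slit z -> z <> 0.
Proof. by move=> /slit_Cmod /Cmod_gt_0. Qed.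

(** Equal sines and cosines give cos (a - b) = 1, hence sin ((a - b) / 2) = 0, and |a - b| / 2 < PI
    then leaves only a = b. *)
Lemma polar_unique (a b : R) :
  - PI < a <= PI -> - PI < b <= PI -> cos a = cos b -> sin a = sin b -> a = b.
Proof.
move=> Ha Hb Hc Hs.
have H1 : cos (a - b) = 1.
  rewrite cos_minus Hc Hs; have := sin2_cos2 b; rewrite /Rsqr; lra.
have H2 : sin ((a - b) / 2) = 0.
  have := cos_2a_sin ((a - b) / 2).
  rewrite (_ : 2 * ((a - b) / 2) = a - b) ?H1; last field.
  move=> H; have : sin ((a - b) / 2) * sin ((a - b) / 2) = 0 by lra.
  by case/Rmult_integral.
case: (Rtotal_order a b) => [H | [// | H]].
- have : 0 < sin ((b - a) / 2) by apply: sin_gt_0; lra.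
  rewrite (_ : (b - a) / 2 = - ((a - b) / 2)) ?sin_neg; [lra | field].
- have : 0 < sin ((a - b) / 2) by apply: sin_gt_0; lra.
  lra.
Qed.

Lemma Cmod_polar (r t : R) : 0 <= r -> Cmod (r * cos t, r * sin t) = r.
Proof.
move=> H; rewrite /Cmod /=.
replace (_ + _) with (Rsqr r); first exact: sqrt_Rsqr.
have := sin2_cos2 t; rewrite /Rsqr => H1.
transitivity (r * r * (sin t * sin t + cos t * cos t)); [rewrite H1; ring | ring].
Qed.

Lemma Clog_polar (r t : R) :
  0 < r -> - PI < t <= PI -> Clog (r * cos t, r * sin t) = (ln r, t).
Proof.
move=> Hr Ht.
have Hm : Cmod (r * cos t, r * sin t) = r by apply: Cmod_polar; lra.
rewrite /Clog /Carg Hm; congr (_, _).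
apply: iota_unique => [y [Hy [Hc Hs]] |]; last by split.
apply: polar_unique => //; apply: (Rmult_eq_reg_l r); lra.
Qed.

(** Rational parametrisation of the circle by u = tan (t / 2), used for the half-angle form of the
    argument. *)
Lemma cos_atan_double (u : R) : cos (2 * atan u) = (1 - u ^ 2) / (1 + u ^ 2).
Proof.
rewrite cos_2a_cos cos_atan.
have H : 0 < 1 + Rsqr u by have := Rle_0_sqr u; lra.
have -> : 2 * (1 / sqrt (1 + Rsqr u)) * (1 / sqrt (1 + Rsqr u)) = 2 / (sqrt (1 + Rsqr u) * sqrt (1 + Rsqr u)).
  field; have := sqrt_lt_R0 _ H; lra.
rewrite sqrt_sqrt /Rsqr; last by rewrite /Rsqr in H; lra.
rewrite /Rsqr in H; field; lra.
Qed.

Lemma sin_atan_double (u : R) : sin (2 * atan u) = 2 * u / (1 + u ^ 2).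
Proof.
rewrite sin_2a sin_atan cos_atan.
have H : 0 < 1 + Rsqr u by have := Rle_0_sqr u; lra.
have -> : 2 * (u / sqrt (1 + Rsqr u)) * (1 / sqrt (1 + Rsqr u)) = 2 * u / (sqrt (1 + Rsqr u) * sqrt (1 + Rsqr u)).
  field; have := sqrt_lt_R0 _ H; lra.
rewrite sqrt_sqrt /Rsqr; last by rewrite /Rsqr in H; lra.
rewrite /Rsqr in H; field; lra.
Qed.

(** The argument 2 arctan (Im z / (|z| + Re z)) is a single formula on the whole slit plane, so
    continuity and differentiability of [Clog] need no case distinction by quadrant; positivity of
    the denominator is exactly [slit]. *)
Lemma slit_polar (z : C) (t := 2 * atan (Im z / (Cmod z + Re z))) :
  slit z -> Cmod z * cos t = Re z /\ Cmod z * sin t = Im z.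
Proof.
rewrite {}/t => Hz; have Hm := slit_Cmod z Hz; rewrite /slit in Hz.
have H2 := Cmod2_alt z.
set u := Im z / (Cmod z + Re z).
have Hu : 1 + u ^ 2 = 2 * Cmod z / (Cmod z + Re z).
  rewrite /u; transitivity ((Cmod z ^ 2 + 2 * Cmod z * Re z + (Re z ^ 2 + Im z ^ 2)) / (Cmod z + Re z) ^ 2).
    field; lra.
  rewrite -H2; field; lra.
have Hu' : 1 - u ^ 2 = 2 * Re z / (Cmod z + Re z).
  transitivity (2 - (1 + u ^ 2)); [ring | rewrite Hu; field; lra].
rewrite cos_atan_double sin_atan_double Hu' Hu /u; split; field; lra.
Qed.

Lemma Clog_slit (z : C) :
  slit z -> Clog z = (ln (Cmod z), 2 * atan (Im z / (Cmod z + Re z))).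
Proof.
move=> Hz; have Hm := slit_Cmod z Hz; have [Ec Es] := slit_polar z Hz.
set u := Im z / (Cmod z + Re z) in Ec Es *.
have := Clog_polar (Cmod z) (2 * atan u) Hm.
rewrite Ec Es (_ : (Re z, Im z) = z); last by case: (z).
apply; have := atan_bound u; lra.
Qed.

Lemma Cexp_Clog (z : C) : slit z -> Cexp (Clog z) = z.
Proof.
move=> Hz; have Hm := slit_Cmod z Hz; have [Ec Es] := slit_polar z Hz.
by rewrite Clog_slit // /Cexp; cbn [Re Im fst snd]; rewrite exp_ln // Ec Es; case: (z).
Qed.

Lemma continuous_C_pair (T : UniformSpace) (f g : T -> R) (x : T) :
  continuous f x -> continuous g x ->
  continuous (U := C_UniformSpace) (fun t => (f t, g t)) x.
Proof.
move=> Hf Hg; apply: (continuous_comp_2 f g (fun u v => (u, v)) x Hf Hg).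
by apply: (continuous_ext (fun z => z)); [case | exact: continuous_id].
Qed.

Lemma continuous_Re (z : C) : continuous Re z.
Proof. exact: continuous_fst. Qed.

Lemma continuous_Im (z : C) : continuous Im z.
Proof. exact: continuous_snd. Qed.

Lemma continuous_Cmod (z : C) : continuous Cmod z.
Proof.
apply: (continuous_ext (fun z : C_R_NormedModule => norm z)) => [w |].
  by rewrite -Cmod_norm.
exact: (filterlim_norm (V := C_R_NormedModule)).
Qed.

Lemma continuous_Cexp (z : C) : continuous Cexp z.
Proof.
apply: continuous_C_pair; apply: continuous_mult.
- apply: continuous_comp; [exact: continuous_Re | exact: continuous_exp].
- apply: continuous_comp; [exact: continuous_Im | exact: continuous_cos].
- apply: continuous_comp; [exact: continuous_Re | exact: continuous_exp].
- apply: continuous_comp; [exact: continuous_Im | exact: continuous_sin].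
Qed.

Lemma locally_slit (z : C) : slit z -> locally z slit.
Proof.
move=> H.
apply: (continuous_plus Cmod Re z (continuous_Cmod z) (continuous_Re z) (fun x => 0 < x)).
exact: open_gt.
Qed.

Lemma continuous_Clog (z : C) : slit z -> continuous Clog z.
Proof.
move=> H.
apply: (continuous_ext_loc _ (fun z => (ln (Cmod z), 2 * atan (Im z / (Cmod z + Re z))))).
  by apply: filter_imp (locally_slit z H) => w Hw; rewrite Clog_slit.
apply: continuous_C_pair.
  apply: continuous_comp; first exact: continuous_Cmod.
  apply: (ex_derive_continuous (V := R_NormedModule)); exists (/ Cmod z); exact: is_derive_ln (slit_Cmod _ H).
apply: continuous_scal_r.
apply: continuous_comp.
  apply: continuous_mult; first exact: continuous_Im.
  apply: continuous_comp; last by apply: continuous_Rinv; rewrite /slit in H; lra.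
  apply: continuous_plus; [exact: continuous_Cmod | exact: continuous_Re].
apply: continuous_atan.
Qed.

Lemma is_derive_Clog (g : R -> C) (x : R) (dg : C) :
  slit (g x) ->
  is_derive (V := C_R_NormedModule) g x dg ->
  is_derive (V := C_R_NormedModule) (fun t => Clog (g t)) x (dg / g x)%C.
Proof.
move=> Hs Hg.
have Hloc : locally x (fun t => slit (g t)).
  apply: (ex_derive_continuous (V := C_R_NormedModule) g x); first by exists dg.
  exact: locally_slit.
have Hm := slit_Cmod _ Hs.
have Hm2 := Cmod2_alt (g x).
move: Hg => /is_derive_C_pair [H1 H2].
have Hmod : is_derive (fun t => Cmod (g t)) x
   ((Re (g x) * Re dg + Im (g x) * Im dg) / Cmod (g x)).
  evar_last.
    apply: is_derive_sqrt.
      apply: is_derive_plus; (apply: (is_derive_pow _ 2); eassumption).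
    by have := pow_lt _ 2 Hm; rewrite Hm2 /Re /Im.
  change (sqrt _) with (Cmod (g x)).
  rewrite /plus /= /Re /Im; field; lra.
apply/is_derive_C_pair; rewrite /slit in Hs.
have HC : (dg / g x)%C = ((Re (g x) * Re dg + Im (g x) * Im dg) / Cmod (g x) ^ 2, (Re (g x) * Im dg - Im (g x) * Re dg) / Cmod (g x) ^ 2).
  rewrite Hm2 /Cdiv /Cmult /Cinv /Re /Im /=.
  by congr (_, _); field; move: (pow_lt _ 2 Hm); rewrite Hm2 /Re /Im /= => ?; lra.
rewrite {}HC; split; cbn [Re Im fst snd].
- apply: (is_derive_ext_loc (fun t => ln (Cmod (g t)))).
    by apply: filter_imp Hloc => t Ht; rewrite Clog_slit.
  evar_last.
    apply: (is_derive_comp ln); last exact: Hmod.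
    exact: is_derive_ln.
  rewrite /scal /= /mult /=; field; lra.
- apply: (is_derive_ext_loc (fun t => 2 * atan (Im (g t) / (Cmod (g t) + Re (g t))))).
    by apply: filter_imp Hloc => t Ht; rewrite Clog_slit.
  evar_last.
    apply: is_derive_scal; apply: (is_derive_comp atan); first exact: is_derive_atan.
    apply: is_derive_div; [exact: H2 | | lra].
    apply: is_derive_plus; [exact: Hmod | exact: H1].
  rewrite /plus /scal /= /mult /=.
  set a := Re (g x) in Hs Hm Hm2 *; set b := Im (g x) in Hs Hm Hm2 *; set r := Cmod (g x) in Hs Hm Hm2 *.
  (* The squared half-angle tangent is (r^2 - a^2) / (r + a)^2 = (r - a) / (r + a); with b
     eliminated this way, what remains is a polynomial identity. *)
  have K : (b / (r + a)) * (b / (r + a)) = 2 * r / (r + a) - 1.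
    transitivity ((r ^ 2 - a ^ 2) / (r + a) ^ 2); [rewrite Hm2; field; lra | field; lra].
  rewrite /Rsqr K.
  apply: (Rmult_eq_reg_r (r ^ 2 * (r + a))); last by apply: Rgt_not_eq; apply: Rmult_lt_0_compat; [exact: pow_lt | lra].
  transitivity (r * Im dg * (r + a) - b * (Re dg * r + (a * Re dg + b * Im dg))).
    field; lra.
  transitivity ((a * Im dg - b * Re dg) * (r + a)); last by (field; lra).
  have Hb : b ^ 2 = r ^ 2 - a ^ 2 by lra.
  transitivity (r ^ 2 * Im dg + r * a * Im dg - b * Re dg * r - b * a * Re dg - b ^ 2 * Im dg); first ring.
  rewrite Hb; ring.
Qed.

Lemma Cmod_Cpower (z : C) (a : R) : Cmod (Cpower z a) = Rpower (Cmod z) a.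
Proof. by rewrite /Cpower Cmod_Cexp /= Rmult_0_l Rminus_0_r. Qed.

Lemma Cpower_plus (z : C) (a b : R) : Cpower z (a + b) = (Cpower z a * Cpower z b)%C.
Proof. rewrite /Cpower -Cexp_plus RtoC_plus; congr Cexp; ring. Qed.

Lemma Cpower_1 (z : C) : slit z -> Cpower z 1 = z.
Proof. by move=> H; rewrite /Cpower Cmult_1_l Cexp_Clog. Qed.

Lemma Cpower_minus_1 (z : C) (a : R) : slit z -> Cpower z (a - 1) = (Cpower z a / z)%C.
Proof.
move=> H.
have -> : Cpower z a = (Cpower z (a - 1) * Cpower z 1)%C.
  by rewrite -Cpower_plus; congr Cpower; ring.
rewrite Cpower_1 //; field; exact: slit_neq_0.
Qed.

Lemma Cpower_polar (r t a : R) :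
  0 < r -> - PI < t <= PI ->
  Cpower (r * cos t, r * sin t) a = (RtoC (Rpower r a) * Cexp (0%R, a * t)%R)%C.
Proof.
move=> Hr Ht; rewrite /Cpower Clog_polar // /Rpower -Cexp_RtoC -Cexp_plus; congr Cexp.
by congr (_, _); rewrite /= ?Rmult_1_l; ring.
Qed.

Lemma Cpower_RtoC (x a : R) : 0 < x -> Cpower (RtoC x) a = RtoC (Rpower x a).
Proof.
move=> Hx; have := Cpower_polar x 0 a Hx.
rewrite cos_0 sin_0 Rmult_1_r !Rmult_0_r (_ : (0, 0) = RtoC 0) // Cexp_RtoC exp_0 Cmult_1_r => H.
apply: H; have := PI_RGT_0; lra.
Qed.

Lemma is_derive_Cpower (g : R -> C) (a x : R) (dg : C) :
  slit (g x) ->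
  is_derive (V := C_R_NormedModule) g x dg ->
  is_derive (V := C_R_NormedModule) (fun t => Cpower (g t) a) x
    (a * Cpower (g x) (a - 1) * dg)%C.
Proof.
move=> Hs Hg; rewrite Cpower_minus_1 //; evar_last.
  exact: is_derive_Cexp (is_derive_Cmult_l (RtoC a) _ _ _ (is_derive_Clog g x dg Hs Hg)).
change ((a * (dg / g x) * Cpower (g x) a)%C = (a * (Cpower (g x) a / g x) * dg)%C).
field; exact: slit_neq_0.
Qed.

Lemma continuous_Cmult (T : UniformSpace) (f g : T -> C) (x : T) :
  continuous f x -> continuous g x -> continuous (fun t => f t * g t)%C x.
Proof.
move=> Hf Hg.
have f1 := continuous_comp f Re x Hf (continuous_Re _).
have f2 := continuous_comp f Im x Hf (continuous_Im _).
have g1 := continuous_comp g Re x Hg (continuous_Re _).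
have g2 := continuous_comp g Im x Hg (continuous_Im _).
apply: continuous_C_pair.
- apply: (continuous_minus (V := R_NormedModule)); exact: (continuous_mult (K := R_AbsRing)).
- apply: (continuous_plus (V := R_NormedModule)); exact: (continuous_mult (K := R_AbsRing)).
Qed.

Lemma continuous_Cplus (T : UniformSpace) (f g : T -> C) (x : T) :
  continuous f x -> continuous g x -> continuous (fun t => f t + g t)%C x.
Proof. exact: (continuous_plus (V := C_R_NormedModule)). Qed.

Lemma continuous_RtoC (T : UniformSpace) (f : T -> R) (x : T) :
  continuous f x -> continuous (fun t => RtoC (f t)) x.
Proof.
move=> H; apply: continuous_C_pair => //; exact: continuous_const.
Qed.

Lemma continuous_Cpower (z : C) (a : R) : slit z -> continuous (fun z => Cpower z a) z.
Proof.
move=> H; apply: continuous_comp; last exact: continuous_Cexp.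
apply: continuous_Cmult; [exact: continuous_const | exact: continuous_Clog].
Qed.

(** * Improper integrals from primitives *)

Lemma locally_interval (a b x : R) : a < x < b -> locally x (fun t => a < t < b).
Proof.
move=> H; have He : 0 < Rmin (x - a) (b - x) by apply: Rmin_pos; lra.
exists (mkposreal _ He) => t; rewrite /ball /= /AbsRing_ball /= /abs /minus /plus /opp /= => /Rabs_def2 Ht.
have H1 := Rmin_l (x - a) (b - x); have H2 := Rmin_r (x - a) (b - x); lra.
Qed.

Lemma norm_C (z : C) : norm (V := C_R_NormedModule) z = Cmod z.
Proof. by rewrite Cmod_norm. Qed.

Lemma at_right_0_intro (P : R -> Prop) (eps : R) :
  0 < eps -> (forall y, 0 < y < eps -> P y) -> at_right 0 P.
Proof.
move=> He H; exists (mkposreal _ He) => y; rewrite /ball /= /AbsRing_ball /= /abs /minus /plus /opp /= => /Rabs_def2 Hy Hy0.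
apply: H; lra.
Qed.

Lemma at_right_0_elim (P : R -> Prop) :
  at_right 0 P -> exists eps, 0 < eps /\ forall y, 0 < y < eps -> P y.
Proof.
move=> [eps H]; exists eps; split; first exact: cond_pos.
move=> y Hy; apply: H; last lra.
rewrite /ball /= /AbsRing_ball /= /abs /minus /plus /opp /=; rewrite Rabs_pos_eq; lra.
Qed.

Lemma filterlim_at_right_0_id : filterlim (fun y : R => y) (at_right 0) (locally 0).
Proof. exact: filter_le_within. Qed.

Lemma filterlim_at_right_0_linear (f : R -> R) (l M : R) :
  at_right 0 (fun y => Rabs (f y - l) <= M * y) -> filterlim f (at_right 0) (locally l).
Proof.
move=> H.
have K (c : R) : filterlim (fun y => l + c * y) (at_right 0) (locally l).
  rewrite [X in locally X](_ : l = l + c * 0); last ring.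
  have K1 : continuous (fun y => l + c * y) 0.
    by apply: (ex_derive_continuous (V := R_NormedModule)); auto_derive.
  exact: filterlim_comp filterlim_at_right_0_id K1.
apply: (filterlim_le_le (fun y => l + (- M) * y) f (fun y => l + M * y) (Finite l)) => //; try exact: K.
by apply: filter_imp H => y /Rabs_le_between Hy; lra.
Qed.

Lemma filterlim_Rabs (T : Type) (F : (T -> Prop) -> Prop) (f : T -> R) (l eps : R) :
  0 < eps -> filterlim f F (locally l) -> F (fun x => Rabs (f x - l) < eps).
Proof. by move=> He H; exact: (H _ (locally_ball l (mkposreal _ He))). Qed.

Lemma filterlim_minus_const (F : (R -> Prop) -> Prop) (FF : Filter F) (f : R -> R) (l c : R) :
  filterlim f F (locally l) -> filterlim (fun x => f x - c) F (locally (l - c)).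
Proof.
move=> H.
apply: (filterlim_comp_2 f (fun _ => opp c) plus (G := locally l) (H := locally (opp c)) (I := locally (plus l (opp c)))) => //.
- exact: filterlim_const.
- exact: (filterlim_plus (V := R_NormedModule)).
Qed.

Lemma filterlim_const_mult (F : (R -> Prop) -> Prop) (FF : Filter F) (f : R -> R) (l c : R) :
  filterlim f F (locally l) -> filterlim (fun x => c * f x) F (locally (c * l)).
Proof.
move=> H; refine (filterlim_comp _ _ _ f (Rmult c) _ _ _ H _); exact: (filterlim_Rbar_mult_l c l).
Qed.

Lemma filterlim_Rplus (F : (R -> Prop) -> Prop) (FF : Filter F) (f g : R -> R) (l m : R) :
  filterlim f F (locally l) -> filterlim g F (locally m) ->
  filterlim (fun y => f y + g y) F (locally (l + m)).
Proof.
move=> Hf Hg; exact: (filterlim_comp_2 f g Rplus Hf Hg (filterlim_plus (V := R_NormedModule) l m)).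
Qed.

Lemma filterlim_Rmult (f g : R -> R) (F : (R -> Prop) -> Prop) (FF : Filter F) (l m : R) :
  filterlim f F (locally l) -> filterlim g F (locally m) ->
  filterlim (fun y => f y * g y) F (locally (l * m)).
Proof.
move=> Hf Hg; exact: (filterlim_comp_2 f g Rmult Hf Hg (filterlim_mult (K := R_AbsRing) l m)).
Qed.

Lemma filterlim_RtoC (F : (R -> Prop) -> Prop) (f : R -> R) (l : R) :
  filterlim f F (locally l) -> filterlim (fun y => RtoC (f y)) F (locally (RtoC l)).
Proof.
move=> H.
have K : continuous (U := C_UniformSpace) RtoC l by apply: continuous_RtoC; exact: continuous_id.
exact: filterlim_comp H K.
Qed.

Lemma filterlim_Cmult (F : (R -> Prop) -> Prop) (FF : Filter F) (f g : R -> C) (l m : C) :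
  filterlim f F (locally l) -> filterlim g F (locally m) ->
  filterlim (fun y => f y * g y)%C F (locally (l * m)%C).
Proof.
move=> Hf Hg.
have K : continuous (U := C_UniformSpace) (fun z : C * C => fst z * snd z)%C (l, m).
  by apply: continuous_Cmult; [exact: continuous_fst | exact: continuous_snd].
apply: (filterlim_comp_2 f g Cmult Hf Hg).
apply: filterlim_filter_le_1 K => Q [e He].
apply: (Filter_prod _ _ _ (ball l e) (ball m e)); try exact: locally_ball.
by move=> x y Hx Hy; apply: He; split.
Qed.

Lemma filterlim_Cmult_const (F : (R -> Prop) -> Prop) (FF : Filter F) (f : R -> C) (a l' : C) :
  filterlim f F (locally l') -> filterlim (fun y => a * f y)%C F (locally (a * l')%C).
Proof. by move=> H; apply: filterlim_Cmult => //; exact: filterlim_const. Qed.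

Lemma filterlim_Cmod_le (F : (R -> Prop) -> Prop) (FF : ProperFilter F)
    (f : R -> C) (g : R -> R) (l : C) (m : R) :
  F (fun x => Cmod (f x) <= g x) -> filterlim f F (locally l) ->
  filterlim g F (locally m) -> Cmod l <= m.
Proof.
move=> H Hf Hg.
have K : Rbar_le (Cmod l) m; last by [].
apply: (filterlim_le (F := F) (fun x => Cmod (f x)) g) => //.
exact: filterlim_comp Hf (continuous_Cmod l).
Qed.

Lemma filterlim_C_0 (F : (R -> Prop) -> Prop) (FF : Filter F) (f : R -> C) (g : R -> R) :
  F (fun x => Cmod (f x) <= g x) -> filterlim g F (locally 0) ->
  filterlim f F (locally (RtoC 0)).
Proof.
move=> H Hg; apply: (filterlim_norm_zero (V := C_R_NormedModule)).
apply: (filterlim_le_le (fun _ => 0) _ g (Finite 0)) => //; last exact: filterlim_const.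
apply: filter_imp H => x Hx; rewrite norm_C; split => //; exact: Cmod_ge_0.
Qed.

Lemma filterlim_Rmult_p_infty (a : R) :
  0 < a -> filterlim (Rmult a) (Rbar_locally p_infty) (Rbar_locally p_infty).
Proof.
move=> Ha; have := filterlim_Rbar_mult_l a p_infty; rewrite /Rbar_mult /=.
by case: Rle_dec => //; [move=> H; case: Rle_lt_or_eq_dec => // ; lra | lra].
Qed.

Lemma filterlim_Rmult_m_infty (a : R) :
  0 < a -> filterlim (Rmult a) (Rbar_locally m_infty) (Rbar_locally m_infty).
Proof.
move=> Ha; have := filterlim_Rbar_mult_l a m_infty; rewrite /Rbar_mult /=.
by case: Rle_dec => //; [move=> H; case: Rle_lt_or_eq_dec => // ; lra | lra].
Qed.

(** Bundles the two facts that the fundamental theorem of calculus asks for at a point; being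
    pointwise, it can be required on an open interval at whose ends f is singular. *)
Definition C1_primitive {V : NormedModule R_AbsRing} (P f : R -> V) (x : R) : Prop :=
  is_derive P x (f x) /\ continuous f x.

Lemma C1_primitive_is_RInt (V : CompleteNormedModule R_AbsRing) (P f : R -> V) (a b : R) :
  (forall x, Rmin a b <= x <= Rmax a b -> C1_primitive P f x) ->
  is_RInt f a b (minus (P b) (P a)).
Proof. by move=> H; apply: is_RInt_derive => x /H []. Qed.

(** Reduces improper integrals to limits of a primitive along the two filters, which is how
    convergence and value are obtained throughout. *)
Lemma is_RInt_gen_primitive (V : CompleteNormedModule R_AbsRing) (P f : R -> V)
    (Fa Fb : (R -> Prop) -> Prop) (FFa : Filter Fa) (FFb : Filter Fb) (la lb : V) :
  filter_prod Fa Fb (fun ab =>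
    forall x, Rmin (fst ab) (snd ab) <= x <= Rmax (fst ab) (snd ab) -> C1_primitive P f x) ->
  filterlim P Fa (locally la) -> filterlim P Fb (locally lb) ->
  is_RInt_gen f Fa Fb (minus lb la).
Proof.
move=> H Ha Hb Q HQ.
have K : filterlim (fun ab : R * R => minus (P (snd ab)) (P (fst ab)))
    (filter_prod Fa Fb) (locally (minus lb la)).
  apply: (filterlim_comp_2 (fun ab => P (snd ab)) (fun ab => opp (P (fst ab))) plus).
  - exact: (filterlim_comp _ _ _ snd P _ Fb _ filterlim_snd Hb).
  - apply: (filterlim_comp _ _ _ (fun ab => P (fst ab)) opp _ (locally la)); last exact: filterlim_opp.
    exact: (filterlim_comp _ _ _ fst P _ Fa _ filterlim_fst Ha).
  - exact: filterlim_plus.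
have {}K : filter_prod Fa Fb (fun ab => Q (minus (P (snd ab)) (P (fst ab)))) by exact: K.
apply: filter_imp (filter_and _ _ H K) => ab [H1 H2].
by exists (minus (P (snd ab)) (P (fst ab))); split => //; exact: C1_primitive_is_RInt.
Qed.

Lemma filter_prod_interval (a b : R) (Q : R -> Prop) :
  a < b -> (forall x, a < x < b -> Q x) ->
  filter_prod (at_right a) (at_left b)
    (fun ab => forall x, Rmin (fst ab) (snd ab) <= x <= Rmax (fst ab) (snd ab) -> Q x).
Proof.
move=> Hab H.
have He : 0 < b - a by lra.
apply: (Filter_prod _ _ _ (fun x => a < x < b) (fun x => a < x < b)) => /=.
- exists (mkposreal _ He) => y; rewrite /ball /= /AbsRing_ball /= /abs /minus /plus /opp /= => /Rabs_def2 Hy Hy'; lra.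
- exists (mkposreal _ He) => y; rewrite /ball /= /AbsRing_ball /= /abs /minus /plus /opp /= => /Rabs_def2 Hy Hy'; lra.
- move=> x y Hx Hy z; rewrite /Rmin /Rmax; case: Rle_dec => _ Hz; apply: H; lra.
Qed.

Lemma is_RInt_gen_interval (V : CompleteNormedModule R_AbsRing) (P f : R -> V)
    (a b : R) (la lb : V) :
  a < b -> (forall x, a < x < b -> C1_primitive P f x) ->
  filterlim P (at_right a) (locally la) -> filterlim P (at_left b) (locally lb) ->
  is_RInt_gen f (at_right a) (at_left b) (minus lb la).
Proof.
move=> Hab H; apply: is_RInt_gen_primitive; exact: filter_prod_interval.
Qed.

(** The comparison test through Cauchy's criterion: as Q has a limit, its increments become small,
    and they bound those of P. *)
Lemma filterlim_dominated (T : Type) (V : CompleteNormedModule R_AbsRing)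
    (F : (T -> Prop) -> Prop) (FF : ProperFilter F) (P : T -> V) (Q : T -> R) (D : T -> Prop) (l : R) :
  F D -> (forall x y, D x -> D y -> norm (minus (P y) (P x)) <= Rabs (Q y - Q x)) ->
  filterlim Q F (locally l) -> exists l', filterlim P F (locally l').
Proof.
move=> HD H HQ; apply/filterlim_locally_cauchy => eps.
have [_ K] := filterlim_locally_cauchy (F := F) Q.
have [S [HS HS']] := K (ex_intro _ l HQ) eps.
exists (fun x => D x /\ S x); split; first exact: filter_and.
move=> u v [Du Su] [Dv Sv]; apply: norm_compat1.
apply: Rle_lt_trans (H _ _ Du Dv) _; exact: (HS' u v Su Sv).
Qed.

Lemma C1_primitive_norm_le (V : CompleteNormedModule R_AbsRing) (P f : R -> V)
    (Q g : R -> R) (a b : R) :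
  a <= b ->
  (forall x, a <= x <= b -> C1_primitive P f x) ->
  (forall x, a <= x <= b -> C1_primitive (V := R_NormedModule) Q g x) ->
  (forall x, a <= x <= b -> norm (f x) <= g x) ->
  norm (minus (P b) (P a)) <= Q b - Q a.
Proof.
move=> Hab HP HQ H; apply: (norm_RInt_le f g a b) => //.
- by apply: C1_primitive_is_RInt => x; rewrite Rmin_left // Rmax_right //; exact: HP.
- by apply: (C1_primitive_is_RInt R_CompleteNormedModule) => x; rewrite Rmin_left // Rmax_right //; exact: HQ.
Qed.

(** The absolute value frees the estimate from the order of x and y, as Cauchy's criterion
    requires. *)
Lemma C1_primitive_norm_le_abs (V : CompleteNormedModule R_AbsRing) (P f : R -> V)
    (Q g : R -> R) (D : R -> Prop) :
  (forall x y z, D x -> D y -> x <= z <= y -> D z) ->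
  (forall x, D x -> C1_primitive P f x) ->
  (forall x, D x -> C1_primitive (V := R_NormedModule) Q g x) ->
  (forall x, D x -> norm (f x) <= g x) ->
  forall x y, D x -> D y -> norm (minus (P y) (P x)) <= Rabs (Q y - Q x).
Proof.
move=> HD HP HQ H x y Dx Dy.
case: (Rle_dec x y) => Hxy.
- apply: Rle_trans (Rle_abs _).
  apply: C1_primitive_norm_le => // z Hz; [apply: HP | apply: HQ | apply: H]; exact: HD Hz.
- rewrite -norm_opp opp_minus Rabs_minus_sym; apply: Rle_trans (Rle_abs _).
  apply: C1_primitive_norm_le => [|z Hz|z Hz|z Hz]; first lra; [apply: HP | apply: HQ | apply: H]; exact: HD Hz.
Qed.

Lemma RInt_C1_primitive (V : CompleteNormedModule R_AbsRing) (f : R -> V) (a b x0 x : R) :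
  a < x0 < b -> a < x < b -> (forall x, a < x < b -> continuous f x) ->
  C1_primitive (RInt f x0) f x.
Proof.
move=> H0 Hx H; split; last exact: H.
apply: (is_derive_RInt f _ x0); last exact: H.
apply: filter_imp (locally_interval a b x Hx) => y Hy.
apply: RInt_correct; apply: ex_RInt_continuous => z Hz; apply: H.
move: Hz; rewrite /Rmin /Rmax; case: Rle_dec; lra.
Qed.

(** * Real powers and Gamma integrals *)

Lemma is_derive_Rpower (a x : R) :
  0 < x -> is_derive (fun x => Rpower x a) x (a * Rpower x (a - 1)).
Proof. move=> H; apply/is_derive_Reals; exact: derivable_pt_lim_power. Qed.

Lemma continuous_Rpower (a x : R) : 0 < x -> continuous (fun x => Rpower x a) x.
Proof.
move=> H; apply: (ex_derive_continuous (V := R_NormedModule)).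
by eexists; exact: is_derive_Rpower.
Qed.

Lemma Rpower_pos (x a : R) : 0 < Rpower x a.
Proof. exact: exp_pos. Qed.

Lemma Rpower_minus (x a b : R) : Rpower x (a - b) = Rpower x a / Rpower x b.
Proof. by rewrite /Rminus Rpower_plus Rpower_Ropp. Qed.

Lemma Rpower_le_anti (x y a : R) : 0 < x <= y -> a <= 0 -> Rpower y a <= Rpower x a.
Proof.
move=> Hx Ha; rewrite -(Ropp_involutive a) !(Rpower_Ropp _ (- a)).
apply: Rinv_le_contravar; first exact: Rpower_pos.
apply: Rle_Rpower_l; lra.
Qed.

Lemma Rpower_at_right_0 (a : R) :
  0 < a -> filterlim (fun x => Rpower x a) (at_right 0) (locally 0).
Proof.
move=> Ha; apply: (filterlim_comp _ _ _ (fun x => a * ln x) exp _ (Rbar_locally m_infty)).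
  apply: (filterlim_comp _ _ _ ln (Rmult a) _ (Rbar_locally m_infty)); first exact: is_lim_ln_0.
  exact: filterlim_Rmult_m_infty.
exact: is_lim_exp_m.
Qed.

Lemma Rpower_p_infty (a : R) :
  0 < a -> filterlim (fun x => Rpower x a) (Rbar_locally p_infty) (Rbar_locally p_infty).
Proof.
move=> Ha; apply: (filterlim_comp _ _ _ (fun x => a * ln x) exp _ (Rbar_locally p_infty)).
  apply: (filterlim_comp _ _ _ ln (Rmult a) _ (Rbar_locally p_infty)); first exact: is_lim_ln_p.
  exact: filterlim_Rmult_p_infty.
exact: is_lim_exp_p.
Qed.

(** For a <= 1 the integrand is dominated by t^(a - 1) near 0 and by e^(-t) beyond 1. The primitive
    itself is returned because it is later composed with a power. *)
Lemma Gamma_primitive (a : R) :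
  0 < a <= 1 ->
  exists (P : R -> R) (l0 l1 : R),
    (forall t, 0 < t -> is_derive P t (Rpower t (a - 1) * exp (- t))) /\
    filterlim P (at_right 0) (locally l0) /\
    filterlim P (Rbar_locally p_infty) (locally l1) /\
    Gamma a = l1 - l0.
Proof.
move=> Ha; set f := fun t => Rpower t (a - 1) * exp (- t).
have Hf : forall t, 0 < t -> continuous (U := R_UniformSpace) f t.
  move=> t Ht; apply: (continuous_mult (K := R_AbsRing)); first exact: continuous_Rpower.
  apply: continuous_comp; last exact: continuous_exp.
  exact: (continuous_opp (V := R_NormedModule) (fun t => t)) (continuous_id _).
set P := RInt (V := R_CompleteNormedModule) f 1.
have HP : forall t, 0 < t -> C1_primitive (V := R_NormedModule) P f t.
  move=> t Ht; apply: (RInt_C1_primitive R_CompleteNormedModule f 0 (t + 2) 1 t); try lra.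
  move=> x Hx; apply: Hf; lra.
have Hpos t : 0 < f t by apply: Rmult_lt_0_compat; [exact: Rpower_pos | exact: exp_pos].
have [l0 H0] : exists l, filterlim (U := R_CompleteNormedModule) P (at_right 0) (locally l).
  apply: (filterlim_dominated _ _ _ _ P (fun t => / a * Rpower t a) (fun x => 0 < x) (/ a * 0)).
  - by exists (mkposreal 1 Rlt_0_1) => y _.
  - apply: (C1_primitive_norm_le_abs R_CompleteNormedModule _ f _ (fun t => Rpower t (a - 1))) => [x y z|x Hx|x Hx|x Hx].
    + lra.
    + exact: HP.
    + split; last exact: continuous_Rpower.
      evar_last; first exact: is_derive_scal _ _ _ _ (is_derive_Rpower a x Hx).
      rewrite /scal /= /mult /=; field; lra.
    + rewrite /norm /= /abs /= Rabs_pos_eq; last exact/Rlt_le/Hpos.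
      rewrite /f -[X in _ <= X]Rmult_1_r; apply: Rmult_le_compat_l; first exact/Rlt_le/Rpower_pos.
      rewrite -exp_0; apply: Rlt_le; apply: exp_increasing; lra.
  - apply: (filterlim_comp _ _ _ _ (Rmult (/ a)) _ (locally 0)); first by apply: Rpower_at_right_0; lra.
    exact: (filterlim_Rbar_mult_l (/ a) 0).
have [l1 H1] : exists l, filterlim (U := R_CompleteNormedModule) P (Rbar_locally p_infty) (locally l).
  apply: (filterlim_dominated _ _ _ _ P (fun t => - exp (- t)) (fun x => 1 < x) (- 0)).
  - by exists 1.
  - apply: (C1_primitive_norm_le_abs R_CompleteNormedModule _ f _ (fun t => exp (- t))) => [x y z|x Hx|x Hx|x Hx].
    + lra.
    + apply: HP; lra.
    + split; first by auto_derive => //; ring.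
      apply: (ex_derive_continuous (V := R_NormedModule)); by auto_derive.
    + rewrite /norm /= /abs /= Rabs_pos_eq; last exact/Rlt_le/Hpos.
      rewrite /f -[X in _ <= X]Rmult_1_l; apply: Rmult_le_compat_r; first exact/Rlt_le/exp_pos.
      rewrite -[X in _ <= X](Rpower_O x); last lra.
      apply: Rle_Rpower; lra.
  - apply: (filterlim_comp _ _ _ (fun t => exp (- t)) Ropp _ (locally 0)); last exact: (filterlim_opp (V := R_NormedModule)).
    apply: (filterlim_comp _ _ _ Ropp exp _ (Rbar_locally m_infty)); last exact: is_lim_exp_m.
    exact: (filterlim_Rbar_opp p_infty).
exists P, l0, l1; split; [by move=> t /HP [] | split => //; split => //].
rewrite /Gamma; refine (is_RInt_gen_unique (V := R_CompleteNormedModule) f (l1 - l0) _).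
refine (is_RInt_gen_primitive R_CompleteNormedModule P f (at_right 0) (Rbar_locally p_infty) _ _ l0 l1 _ H0 H1).
apply: (Filter_prod _ _ _ (fun x => 0 < x) (fun x => 0 < x)) => /=.
- by exists (mkposreal 1 Rlt_0_1) => y _.
- by exists 0.
- move=> x y Hx Hy z; rewrite /Rmin /Rmax; case: Rle_dec => _ Hz; apply: HP; lra.
Qed.

(** The substitution u = w t^rho is carried out by composing the primitive of the Gamma integrand
    with it; the constant comes from t^(a - 1) dt = (1/rho) w^(-a/rho) u^(a/rho - 1) du. The
    condition a <= rho keeps a / rho in the range of [Gamma_primitive]. *)
Lemma stretched_exp_primitive (rho a w : R) :
  0 < rho -> 0 < a <= rho -> 0 < w ->
  exists (E : R -> R) (l0 l1 : R),
    (forall t, 0 < t ->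
      C1_primitive (V := R_NormedModule) E (fun t => Rpower t (a - 1) * exp (- (w * Rpower t rho))) t) /\
    filterlim E (at_right 0) (locally l0) /\
    filterlim E (Rbar_locally p_infty) (locally l1) /\
    l1 - l0 = / rho * Gamma (a / rho) * Rpower w (- (a / rho)).
Proof.
move=> Hr Ha Hw.
have Hx : 0 < a / rho <= 1.
  split; first by apply: Rdiv_lt_0_compat; lra.
  apply: (Rmult_le_reg_r rho) => //; field_simplify; lra.
have [P [l0 [l1 [HP [H0 [H1 HG]]]]]] := Gamma_primitive _ Hx.
set c := / rho * Rpower w (- (a / rho)).
exists (fun t => c * P (w * Rpower t rho)), (c * l0), (c * l1).
have Hmul (l : R) : filterlim (Rmult c) (locally l) (locally (c * l)) by exact: (filterlim_Rbar_mult_l c l).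
split; [|split; [|split]].
- move=> t Ht; split.
    evar_last.
      apply: is_derive_scal; apply: (is_derive_comp P).
        apply: HP; apply: Rmult_lt_0_compat => //; exact: Rpower_pos.
      apply: is_derive_scal; exact: is_derive_Rpower.
    rewrite /scal /= /mult /= /c.
    have -> : Rpower (w * Rpower t rho) (a / rho - 1) = Rpower w (a / rho) / w * (Rpower t a / Rpower t rho).
      rewrite -Rpower_mult_distr //; last exact: Rpower_pos.
      rewrite Rpower_mult (_ : rho * (a / rho - 1) = a + - rho); last by field; lra.
      by rewrite !Rpower_plus !Rpower_Ropp Rpower_1.
    rewrite !Rpower_minus !Rpower_Ropp !Rpower_1 //.
    field; repeat split; try lra; apply: Rgt_not_eq; exact: Rpower_pos.
  apply: (continuous_mult (K := R_AbsRing)); first exact: continuous_Rpower.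
  apply: continuous_comp; last exact: continuous_exp.
  apply: (continuous_opp (V := R_NormedModule)); apply: (continuous_scal_r (V := R_NormedModule)); exact: continuous_Rpower.
- refine (filterlim_comp _ _ _ _ (Rmult c) _ (locally l0) _ _ (Hmul l0)).
  refine (filterlim_comp _ _ _ (fun t => w * Rpower t rho) P _ (at_right 0) _ _ H0) => Q [eps HQ].
  have K : filterlim (fun t => w * Rpower t rho) (at_right 0) (locally (w * 0)).
    apply: filterlim_comp (Rpower_at_right_0 _ Hr) _; exact: (filterlim_Rbar_mult_l w 0).
  rewrite Rmult_0_r in K.
  have {}K : at_right 0 (fun t => ball 0 eps (w * Rpower t rho)) := K _ (locally_ball 0 eps).
  refine (filter_imp (F := at_right 0) _ _ _ K) => t Ht; apply: HQ; first exact: Ht.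
  apply: Rmult_lt_0_compat => //; exact: Rpower_pos.
- refine (filterlim_comp _ _ _ _ (Rmult c) _ (locally l1) _ _ (Hmul l1)).
  refine (filterlim_comp _ _ _ (fun t => w * Rpower t rho) P _ (Rbar_locally p_infty) _ _ H1).
  exact: (filterlim_comp _ _ _ (fun t => Rpower t rho) (Rmult w) _ _ _ (Rpower_p_infty _ Hr) (filterlim_Rmult_p_infty w Hw)).
- rewrite HG /c; ring.
Qed.

(** * Integrals along the half-lines *)

Lemma is_derive_nonneg_le (f df : R -> R) (a b : R) :
  a <= b -> (forall x, a <= x <= b -> is_derive f x (df x)) ->
  (forall x, a <= x <= b -> 0 <= df x) -> f a <= f b.
Proof.
move=> Hab Hd Hp.
have [c [Hc E]] : exists c, Rmin a b <= c <= Rmax a b /\ f b - f a = df c * (b - a).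
  apply: MVT_gen => x; rewrite Rmin_left // Rmax_right // => Hx.
    apply: Hd; lra.
  apply/continuity_pt_filterlim; apply: (ex_derive_continuous (V := R_NormedModule)).
  by exists (df x); exact: Hd.
rewrite Rmin_left // Rmax_right // in Hc.
have : 0 <= df c * (b - a) by apply: Rmult_le_pos; [exact: Hp | lra].
lra.
Qed.

Lemma is_derive_pos_lt (f df : R -> R) (a b : R) :
  a < b -> (forall x, a <= x <= b -> is_derive f x (df x)) ->
  (forall x, a <= x <= b -> 0 < df x) -> f a < f b.
Proof.
move=> Hab Hd Hp.
have [c [Hc E]] : exists c, Rmin a b <= c <= Rmax a b /\ f b - f a = df c * (b - a).
  apply: MVT_gen => x; rewrite Rmin_left ?Rmax_right; try lra; move=> Hx.
    apply: Hd; lra.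
  apply/continuity_pt_filterlim; apply: (ex_derive_continuous (V := R_NormedModule)).
  by exists (df x); exact: Hd.
rewrite Rmin_left ?Rmax_right in Hc; try lra.
have : 0 < df c * (b - a) by apply: Rmult_lt_0_compat; [exact: Hp | lra].
lra.
Qed.

(** The comparison estimate pushed to the left end 0, where P and Q have only limits and f and g may
    be singular. *)
Lemma C1_primitive_norm_le_right (V : CompleteNormedModule R_AbsRing) (P f : R -> V)
    (Q g : R -> R) (b : R) (p0 : V) (q0 : R) :
  0 < b ->
  (forall x, 0 < x <= b -> C1_primitive P f x) ->
  (forall x, 0 < x <= b -> C1_primitive (V := R_NormedModule) Q g x) ->
  (forall x, 0 < x <= b -> norm (f x) <= g x) ->
  filterlim P (at_right 0) (locally p0) ->
  filterlim Q (at_right 0) (locally q0) ->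
  norm (minus (P b) p0) <= Q b - q0.
Proof.
move=> Hb HP HQ H HP0 HQ0.
have K : Rbar_le (norm (minus (P b) p0)) (Q b - q0); last by [].
apply: (filterlim_le (F := at_right 0) (fun e => norm (minus (P b) (P e))) (fun e => Q b - Q e)).
- exists (mkposreal b Hb) => e; rewrite /ball /= /AbsRing_ball /= /abs /minus /plus /opp /= => /Rabs_def2 He He0.
  apply: C1_primitive_norm_le => [|x Hx|x Hx|x Hx]; first lra; [apply: HP | apply: HQ | apply: H]; lra.
- apply: (filterlim_comp _ _ _ _ norm _ (locally (minus (P b) p0))); last exact: filterlim_norm.
  apply: (filterlim_comp_2 (fun _ => P b) (fun e => opp (P e)) plus).
  + exact: filterlim_const.
  + apply: (filterlim_comp _ _ _ P opp _ (locally p0)) => //; exact: filterlim_opp.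
  + exact: filterlim_plus.
- apply: (filterlim_comp_2 (fun _ => Q b) (fun e => opp (Q e)) plus (G := locally (Q b)) (H := locally (opp q0)) (I := locally (plus (Q b) (opp q0)))).
  + exact: filterlim_const.
  + apply: (filterlim_comp _ _ _ Q opp _ (locally q0)) => //; exact: (filterlim_opp (V := R_NormedModule)).
  + exact: (filterlim_plus (V := R_NormedModule)).
Qed.

Lemma RInt_C_pair (f : R -> C) (a b : R) :
  ex_RInt (V := C_R_NormedModule) f a b ->
  RInt (V := C_R_CompleteNormedModule) f a b =
  (RInt (fun t => Re (f t)) a b, RInt (fun t => Im (f t)) a b).
Proof.
move=> [l Hl]; apply: is_RInt_unique.
have H1 := is_RInt_fct_extend_fst _ _ _ _ Hl.
have H2 := is_RInt_fct_extend_snd _ _ _ _ Hl.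
rewrite (is_RInt_unique _ _ _ _ H1) (is_RInt_unique _ _ _ _ H2).
by case: l Hl {H1 H2}.
Qed.

Lemma ex_RInt_C_pair (f : R -> C) (a b : R) :
  ex_RInt (V := C_R_NormedModule) f a b ->
  ex_RInt (fun t => Re (f t)) a b /\ ex_RInt (fun t => Im (f t)) a b.
Proof.
move=> [l Hl]; split; eexists; [exact: is_RInt_fct_extend_fst Hl | exact: is_RInt_fct_extend_snd Hl].
Qed.

Lemma is_derive_RInt_param_C (G dG : R -> R -> C) (c d x : R) :
  c <= d ->
  locally x (fun u => forall t, c <= t <= d ->
    is_derive (V := C_R_NormedModule) (fun u => G u t) u (dG u t)) ->
  locally x (fun u => ex_RInt (V := C_R_NormedModule) (G u) c d) ->
  (forall t, c <= t <= d -> locally (x, t) (fun z : R * R =>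
    is_derive (V := C_R_NormedModule) (fun u => G u (snd z)) (fst z) (dG (fst z) (snd z)))) ->
  (forall t, c <= t <= d ->
    continuous (U := C_UniformSpace) (fun z : R * R => dG (fst z) (snd z)) (x, t)) ->
  ex_RInt (V := C_R_NormedModule) (dG x) c d ->
  is_derive (V := C_R_NormedModule) (fun u => RInt (V := C_R_CompleteNormedModule) (G u) c d) x
    (RInt (V := C_R_CompleteNormedModule) (dG x) c d).
Proof.
move=> Hcd Hd Hi Hd2 Hc Hid.
apply: (is_derive_ext_loc (fun u => (RInt (fun t => Re (G u t)) c d, RInt (fun t => Im (G u t)) c d) : C_R_NormedModule)).
  by apply: filter_imp Hi => u Hu; rewrite RInt_C_pair.
rewrite RInt_C_pair //.
(* The real theorem is applied once, to a coordinate [p] compatible with derivatives, continuity and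
   integrability; [p] is then taken to be [Re] and [Im]. *)
have Main (p : C -> R) (Hp : forall (f : R -> C) u l, is_derive (V := C_R_NormedModule) f u l -> is_derive (fun t => p (f t)) u (p l))
    (Hpc : forall z : C, continuous p z)
    (Hpi : forall f : R -> C, ex_RInt (V := C_R_NormedModule) f c d -> ex_RInt (fun t => p (f t)) c d) :
    is_derive (fun u => RInt (fun t => p (G u t)) c d) x (RInt (fun t => p (dG x t)) c d).
  evar_last.
    apply: is_derive_RInt_param.
    - apply: filter_imp Hd => u Hu t; rewrite Rmin_left // Rmax_right // => Ht.
      by eexists; apply: Hp; exact: Hu.
    - move=> t; rewrite Rmin_left // Rmax_right // => Ht.
      apply: (continuity_2d_pt_ext_loc (fun u v => p (dG u v))).
        apply/locally_2d_locally; apply: filter_imp (Hd2 t Ht) => -[u v] /= Huv.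
        by rewrite (is_derive_unique _ _ _ (Hp _ _ _ Huv)).
      apply/continuity_2d_pt_filterlim.
      exact: (continuous_comp (fun z : R * R => dG (fst z) (snd z)) p (x, t) (Hc t Ht) (Hpc _)).
    - by apply: filter_imp Hi => u Hu; apply: Hpi.
  apply: RInt_ext => t; rewrite Rmin_left // Rmax_right // => Ht.
  have Ht' : c <= t <= d by lra.
  apply: is_derive_unique; apply: Hp; exact: (locally_singleton _ _ Hd t Ht').
apply/is_derive_C_pair; split.
- apply: (Main Re) => [f u l /is_derive_C_pair [] //|z|f /ex_RInt_C_pair [] //]; exact: continuous_Re.
- apply: (Main Im) => [f u l /is_derive_C_pair [] //|z|f /ex_RInt_C_pair [] //]; exact: continuous_Im.
Qed.

Lemma sgn_sqr (j : index) : sgn j * sgn j = 1.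
Proof. case: j => /=; ring. Qed.

Lemma Rpower_le_1 (t a : R) : 1 <= t -> a <= 0 -> Rpower t a <= 1.
Proof. move=> Ht Ha; rewrite -(Rpower_O t); [apply: Rle_Rpower | ]; lra. Qed.

Lemma Im_Cpower (z : C) (a : R) : Im (Cpower z a) = Rpower (Cmod z) a * sin (a * Carg z).
Proof. by rewrite /Cpower /Cexp /Rpower /= !Rmult_0_l Rminus_0_r Rplus_0_r. Qed.

(** * Geometry of the half-lines and decay of the oscillating factor *)

Section Ray.

Context (rho : index -> R) (j : index) (omega : R)
  (hrho : 1 <= rho j) (homega : 0 < omega).

Let alpha := PI / (2 * rho j).
Definition ray_dir : C := Cexp (RtoC (sgn j) * Ci * RtoC (PI / (2 * rho j)))%C.
Definition ray (s t : R) : C := (RtoC s + RtoC t * ray_dir)%C.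

Definition pow_osc (a : R) (z : C) : C := (Cpower z a * osc rho j omega z)%C.

Lemma alpha_bound : 0 < alpha <= PI / 2.
Proof.
have := PI_RGT_0 => H; split; first by apply: Rdiv_lt_0_compat; lra.
rewrite /alpha; apply: (Rmult_le_reg_r (2 * rho j)); first lra.
field_simplify; [nra | lra].
Qed.

Lemma ray_dir_polar : ray_dir = (cos (sgn j * alpha), sin (sgn j * alpha)).
Proof.
rewrite /ray_dir /Cexp /alpha /=; rewrite (_ : _ - _ = 0); last ring.
rewrite exp_0 !Rmult_1_l; congr (cos _, sin _); ring.
Qed.

Lemma ray_dir_eq : ray_dir = (cos alpha, sgn j * sin alpha).
Proof.
rewrite ray_dir_polar; case: j => /=; first by rewrite !Rmult_1_l.
rewrite (_ : -1 * alpha = - alpha); last ring.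
rewrite cos_neg sin_neg; congr (_, _); ring.
Qed.

Lemma sin_alpha : 0 < sin alpha.
Proof. have := alpha_bound => H; apply: sin_gt_0; lra. Qed.

Lemma cos_alpha : 0 <= cos alpha.
Proof. have := alpha_bound => H; apply: cos_ge_0; lra. Qed.

Lemma Re_ray (s t : R) : Re (ray s t) = s + t * cos alpha.
Proof. rewrite /ray ray_dir_eq /=; ring. Qed.

Lemma Im_ray (s t : R) : Im (ray s t) = sgn j * (t * sin alpha).
Proof. rewrite /ray ray_dir_eq /=; ring. Qed.

Lemma ray_0_l (t : R) : ray 0 t = (t * cos (sgn j * alpha), t * sin (sgn j * alpha)).
Proof. rewrite /ray ray_dir_polar /Cplus /Cmult /RtoC /=; congr (_, _); ring. Qed.

Lemma ray_0_r (s : R) : ray s 0 = RtoC s.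
Proof. rewrite /ray; ring. Qed.

Lemma slit_ray_pos (s t : R) : 0 < t -> slit (ray s t).
Proof.
move=> Ht; apply: slit_Im; rewrite Im_ray; have := sin_alpha => Hs.
have H : 0 < t * sin alpha by exact: Rmult_lt_0_compat.
case: j => /=; lra.
Qed.

Lemma slit_ray_nonneg (s t : R) : 0 < s -> 0 <= t -> slit (ray s t).
Proof.
move=> Hs [Ht | <-]; first exact: slit_ray_pos.
by rewrite ray_0_r; apply: slit_Re.
Qed.

Lemma Cmod_ray_sqr (s t : R) :
  Cmod (ray s t) ^ 2 = s ^ 2 + t ^ 2 + 2 * s * t * cos alpha.
Proof.
rewrite Cmod2_alt Re_ray Im_ray.
have H := sin2_cos2 alpha; rewrite /Rsqr in H; have H2 := sgn_sqr j.
transitivity ((s + t * cos alpha) ^ 2 + (sgn j * sgn j) * t ^ 2 * (sin alpha * sin alpha)); first ring.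
rewrite H2 (_ : sin alpha * sin alpha = 1 - cos alpha * cos alpha); [ring | lra].
Qed.

(** In the law of cosines the cross term is nonnegative, since rho_j >= 1 makes the angle alpha at
    most PI / 2. *)
Lemma Cmod_ray_ge (s t : R) : 0 <= s -> 0 <= t -> s <= Cmod (ray s t) /\ t <= Cmod (ray s t).
Proof.
move=> Hs Ht.
have H := Cmod_ray_sqr s t; have Hc := cos_alpha.
have K : 0 <= 2 * s * t * cos alpha by repeat (apply: Rmult_le_pos; try lra).
have Hm := Cmod_ge_0 (ray s t).
split; nra.
Qed.

Lemma is_derive_ray_r (s t : R) :
  is_derive (V := C_R_NormedModule) (fun t => ray s t) t ray_dir.
Proof.
evar_last.
  apply: is_derive_Cplus; first exact: is_derive_const.
  apply: is_derive_Cmult; last exact: is_derive_const.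
  exact: is_derive_RtoC (is_derive_id _).
change ((RtoC 0 + (RtoC 1 * ray_dir + RtoC t * RtoC 0))%C = ray_dir); ring.
Qed.

Lemma is_derive_ray_l (s t : R) :
  is_derive (V := C_R_NormedModule) (fun s => ray s t) s (RtoC 1).
Proof.
evar_last.
  apply: is_derive_Cplus; last exact: is_derive_const.
  exact: is_derive_RtoC (is_derive_id _).
change ((RtoC 1 + RtoC 0)%C = RtoC 1); ring.
Qed.

(** The complex derivative of [pow_osc a]. It is again a combination of functions [pow_osc], so
    integration by parts stays within the family. *)
Definition dpow_osc (a : R) (z : C) : C :=
  (RtoC a * pow_osc (a - 1) z
   + RtoC (sgn j) * Ci * RtoC omega * RtoC (rho j) * pow_osc (a + rho j - 1) z)%C.

Lemma is_derive_pow_osc (g : R -> C) (a x : R) (dg : C) :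
  slit (g x) ->
  is_derive (V := C_R_NormedModule) g x dg ->
  is_derive (V := C_R_NormedModule) (fun t => pow_osc a (g t)) x (dpow_osc a (g x) * dg)%C.
Proof.
move=> Hs Hg; evar_last.
  apply: is_derive_Cmult (is_derive_Cpower g a x dg Hs Hg) _.
  apply: is_derive_Cexp; apply: is_derive_Cmult_l; exact: (is_derive_Cpower g (rho j) x dg Hs Hg).
rewrite /dpow_osc /pow_osc -/(osc rho j omega (g x)).
rewrite (_ : a + rho j - 1 = a + (rho j - 1)) ?Cpower_plus; last ring.
ring.
Qed.

Lemma continuous_pow_osc (a : R) (z : C) : slit z -> continuous (pow_osc a) z.
Proof.
move=> Hz; apply: continuous_Cmult; first exact: continuous_Cpower.
apply: continuous_comp; last exact: continuous_Cexp.
apply: continuous_Cmult; [exact: continuous_const | exact: continuous_Cpower].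
Qed.

Lemma continuous_dpow_osc (a : R) (z : C) : slit z -> continuous (dpow_osc a) z.
Proof.
move=> Hz; apply: continuous_Cplus; apply: continuous_Cmult; (try exact: continuous_const);
  exact: continuous_pow_osc.
Qed.

(** Increasing s moves the point to the right at fixed height, so the argument, which is
    [sgn j * alpha] at s = 0, shrinks towards 0 without changing sign. *)
Lemma Carg_ray_bound (s t : R) : 0 <= s -> 0 < t -> 0 <= sgn j * Carg (ray s t) <= alpha.
Proof.
move=> Hs Ht.
have Hsin := sin_alpha; have Hal := alpha_bound.
have Hp u := slit_ray_pos u t Ht.
split.
- have -> : Carg (ray s t) = _ := f_equal snd (Clog_slit _ (Hp s)).
  cbn [snd]; rewrite Im_ray; move: (Hp s); rewrite /slit; set d := Cmod _ + _ => Hd.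
  have K : 0 <= atan (t * sin alpha / d).
    rewrite -atan_0; case: (Rle_lt_or_eq_dec 0 (t * sin alpha / d)) => [|H|<-]; last by right.
      apply: Rlt_le; apply: Rdiv_lt_0_compat => //; exact: Rmult_lt_0_compat.
    by apply: Rlt_le; apply: atan_increasing.
  case: j => /=.
    by rewrite !Rmult_1_l; lra.
  rewrite (_ : -1 * (t * sin alpha) / d = - (t * sin alpha / d)) ?atan_opp; [lra | field; lra].
- have H0 : sgn j * Carg (ray 0 t) = alpha.
    have HPI := PI_RGT_0.
    have Hb : - PI < sgn j * alpha <= PI by case: j => /=; lra.
    have := f_equal snd (Clog_polar t (sgn j * alpha) Ht Hb); rewrite -ray_0_l; cbn [snd Clog] => ->.
    rewrite -Rmult_assoc sgn_sqr; ring.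
  rewrite -[X in _ <= X]H0; apply: Ropp_le_cancel.
  apply: (is_derive_nonneg_le (fun u => - (sgn j * Im (Clog (ray u t)))) (fun u => t * sin alpha / Cmod (ray u t) ^ 2)) => // u Hu.
  + have /is_derive_C_pair [_ D] := is_derive_Clog _ u _ (Hp u) (is_derive_ray_l u t).
    evar_last.
      apply: is_derive_opp; apply: is_derive_scal; exact: D.
    change (- (sgn j * Im (RtoC 1 / ray u t)%C) = t * sin alpha / Cmod (ray u t) ^ 2).
    rewrite Cmod2_alt /Cdiv Cmult_1_l /Cinv; cbn [Im snd fst].
    rewrite -[fst (ray u t)]/(Re (ray u t)) -[snd (ray u t)]/(Im (ray u t)).
    have Hm : 0 < Re (ray u t) ^ 2 + Im (ray u t) ^ 2.
      rewrite -Cmod2_alt; apply: pow_lt; exact: slit_Cmod.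
    rewrite {1}Im_ray.
    transitivity ((sgn j * sgn j) * (t * sin alpha) / (Re (ray u t) ^ 2 + Im (ray u t) ^ 2)).
      field; lra.
    rewrite sgn_sqr; field; lra.
  + apply: Rlt_le; apply: Rdiv_lt_0_compat; first exact: Rmult_lt_0_compat.
    apply: pow_lt; exact: slit_Cmod.
Qed.

(** [Im z^rho] increases with [s], because its derivative [rho Im z^(rho - 1)]
    is nonnegative on the sector. *)
Lemma Im_Cpower_ray (s t : R) :
  0 <= s -> 0 < t -> Rpower t (rho j) <= sgn j * Im (Cpower (ray s t) (rho j)).
Proof.
move=> Hs Ht; have Hal := alpha_bound; have HPI := PI_RGT_0.
(* At s = 0 the angle rho_j * alpha is PI / 2, so z^rho_j = +- i t^rho_j; the direction of the
   half-line is chosen for this. *)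
have -> : Rpower t (rho j) = sgn j * Im (Cpower (ray 0 t) (rho j)).
  rewrite ray_0_l Cpower_polar //; last by case: j => /=; lra.
  rewrite (_ : rho j * (sgn j * alpha) = sgn j * (PI / 2)); last by rewrite /alpha; field; lra.
  have K : sgn j * sin (sgn j * (PI / 2)) = 1.
    case: j => /=; first by rewrite !Rmult_1_l sin_PI2.
    rewrite (_ : -1 * (PI / 2) = - (PI / 2)) ?sin_neg ?sin_PI2; lra.
  transitivity (Rpower t (rho j) * (sgn j * sin (sgn j * (PI / 2)))); first by rewrite K; ring.
  rewrite /Cexp /= exp_0; ring.
apply: (is_derive_nonneg_le (fun u => sgn j * Im (Cpower (ray u t) (rho j)))
   (fun u => sgn j * (rho j * Im (Cpower (ray u t) (rho j - 1))))) => // u Hu.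
- apply: is_derive_scal.
  have /is_derive_C_pair [_ D] := is_derive_Cpower _ (rho j) u _ (slit_ray_pos u t Ht) (is_derive_ray_l u t).
  evar_last; first exact: D.
  by rewrite /Cmult /=; ring.
- rewrite Im_Cpower.
  have Hu0 : 0 <= u by lra.
  have Hb := Carg_ray_bound u t Hu0 Ht.
  (* As rho_j * alpha = PI / 2, the angle of z^(rho_j - 1), up to the sign [sgn j], stays between 0
     and PI / 2, where the sine is nonnegative. *)
  have Hra : 0 <= (rho j - 1) * (sgn j * Carg (ray u t)) <= PI.
    have K : rho j * alpha = PI / 2 by rewrite /alpha; field; lra.
    split; first by apply: Rmult_le_pos; lra.
    apply: Rle_trans (_ : (rho j - 1) * alpha <= _); last lra.
    apply: Rmult_le_compat_l; lra.
  have Hsn := sin_ge_0 _ (proj1 Hra) (proj2 Hra).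
  have E : sgn j * sin ((rho j - 1) * Carg (ray u t)) = sin ((rho j - 1) * (sgn j * Carg (ray u t))).
    case: j => /=; first by rewrite !Rmult_1_l.
    rewrite -[X in X * sin _]/(- (1)) (_ : (rho two - 1) * (-1 * Carg (ray u t)) = - ((rho two - 1) * Carg (ray u t))) ?sin_neg; ring.
  transitivity (rho j * (Rpower (Cmod (ray u t)) (rho j - 1) * sin ((rho j - 1) * (sgn j * Carg (ray u t))))); last by rewrite -E; right; ring.
  apply: Rmult_le_pos; first lra.
  apply: Rmult_le_pos => //; exact/Rlt_le/Rpower_pos.
Qed.

Lemma Cmod_pow_osc_ray (a s t : R) :
  0 <= s -> 0 < t ->
  Cmod (pow_osc a (ray s t)) <= Rpower (Cmod (ray s t)) a * exp (- (omega * Rpower t (rho j))).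
Proof.
move=> Hs Ht; rewrite /pow_osc Cmod_mult Cmod_Cpower; apply: Rmult_le_compat_l; first exact/Rlt_le/Rpower_pos.
rewrite /osc Cmod_Cexp.
have H := Im_Cpower_ray s t Hs Ht.
have -> : Re (RtoC (sgn j) * Ci * RtoC omega * Cpower (ray s t) (rho j))%C = - (omega * (sgn j * Im (Cpower (ray s t) (rho j)))).
  rewrite /Cmult /=; ring.
have [K | ->] : omega * Rpower t (rho j) <= omega * (sgn j * Im (Cpower (ray s t) (rho j))).
  by apply: Rmult_le_compat_l; lra.
- by apply: Rlt_le; apply: exp_increasing; lra.
- by right.
Qed.

(** As a <= 0, bounding |z|^a through |z| >= s produces the power of s in the remainder estimates.
    The companion bound through |z| >= t is uniform in s and keeps its meaning at s = 0. *)
Lemma Cmod_pow_osc_ray_l (a s t : R) :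
  a <= 0 -> 0 < s -> 0 < t ->
  Cmod (pow_osc a (ray s t)) <= Rpower s a * exp (- (omega * Rpower t (rho j))).
Proof.
move=> Ha Hs Ht; apply: Rle_trans (Cmod_pow_osc_ray a s t (Rlt_le _ _ Hs) Ht) _.
apply: Rmult_le_compat_r; first exact/Rlt_le/exp_pos.
apply: Rpower_le_anti => //; split => //; exact: proj1 (Cmod_ray_ge s t (Rlt_le _ _ Hs) (Rlt_le _ _ Ht)).
Qed.

Lemma Cmod_pow_osc_ray_r (a s t : R) :
  a <= 0 -> 0 <= s -> 0 < t ->
  Cmod (pow_osc a (ray s t)) <= Rpower t a * exp (- (omega * Rpower t (rho j))).
Proof.
move=> Ha Hs Ht; apply: Rle_trans (Cmod_pow_osc_ray a s t Hs Ht) _.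
apply: Rmult_le_compat_r; first exact/Rlt_le/exp_pos.
apply: Rpower_le_anti => //; split => //; exact: proj2 (Cmod_ray_ge s t Hs (Rlt_le _ _ Ht)).
Qed.

Lemma Cmod_ray_dir : Cmod ray_dir = 1.
Proof. by rewrite /ray_dir Cmod_Cexp /= (_ : _ - _ = 0) ?exp_0 //; ring. Qed.

(** * The half-line integrals: convergence, size and dependence on s *)

Definition ray_integrand (a s t : R) : C := (pow_osc a (ray s t) * ray_dir)%C.

Definition ray_partial (a s d T : R) : C :=
  RInt (V := C_R_CompleteNormedModule) (ray_integrand a s) d T.

(** For d = 0 this is convertible with [int_Lambda] applied to [pow_osc a]. A positive d removes the
    start of the half-line, so that s = 0, where the integrand is singular at t = 0, is also
    allowed. *)
Definition ray_int (a s d : R) : C :=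
  RInt_gen (V := C_R_CompleteNormedModule) (ray_integrand a s) (at_point d) (Rbar_locally p_infty).

(** For s > 0 negative t is allowed too, so that derivatives at t = 0 can be two-sided. *)
Lemma slit_ray_neq (s t : R) : 0 < s \/ 0 < t -> slit (ray s t).
Proof.
case=> H; last exact: slit_ray_pos.
case: (Req_dec t 0) => [-> | Ht]; first by apply: slit_ray_nonneg; lra.
apply: slit_Im; rewrite Im_ray; have Hs := sin_alpha.
have K : t * sin alpha <> 0 by apply: Rmult_integral_contrapositive; lra.
by case: j => /=; lra.
Qed.

Lemma continuous_ray_r (s t : R) : continuous (U := C_UniformSpace) (ray s) t.
Proof.
apply: (ex_derive_continuous (V := C_R_NormedModule)); eexists; exact: is_derive_ray_r.
Qed.

Lemma continuous_ray_l (s t : R) : continuous (U := C_UniformSpace) (fun s => ray s t) s.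
Proof.
apply: (ex_derive_continuous (V := C_R_NormedModule)); eexists; exact: is_derive_ray_l.
Qed.

Lemma continuous_ray (z : R * R) :
  continuous (U := C_UniformSpace) (fun z : R * R => ray (fst z) (snd z)) z.
Proof.
apply: continuous_Cplus; first (apply: continuous_RtoC; exact: continuous_fst).
apply: continuous_Cmult; last exact: continuous_const.
apply: continuous_RtoC; exact: continuous_snd.
Qed.

Lemma continuous_ray_integrand (a s t : R) :
  0 < s \/ 0 < t -> continuous (U := C_UniformSpace) (ray_integrand a s) t.
Proof.
move=> H; apply: continuous_Cmult; last exact: continuous_const.
apply: (continuous_comp (ray s) (pow_osc a)); first exact: continuous_ray_r.
exact: continuous_pow_osc (slit_ray_neq s t H).
Qed.

Lemma ray_partial_primitive (a s d T : R) :
  0 <= d -> 0 < s \/ 0 < d -> d <= T ->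
  C1_primitive (V := C_R_NormedModule) (ray_partial a s d) (ray_integrand a s) T.
Proof.
move=> Hd Hs HT; case: (Rlt_dec 0 s) => H0.
- apply: (RInt_C1_primitive C_R_CompleteNormedModule _ (d - 1) (T + 1)); try lra.
  move=> x _; apply: continuous_ray_integrand; by left.
- apply: (RInt_C1_primitive C_R_CompleteNormedModule _ 0 (T + 1)); try lra.
  move=> x Hx; apply: continuous_ray_integrand; right; lra.
Qed.

Lemma Cmod_ray_integrand (a s t : R) : Cmod (ray_integrand a s t) = Cmod (pow_osc a (ray s t)).
Proof. by rewrite /ray_integrand Cmod_mult Cmod_ray_dir Rmult_1_r. Qed.

Lemma ray_partial_cvg (a s d : R) :
  a <= 0 -> 0 <= s -> 0 <= d -> 0 < s \/ 0 < d ->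
  exists l : C, filterlim (ray_partial a s d) (Rbar_locally p_infty) (locally l).
Proof.
move=> Ha Hs Hd Hsd.
have Hr : 0 < rho j by lra.
have Hr1 : 0 < 1 <= rho j by lra.
have [E [l0 [l1 [HE [_ [H1 _]]]]]] := stretched_exp_primitive (rho j) 1 omega Hr Hr1 homega.
(* Beyond t = 1 one has t^a <= 1, so the case a = 1 of [stretched_exp_primitive] dominates whatever
   a <= 0 is. *)
apply: (filterlim_dominated R C_R_CompleteNormedModule _ _ _ E (fun t => 1 + d < t) l1) => //.
  by exists (1 + d).
apply: (C1_primitive_norm_le_abs C_R_CompleteNormedModule _ (ray_integrand a s) _ (fun t => Rpower t (1 - 1) * exp (- (omega * Rpower t (rho j))))) => [x y z|x Hx|x Hx|x Hx].
- lra.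
- apply: ray_partial_primitive => //; lra.
- apply: HE; lra.
- rewrite norm_C Cmod_ray_integrand.
  apply: Rle_trans (Cmod_pow_osc_ray_r a s x Ha Hs _) _; first lra.
  apply: Rmult_le_compat_r; first exact/Rlt_le/exp_pos.
  rewrite (_ : 1 - 1 = 0) ?Rpower_O; try lra; apply: Rpower_le_1; lra.
Qed.

Lemma ray_partial_lim (a s d : R) :
  a <= 0 -> 0 <= s -> 0 <= d -> 0 < s \/ 0 < d ->
  filterlim (ray_partial a s d) (Rbar_locally p_infty) (locally (ray_int a s d)).
Proof.
move=> Ha Hs Hd Hsd; have [l Hl] := ray_partial_cvg a s d Ha Hs Hd Hsd.
suff -> : ray_int a s d = l by [].
refine (is_RInt_gen_unique (V := C_R_CompleteNormedModule) _ _ _).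
have Hz : filterlim (ray_partial a s d) (at_point d) (locally (zero : C_R_NormedModule)).
  move=> Q /locally_singleton HQ; rewrite /filtermap /at_point /ray_partial.
  by rewrite (RInt_point (V := C_R_CompleteNormedModule)).
have := is_RInt_gen_primitive C_R_CompleteNormedModule (ray_partial a s d) (ray_integrand a s) (at_point d) (Rbar_locally p_infty) _ _ zero l _ Hz Hl.
rewrite minus_zero_r; apply.
apply: (Filter_prod _ _ _ (fun x => x = d) (fun x => d < x)) => //=; first by exists d.
move=> x y -> Hy z; rewrite Rmin_left ?Rmax_right; try lra.
by move=> Hz'; apply: ray_partial_primitive => //; lra.
Qed.

Lemma ray_partial_Chasles (a s d T : R) :
  0 < s -> (ray_partial a s 0 d + ray_partial a s d T)%C = ray_partial a s 0 T.
Proof.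
move=> Hs; apply: (RInt_Chasles (V := C_R_CompleteNormedModule));
  apply: (ex_RInt_continuous (V := C_R_CompleteNormedModule)) => z _;
  apply: continuous_ray_integrand; by left.
Qed.

(** The dominating primitive E is known only for t > 0, so the estimate starts from its limit l0 at
    0. *)
Lemma ray_partial_le (a s T l0 : R) (E g : R -> R) :
  0 < s -> 0 < T ->
  (forall t, 0 < t -> C1_primitive (V := R_NormedModule) E g t) ->
  filterlim E (at_right 0) (locally l0) ->
  (forall t, 0 < t -> Cmod (pow_osc a (ray s t)) <= g t) ->
  Cmod (ray_partial a s 0 T) <= E T - l0.
Proof.
move=> Hs HT HE H0 H.
have := C1_primitive_norm_le_right C_R_CompleteNormedModule (ray_partial a s 0) (ray_integrand a s) E g T zero l0 HT.
rewrite minus_zero_r norm_C; apply => //.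
- move=> x Hx; apply: ray_partial_primitive; lra.
- move=> x Hx; apply: HE; lra.
- move=> x Hx; rewrite norm_C Cmod_ray_integrand; apply: H; lra.
- have <- : ray_partial a s 0 0 = zero (G := C_R_NormedModule) by exact: (RInt_point (V := C_R_CompleteNormedModule)).
  have [D _] := ray_partial_primitive a s 0 0 (Rle_refl 0) (or_introl Hs) (Rle_refl 0).
  have Cn : continuous (U := C_UniformSpace) (ray_partial a s 0) 0.
    by apply: (ex_derive_continuous (V := C_R_NormedModule)); eexists; exact: D.
  apply: filterlim_filter_le_1 Cn; exact: filter_le_within.
Qed.

(** The constant is the integral of e^(-omega t^rho_j) over (0, oo). Both remainder bounds come from
    here, with a = mu_j - 1 and a = mu_j - rho_j - 1. *)
Lemma ray_int_le (a s : R) :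
  a <= 0 -> 0 < s ->
  Cmod (ray_int a s 0) <= Rpower s a * (/ rho j * Gamma (/ rho j) * Rpower omega (- / rho j)).
Proof.
move=> Ha Hs.
have Hr : 0 < rho j by lra.
have Hr1 : 0 < 1 <= rho j by lra.
have [E [l0 [l1 [HE [H0 [H1 HG]]]]]] := stretched_exp_primitive (rho j) 1 omega Hr Hr1 homega.
rewrite /Rdiv Rmult_1_l in HG; rewrite -HG.
apply: (filterlim_Cmod_le (Rbar_locally p_infty) _ (ray_partial a s 0) (fun T => Rpower s a * E T - Rpower s a * l0)).
- exists 0 => T HT; apply: (ray_partial_le _ _ _ _ (fun t => Rpower s a * E t) (fun t => Rpower s a * (Rpower t (1 - 1) * exp (- (omega * Rpower t (rho j)))))) => // [t Ht||t Ht].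
  + have [D Cn] := HE t Ht; split; first exact: is_derive_scal.
    exact: (continuous_scal_r (V := R_NormedModule)).
  + refine (filterlim_comp _ _ _ E (Rmult (Rpower s a)) _ _ _ H0 _).
    exact: (filterlim_Rbar_mult_l (Rpower s a) l0).
  + rewrite (_ : 1 - 1 = 0) ?Rpower_O ?Rmult_1_l //; last ring.
    exact: Cmod_pow_osc_ray_l.
- apply: ray_partial_lim => //; try lra; by left.
- rewrite Rmult_minus_distr_l.
  apply: (filterlim_comp_2 (fun T => Rpower s a * E T) (fun _ => opp (Rpower s a * l0)) plus (G := locally (Rpower s a * l1)) (H := locally (opp (Rpower s a * l0))) (I := locally (plus (Rpower s a * l1) (opp (Rpower s a * l0))))).
  + refine (filterlim_comp _ _ _ E (Rmult (Rpower s a)) _ _ _ H1 _).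
    exact: (filterlim_Rbar_mult_l (Rpower s a) l1).
  + exact: filterlim_const.
  + exact: (filterlim_plus (V := R_NormedModule)).
Qed.

Lemma exp_decay : filterlim (fun T => exp (- (omega * Rpower T (rho j)))) (Rbar_locally p_infty) (locally 0).
Proof.
refine (filterlim_comp _ _ _ (fun T => - (omega * Rpower T (rho j))) exp _ (Rbar_locally m_infty) _ _ is_lim_exp_m).
refine (filterlim_comp _ _ _ (fun T => omega * Rpower T (rho j)) Ropp _ (Rbar_locally p_infty) _ _ (filterlim_Rbar_opp p_infty)).
have Hr : 0 < rho j by lra.
exact: (filterlim_comp _ _ _ (fun t => Rpower t (rho j)) (Rmult omega) _ _ _ (Rpower_p_infty _ Hr) (filterlim_Rmult_p_infty omega homega)).
Qed.

Lemma locally_slit_ray (s d : R) :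
  0 <= d -> 0 < s \/ 0 < d -> locally s (fun u => forall t, d <= t -> slit (ray u t)).
Proof.
move=> Hd [Hs | Hd'].
- exists (mkposreal s Hs) => u; rewrite /ball /= /AbsRing_ball /= /abs /minus /plus /opp /= => /Rabs_def2 Hu t _.
  apply: slit_ray_neq; left; lra.
- exists (mkposreal 1 Rlt_0_1) => u _ t Ht; apply: slit_ray_neq; right; lra.
Qed.

(** The infinitesimal form of Cauchy's theorem: since [ray] has s-derivative 1 and t-derivative
    [ray_dir], the s-derivative of the integrand is the t-derivative of [pow_osc a] along the ray,
    and its integral telescopes. *)
Lemma is_derive_ray_partial_l (a s d T : R) :
  0 <= d -> 0 < s \/ 0 < d -> d <= T ->
  is_derive (V := C_R_NormedModule) (fun s => ray_partial a s d T) s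
    (pow_osc a (ray s T) - pow_osc a (ray s d))%C.
Proof.
move=> Hd Hs HT.
have Hloc := locally_slit_ray s d Hd Hs.
have Hslit t : d <= t -> slit (ray s t) by exact: (locally_singleton _ _ Hloc).
pose dG u t := (dpow_osc a (ray u t) * ray_dir)%C.
have HdG u t : slit (ray u t) -> is_derive (V := C_R_NormedModule) (fun u => ray_integrand a u t) u (dG u t).
  move=> Hu; evar_last.
    apply: is_derive_Cmult; last exact: is_derive_const.
    exact: (is_derive_pow_osc (fun u => ray u t) a u _ Hu (is_derive_ray_l u t)).
  rewrite /dG; change (dpow_osc a (ray u t) * RtoC 1 * ray_dir + pow_osc a (ray u t) * RtoC 0 = dpow_osc a (ray u t) * ray_dir)%C.
  ring.
have HI : is_RInt (V := C_R_NormedModule) (dG s) d T (pow_osc a (ray s T) - pow_osc a (ray s d))%C.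
  apply: (C1_primitive_is_RInt C_R_CompleteNormedModule (fun t => pow_osc a (ray s t))) => x.
  rewrite Rmin_left // Rmax_right // => Hx.
  have Hsx : slit (ray s x) by apply: Hslit; lra.
  split; first exact: is_derive_pow_osc Hsx (is_derive_ray_r s x).
  apply: continuous_Cmult; last exact: continuous_const.
  apply: (continuous_comp (ray s) (dpow_osc a)); [exact: continuous_ray_r | exact: continuous_dpow_osc].
rewrite -(is_RInt_unique (V := C_R_CompleteNormedModule) _ _ _ _ HI).
apply: is_derive_RInt_param_C => //.
- by apply: filter_imp Hloc => u Hu t Ht; apply: HdG; apply: Hu; lra.
- apply: filter_imp Hloc => u Hu.
  apply: (ex_RInt_continuous (V := C_R_CompleteNormedModule)) => z; rewrite Rmin_left // Rmax_right // => Hz.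
  apply: continuous_Cmult; last exact: continuous_const.
  apply: (continuous_comp (ray u) (pow_osc a)); first exact: continuous_ray_r.
  apply: continuous_pow_osc; apply: Hu; lra.
- move=> t Ht.
  have K : slit (ray s t) by apply: Hslit; lra.
  have {}K : locally (s, t) (fun z : R * R => slit (ray (fst z) (snd z))) := continuous_ray (s, t) _ (locally_slit _ K).
  by apply: filter_imp K => -[u v] /= Huv; exact: HdG.
- move=> t Ht; apply: continuous_Cmult; last exact: continuous_const.
  apply: (continuous_comp (fun z : R * R => ray (fst z) (snd z)) (dpow_osc a)); first exact: continuous_ray.
  exact: continuous_dpow_osc (Hslit t (proj1 Ht)).
- by eexists; exact: HI.
Qed.

Lemma continuous_pow_osc_ray_l (a s t : R) :
  0 < s \/ 0 < t -> continuous (U := C_UniformSpace) (fun s => pow_osc a (ray s t)) s.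
Proof.
move=> H; apply: (continuous_comp (fun s => ray s t) (pow_osc a)); first exact: continuous_ray_l.
exact: continuous_pow_osc (slit_ray_neq s t H).
Qed.

(** Cauchy's theorem for the strip between two parallel half-lines. *)
Lemma ray_int_shift (a s s' d : R) :
  a <= 0 -> 0 <= s <= s' -> 0 <= d -> 0 < s \/ 0 < d ->
  (ray_int a s' d - ray_int a s d)%C
  = (- RInt (V := C_R_CompleteNormedModule) (fun u => pow_osc a (ray u d)) s s')%C.
Proof.
move=> Ha Hs Hd Hsd.
set I := RInt _ _ _.
have Hsd' u : s <= u <= s' -> 0 < u \/ 0 < d by case: Hsd => ? ?; [left; lra | by right].
have HI : is_RInt (V := C_R_NormedModule) (fun u => pow_osc a (ray u d)) s s' I.
  apply: (RInt_correct (V := C_R_CompleteNormedModule)); apply: (ex_RInt_continuous (V := C_R_CompleteNormedModule)) => u.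
  rewrite Rmin_left ?Rmax_right; try lra; move=> Hu; exact: continuous_pow_osc_ray_l (Hsd' u Hu).
(* For finite T the strip is a parallelogram: the two half-line pieces and the near side add up to
   the integral over the far side, which tends to 0 as T grows. *)
have HT T : d < T -> is_RInt (V := C_R_NormedModule) (fun u => pow_osc a (ray u T)) s s'
    ((ray_partial a s' d T - ray_partial a s d T) + I)%C.
  move=> HdT; have K := C1_primitive_is_RInt C_R_CompleteNormedModule (fun u => ray_partial a u d T) (fun u => pow_osc a (ray u T) - pow_osc a (ray u d))%C s s'.
  apply: (is_RInt_ext (V := C_R_NormedModule)); last first.
    apply: (is_RInt_plus (V := C_R_NormedModule)) HI; apply: K => u.
    rewrite Rmin_left ?Rmax_right; try lra; move=> Hu; split.
      apply: is_derive_ray_partial_l => //; [exact: Hsd' | lra].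
    apply: (continuous_minus (V := C_R_NormedModule)); apply: continuous_pow_osc_ray_l; last exact: Hsd'.
    right; lra.
  move=> u _; change ((pow_osc a (ray u T) - pow_osc a (ray u d) + pow_osc a (ray u d))%C = pow_osc a (ray u T)); ring.
have L1 : filterlim (fun T => (ray_partial a s' d T - ray_partial a s d T) + I)%C (Rbar_locally p_infty)
    (locally ((ray_int a s' d - ray_int a s d) + I)%C).
  apply: (filterlim_comp_2 (fun T => ray_partial a s' d T - ray_partial a s d T)%C (fun _ => I) Cplus
    _ (filterlim_const I) (filterlim_plus (V := C_R_NormedModule) _ _)).
  apply: (filterlim_comp_2 (fun T => ray_partial a s' d T) (fun T => - ray_partial a s d T)%C Cplus
    _ _ (filterlim_plus (V := C_R_NormedModule) _ _)).
    apply: ray_partial_lim => //; first lra; apply: Hsd'; lra.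
  refine (filterlim_comp _ _ _ _ Copp _ _ _ _ (filterlim_opp (V := C_R_NormedModule) _)).
  apply: ray_partial_lim => //; lra.
have L2 : filterlim (fun T => (ray_partial a s' d T - ray_partial a s d T) + I)%C (Rbar_locally p_infty) (locally (RtoC 0)).
  apply: (filterlim_C_0 _ _ _ (fun T => (s' - s) * exp (- (omega * Rpower T (rho j))))).
    exists (d + 1) => T HdT; rewrite -norm_C.
    apply: (norm_RInt_le (V := C_R_NormedModule) (fun u => pow_osc a (ray u T)) (fun _ => exp (- (omega * Rpower T (rho j)))) s s'); first lra.
    - move=> u Hu; rewrite norm_C; apply: Rle_trans (Cmod_pow_osc_ray_r a u T Ha _ _) _; try lra.
      rewrite -[X in _ <= X]Rmult_1_l; apply: Rmult_le_compat_r; first exact/Rlt_le/exp_pos.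
      apply: Rpower_le_1; lra.
    - apply: HT; lra.
    - exact: (is_RInt_const (V := R_NormedModule)).
  rewrite -(Rmult_0_r (s' - s)).
  refine (filterlim_comp _ _ _ _ (Rmult (s' - s)) _ _ _ exp_decay _).
  exact: (filterlim_Rbar_mult_l (s' - s) 0).
have E := filterlim_locally_unique (V := C_R_NormedModule) _ _ _ L1 L2.
transitivity ((ray_int a s' d - ray_int a s d + I) - I)%C; first ring.
by rewrite E; ring.
Qed.

(** By [ray_int_shift] the integral is a constant minus an ordinary integral from the base point s /
    2, which lies to the left of every u in the ball of radius s / 2 around s. *)
Lemma is_derive_ray_int (a s : R) :
  a <= 0 -> 0 < s ->
  is_derive (V := C_R_NormedModule) (fun s => ray_int a s 0) s (- pow_osc a (RtoC s))%C.
Proof.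
move=> Ha Hs.
have Hs2 : 0 < s / 2 by lra.
have D : is_derive (V := C_R_NormedModule) (fun u => ray_int a (s / 2) 0 - RInt (V := C_R_CompleteNormedModule) (fun u => pow_osc a (ray u 0)) (s / 2) u)%C s (- pow_osc a (RtoC s))%C.
  evar_last.
    apply: (is_derive_minus (V := C_R_NormedModule)); first exact: is_derive_const.
    have [|||K _] := RInt_C1_primitive C_R_CompleteNormedModule (fun u => pow_osc a (ray u 0)) 0 (s + 1) (s / 2) s; try lra; last exact: K.
    move=> x Hx; apply: continuous_pow_osc_ray_l; left; lra.
  rewrite ray_0_r; change ((RtoC 0 - pow_osc a (RtoC s))%C = (- pow_osc a (RtoC s))%C); ring.
apply: (is_derive_ext_loc (V := C_R_NormedModule)) D.
exists (mkposreal _ Hs2) => u; rewrite /ball /= /AbsRing_ball /= /abs /minus /plus /opp /= => /Rabs_def2 Hu.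
have := ray_int_shift a (s / 2) u 0 Ha _ (Rle_refl 0) (or_introl Hs2) => K.
transitivity (ray_int a (s / 2) 0 + (ray_int a u 0 - ray_int a (s / 2) 0))%C; last ring.
rewrite K; [ring | lra].
Qed.

(** On the half-line through the origin the phase is constant: z^a contributes a times the angle
    [sgn j * alpha], dz contributes it once more, and the oscillating factor is the real number
    e^(-omega t^rho_j). *)
Lemma ray_partial_0_l (a d T : R) (E : R -> R) :
  0 < d <= T ->
  (forall t, 0 < t ->
    C1_primitive (V := R_NormedModule) E (fun t => Rpower t a * exp (- (omega * Rpower t (rho j)))) t) ->
  ray_partial a 0 d T = (RtoC (E T - E d) * Cexp (0%R, (a + 1) * (sgn j * alpha))%R)%C.
Proof.
move=> Hd HE; have HPI := PI_RGT_0; have Hal := alpha_bound.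
set c := Cexp _.
have K := C1_primitive_is_RInt C_R_CompleteNormedModule (fun t => RtoC (E t) * c)%C (ray_integrand a 0) d T.
rewrite /ray_partial; transitivity (RtoC (E T) * c - RtoC (E d) * c)%C; last by rewrite RtoC_minus; ring.
apply: (is_RInt_unique (V := C_R_CompleteNormedModule)); apply: K => t.
rewrite Rmin_left ?Rmax_right; try lra; move=> Ht.
have Ht0 : 0 < t by lra.
split; last by apply: continuous_ray_integrand; right.
have [D _] := HE t Ht0; evar_last.
  exact: (is_derive_Cmult _ _ _ _ _ (is_derive_RtoC _ _ _ D) (is_derive_const (V := C_R_NormedModule) c t)).
change (RtoC (Rpower t a * exp (- (omega * Rpower t (rho j)))) * c + RtoC (E t) * RtoC 0 = ray_integrand a 0 t)%C.
have Hb : - PI < sgn j * alpha <= PI by case: j => /=; lra.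
rewrite /ray_integrand /pow_osc /osc ray_0_l !Cpower_polar //.
have -> : (RtoC (sgn j) * Ci * RtoC omega * (RtoC (Rpower t (rho j)) * Cexp (0, rho j * (sgn j * alpha))%R))%C
    = RtoC (- (omega * Rpower t (rho j))).
  have -> : rho j * (sgn j * alpha) = sgn j * (PI / 2) by rewrite /alpha; field; lra.
  have -> : Cexp (0, sgn j * (PI / 2))%R = (RtoC (sgn j) * Ci)%C.
    rewrite /Cexp /= exp_0; case: j => /=.
      by rewrite !Rmult_1_l cos_PI2 sin_PI2 /Cmult /=; congr (_, _); ring.
    rewrite (_ : -1 * (PI / 2) = - (PI / 2)) ?cos_neg ?sin_neg ?cos_PI2 ?sin_PI2; last ring.
    by rewrite /Cmult /=; congr (_, _); ring.
  rewrite /Cmult /=; have := sgn_sqr j => Hs.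
  rewrite /RtoC; congr (_, _); last ring.
  transitivity (- (omega * Rpower t (rho j)) * (sgn j * sgn j)); [ring | rewrite Hs; ring].
rewrite Cexp_RtoC RtoC_mult.
have -> : c = (Cexp (0, a * (sgn j * alpha))%R * ray_dir)%C.
  rewrite /ray_dir -Cexp_plus /c; congr Cexp; rewrite /Cplus /Cmult /alpha /=; congr (_, _); ring.
ring.
Qed.

(** The half-line is cut at [t = s]: both pieces up to [s] are small, and the
    remaining ones differ by the integral over a segment of length [s] at
    height [t = s], which is at most [s * s^(mu - 1)]. *)
Lemma ray_int_at_0 (mu : R) :
  0 < mu <= 1 ->
  filterlim (fun s => ray_int (mu - 1) s 0) (at_right 0)
    (locally (RtoC (/ rho j * Gamma (mu / rho j) * Rpower omega (- (mu / rho j)))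
      * Cexp (0%R, mu * (sgn j * alpha))%R)%C).
Proof.
move=> Hmu.
have Hr : 0 < rho j by lra.
have Hr1 : 0 < mu <= rho j by lra.
have [E [l0 [l1 [HE [H0 [H1 HG]]]]]] := stretched_exp_primitive (rho j) mu omega Hr Hr1 homega.
rewrite -HG; set c := Cexp _.
have Hc : Cmod c = 1 by rewrite /c Cmod_Cexp /= exp_0.
have Ha : mu - 1 <= 0 by lra.
have Htail d : 0 < d -> ray_int (mu - 1) 0 d = (RtoC (l1 - E d) * c)%C.
  move=> Hd.
  apply: (filterlim_locally_unique (V := C_R_NormedModule) (F := Rbar_locally p_infty) (ray_partial (mu - 1) 0 d)).
    by apply: ray_partial_lim => //; try lra; right.
  apply: (filterlim_ext_loc (fun T => RtoC (E T - E d) * c)%C).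
    exists d => T HT; rewrite (ray_partial_0_l (mu - 1) d T E) //; last lra.
    by rewrite (_ : mu - 1 + 1 = mu) //; ring.
  have K : continuous (U := C_UniformSpace) (fun x => RtoC x * c)%C (l1 - E d).
    apply: continuous_Cmult; last exact: continuous_const.
    apply: continuous_RtoC; exact: continuous_id.
  refine (filterlim_comp _ _ _ (fun T => E T - E d) (fun x => RtoC x * c)%C _ _ _ _ K).
  exact: filterlim_minus_const.
set L := (RtoC (l1 - l0) * c)%C.
have Main : filterlim (fun s => ray_int (mu - 1) s 0 - L)%C (at_right 0) (locally (RtoC 0)).
  (* The two copies of E s - l0 pay for the pieces up to t = s ([B1] and [B4]); s^mu pays for the
     connecting segment at height t = s ([B3]). *)
  apply: (filterlim_C_0 _ _ _ (fun s => 2 * (E s - l0) + Rpower s mu)); last first.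
    rewrite [X in locally X](_ : 0 = 2 * (l0 - l0) + 0); last ring.
    apply: (filterlim_comp_2 (fun s => 2 * (E s - l0)) (fun s => Rpower s mu) plus (G := locally (2 * (l0 - l0))) (H := locally 0) (I := locally (plus (2 * (l0 - l0)) 0))).
    + apply: filterlim_const_mult; exact: filterlim_minus_const.
    + by apply: Rpower_at_right_0; lra.
    + exact: (filterlim_plus (V := R_NormedModule)).
  exists (mkposreal 1 Rlt_0_1) => s _ Hs.
  have B1 : Cmod (ray_partial (mu - 1) s 0 s) <= E s - l0.
    by apply: ray_partial_le HE H0 _ => // t Ht; apply: Cmod_pow_osc_ray_r => //; lra.
  have B2 : (ray_partial (mu - 1) s 0 s + ray_int (mu - 1) s s)%C = ray_int (mu - 1) s 0.
    apply: (filterlim_locally_unique (V := C_R_NormedModule) (F := Rbar_locally p_infty) (ray_partial (mu - 1) s 0)).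
      apply: (filterlim_ext (fun T => ray_partial (mu - 1) s 0 s + ray_partial (mu - 1) s s T)%C).
        by move=> T; apply: ray_partial_Chasles.
      apply: (filterlim_comp_2 (fun _ => ray_partial (mu - 1) s 0 s) (ray_partial (mu - 1) s s) Cplus _ _ (filterlim_plus (V := C_R_NormedModule) _ _)).
        exact: filterlim_const.
      apply: ray_partial_lim => //; try lra; by left.
    apply: ray_partial_lim => //; try lra; by left.
  have B3 : Cmod (ray_int (mu - 1) s s - ray_int (mu - 1) 0 s)%C <= Rpower s mu.
    have Hs0 : 0 <= 0 <= s by lra.
    rewrite (ray_int_shift (mu - 1) 0 s s Ha Hs0 (Rlt_le _ _ Hs) (or_intror Hs)) Cmod_opp -norm_C.
    apply: Rle_trans (_ : (s - 0) * Rpower s (mu - 1) <= _).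
      apply: (norm_RInt_le (V := C_R_NormedModule) (fun u => pow_osc (mu - 1) (ray u s)) (fun _ => Rpower s (mu - 1)) 0 s); first lra.
      - move=> u Hu; rewrite norm_C; apply: Rle_trans (Cmod_pow_osc_ray_r (mu - 1) u s Ha _ Hs) _; first lra.
        rewrite -[X in _ <= X]Rmult_1_r; apply: Rmult_le_compat_l; first exact/Rlt_le/Rpower_pos.
        rewrite -exp_0; apply: Rlt_le; apply: exp_increasing.
        have : 0 < omega * Rpower s (rho j) by apply: Rmult_lt_0_compat => //; exact: Rpower_pos.
        lra.
      - apply: (RInt_correct (V := C_R_CompleteNormedModule)); apply: (ex_RInt_continuous (V := C_R_CompleteNormedModule)) => u _.
        apply: continuous_pow_osc_ray_l; by right.
      - exact: (is_RInt_const (V := R_NormedModule)).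
    rewrite Rpower_minus Rpower_1 //; right; field; lra.
  have B4 : Cmod (ray_int (mu - 1) 0 s - L)%C <= E s - l0.
    have HEs : 0 <= E s - l0 by apply: Rle_trans B1; exact: Cmod_ge_0.
    rewrite Htail // /L -(Cmod_opp); have -> : (- (RtoC (l1 - E s) * c - RtoC (l1 - l0) * c) = RtoC (E s - l0) * c)%C.
      rewrite !RtoC_minus; ring.
    rewrite Cmod_mult Hc Cmod_R Rabs_pos_eq //; lra.
  have -> : (ray_int (mu - 1) s 0 - L = ray_partial (mu - 1) s 0 s + ((ray_int (mu - 1) s s - ray_int (mu - 1) 0 s) + (ray_int (mu - 1) 0 s - L)))%C.
    rewrite -B2; ring.
  apply: Rle_trans (Cmod_triangle _ _) _.
  have := Cmod_triangle (ray_int (mu - 1) s s - ray_int (mu - 1) 0 s) (ray_int (mu - 1) 0 s - L).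
  lra.
apply: (filterlim_ext (fun s => ray_int (mu - 1) s 0 - L + L)%C) => [s|]; first ring.
rewrite [X in locally X](_ : L = RtoC 0 + L)%C; last ring.
exact: (filterlim_comp_2 (fun s => ray_int (mu - 1) s 0 - L)%C (fun _ => L) Cplus Main (filterlim_const L) (filterlim_plus (V := C_R_NormedModule) _ _)).
Qed.

(** The exponent b = mu - rho_j is the one for which the derivative of z^b e^(+- i omega z^rho_j)
    contains z^(mu - 1) e^(+- i omega z^rho_j); the boundary value at infinity vanishes by decay. *)
Lemma ray_int_by_parts (mu s : R) :
  0 < mu < 1 -> 0 < s ->
  (RtoC (sgn j) * Ci * RtoC omega * RtoC (rho j) * ray_int (mu - 1) s 0)%C =
  (- pow_osc (mu - rho j) (RtoC s) - RtoC (mu - rho j) * ray_int (mu - rho j - 1) s 0)%C.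
Proof.
move=> Hmu Hs.
set k := (RtoC (sgn j) * Ci * RtoC omega * RtoC (rho j))%C.
set b := mu - rho j.
have HT T : 0 < T -> (RtoC b * ray_partial (b - 1) s 0 T + k * ray_partial (mu - 1) s 0 T
    = pow_osc b (ray s T) - pow_osc b (RtoC s))%C.
  move=> HT; rewrite -[in RHS](ray_0_r s).
  have I1 := C1_primitive_is_RInt C_R_CompleteNormedModule (fun t => RtoC b * ray_partial (b - 1) s 0 t + k * ray_partial (mu - 1) s 0 t)%C
    (fun t => dpow_osc b (ray s t) * ray_dir)%C 0 T.
  have I2 := C1_primitive_is_RInt C_R_CompleteNormedModule (fun t => pow_osc b (ray s t))
    (fun t => dpow_osc b (ray s t) * ray_dir)%C 0 T.
  have Cn t : continuous (U := C_UniformSpace) (fun t => dpow_osc b (ray s t) * ray_dir)%C t.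
    apply: continuous_Cmult; last exact: continuous_const.
    apply: (continuous_comp (ray s) (dpow_osc b)); first exact: continuous_ray_r.
    by apply: continuous_dpow_osc; apply: slit_ray_neq; left.
  have D1 t : 0 <= t -> is_derive (V := C_R_NormedModule) (fun t => RtoC b * ray_partial (b - 1) s 0 t + k * ray_partial (mu - 1) s 0 t)%C t (dpow_osc b (ray s t) * ray_dir)%C.
    move=> Ht.
    have [P1 _] := ray_partial_primitive (b - 1) s 0 t (Rle_refl 0) (or_introl Hs) Ht.
    have [P2 _] := ray_partial_primitive (mu - 1) s 0 t (Rle_refl 0) (or_introl Hs) Ht.
    evar_last.
      apply: is_derive_Cplus; apply: is_derive_Cmult_l; [exact: P1 | exact: P2].
    rewrite /dpow_osc /ray_integrand (_ : b + rho j - 1 = mu - 1) -/k; last by rewrite /b; ring.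
    ring.
  have Hmin t : Rmin 0 T <= t <= Rmax 0 T -> 0 <= t by rewrite Rmin_left; lra.
  have J1 := is_RInt_unique (V := C_R_CompleteNormedModule) _ _ _ _ (I1 (fun t Ht => conj (D1 t (Hmin t Ht)) (Cn t))).
  have J2 := is_RInt_unique (V := C_R_CompleteNormedModule) _ _ _ _ (I2 (fun t _ => conj (is_derive_pow_osc (ray s) b t _ (slit_ray_neq s t (or_introl Hs)) (is_derive_ray_r s t)) (Cn t))).
  rewrite J1 in J2; rewrite -[RHS]J2.
  have Z a : ray_partial a s 0 0 = RtoC 0 by exact: (RInt_point (V := C_R_CompleteNormedModule)).
  rewrite !Z; change (RtoC b * ray_partial (b - 1) s 0 T + k * ray_partial (mu - 1) s 0 T
    = (RtoC b * ray_partial (b - 1) s 0 T + k * ray_partial (mu - 1) s 0 T) - (RtoC b * 0 + k * 0))%C; ring.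
have Hcm (c l : C) : continuous (U := C_UniformSpace) (fun z : C_UniformSpace => c * z)%C l.
  apply: continuous_Cmult; [exact: continuous_const | exact: continuous_id].
have L a : a <= 0 -> filterlim (ray_partial a s 0) (Rbar_locally p_infty) (locally (ray_int a s 0)).
  move=> Ha; apply: ray_partial_lim => //; try lra; by left.
have L1 : filterlim (fun T => RtoC b * ray_partial (b - 1) s 0 T + k * ray_partial (mu - 1) s 0 T)%C (Rbar_locally p_infty)
   (locally (RtoC b * ray_int (b - 1) s 0 + k * ray_int (mu - 1) s 0)%C).
  apply: (filterlim_comp_2 (fun T => RtoC b * ray_partial (b - 1) s 0 T)%C (fun T => k * ray_partial (mu - 1) s 0 T)%C Cplus _ _ (filterlim_plus (V := C_R_NormedModule) _ _)).
  - by refine (filterlim_comp _ _ _ _ (fun z => RtoC b * z)%C _ _ _ (L (b - 1) _) (Hcm _ _)); rewrite /b; lra.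
  - by refine (filterlim_comp _ _ _ _ (fun z => k * z)%C _ _ _ (L (mu - 1) _) (Hcm _ _)); lra.
have L2 : filterlim (fun T => RtoC b * ray_partial (b - 1) s 0 T + k * ray_partial (mu - 1) s 0 T)%C (Rbar_locally p_infty)
   (locally (RtoC 0 - pow_osc b (RtoC s))%C).
  apply: (filterlim_ext_loc (fun T => pow_osc b (ray s T) - pow_osc b (RtoC s))%C).
    by exists 0 => T HT'; rewrite HT.
  apply: (filterlim_comp_2 (fun T => pow_osc b (ray s T)) (fun _ => - pow_osc b (RtoC s))%C Cplus _ (filterlim_const _) (filterlim_plus (V := C_R_NormedModule) _ _)).
  apply: (filterlim_C_0 _ _ _ (fun T => Rpower s b * exp (- (omega * Rpower T (rho j))))).
    by exists 0 => T HT'; apply: Cmod_pow_osc_ray_l => //; rewrite /b; lra.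
  rewrite -(Rmult_0_r (Rpower s b)); exact: filterlim_const_mult exp_decay.
have E := filterlim_locally_unique (V := C_R_NormedModule) _ _ _ L1 L2.
transitivity ((RtoC b * ray_int (b - 1) s 0 + k * ray_int (mu - 1) s 0) - RtoC b * ray_int (b - 1) s 0)%C; first ring.
rewrite E; ring.
Qed.

End Ray.

(** * The change of variables at an end point *)

(** The local inverse is differentiable at [f x] because the difference
    quotients of [g] are the inverses of those of [f]. *)
Lemma is_derive_inverse (f df g : R -> R) (a b x : R) :
  (forall x, a < x < b -> is_derive f x (df x)) ->
  (forall x, a < x < b -> 0 < df x) ->
  (forall x, a < x < b -> g (f x) = x) ->
  a < x < b -> is_derive g (f x) (/ df x).
Proof.
move=> Hf Hdf Hg Hx.
have Hc y : a < y < b -> continuity_pt f y.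
  move=> Hy; apply/continuity_pt_filterlim; apply: (ex_derive_continuous (V := R_NormedModule)).
  by exists (df y); exact: Hf.
have Hlt y z : a < y -> y < z -> z < b -> f y < f z.
  move=> Hy Hyz Hz; apply: (is_derive_pos_lt f df) => // t Ht; [apply: Hf | apply: Hdf]; lra.
have Hd : 0 < df x by exact: Hdf.
apply/is_derive_Reals => eps Heps.
have Q : locally (df x) (fun q => Rabs (/ q - / df x) < eps /\ 0 < q).
  apply: filter_and; last exact: (open_gt 0).
  exact: filterlim_Rabs Heps (continuous_Rinv (df x) (Rgt_not_eq _ _ Hd)).
move: Q => [e1 HQ].
have /is_derive_Reals /(_ e1 (cond_pos e1)) [d0 Hd0] := Hf x Hx.
(* [eta] keeps x +- eta inside (a, b) and within the range where the quotients of f are controlled.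
   The intermediate value theorem on [x - eta, x + eta] then writes every value near f x as f y,
   where g is known. *)
pose eta := Rmin (d0 / 2) (Rmin ((x - a) / 2) ((b - x) / 2)).
have Heta : 0 < eta.
  apply: Rmin_pos; first by have := cond_pos d0; lra.
  apply: Rmin_pos; lra.
have E1 : eta <= d0 / 2 by apply: Rmin_l.
have E2 : eta <= (x - a) / 2 by apply: Rle_trans (Rmin_r _ _) _; apply: Rmin_l.
have E3 : eta <= (b - x) / 2 by apply: Rle_trans (Rmin_r _ _) _; apply: Rmin_r.
have F1 : f (x - eta) < f x by apply: Hlt; lra.
have F2 : f x < f (x + eta) by apply: Hlt; lra.
have Hdel : 0 < Rmin (f x - f (x - eta)) (f (x + eta) - f x) by apply: Rmin_pos; lra.
exists (mkposreal _ Hdel) => k Hk0 /= /Rabs_def2 Hk.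
have K1 := Rmin_l (f x - f (x - eta)) (f (x + eta) - f x).
have K2 := Rmin_r (f x - f (x - eta)) (f (x + eta) - f x).
have [y [Hy Ey]] : {y | x - eta <= y <= x + eta /\ f y - (f x + k) = 0}.
  apply: Ranalysis5.IVT_interv; [move=> t Ht | lra | lra | lra].
  apply: continuity_pt_minus; first by apply: Hc; lra.
  by apply: continuity_pt_const => ? ?.
have {}Ey : f y = f x + k by lra.
rewrite -Ey !Hg; try lra.
have Hyx : y - x <> 0.
  move=> H; apply: Hk0; have E : y = x by lra.
  by rewrite E in Ey; lra.
have := Hd0 (y - x) Hyx; rewrite (_ : x + (y - x) = y); last ring.
rewrite Ey (_ : f x + k - f x = k); last ring.
move=> H; have {}H : Rabs (k / (y - x) - df x) < e1.
  apply: H; apply: Rle_lt_trans (_ : eta < _); last by have := cond_pos d0; lra.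
  apply: Rabs_le; lra.
have [] := HQ _ H.
by rewrite (_ : / (k / (y - x)) = (y - x) / k) //; field.
Qed.

Definition bounded_at_0 (f : R -> C) : Prop := exists B, at_right 0 (fun y => Cmod (f y) <= B).

Lemma bounded_at_0_plus (f g : R -> C) :
  bounded_at_0 f -> bounded_at_0 g -> bounded_at_0 (fun y => f y + g y)%C.
Proof.
move=> [B HB] [D HD]; exists (B + D).
apply: filter_imp (filter_and _ _ HB HD) => y [H1 H2].
apply: Rle_trans (Cmod_triangle _ _) _; lra.
Qed.

Lemma bounded_at_0_mult (f g : R -> C) :
  bounded_at_0 f -> bounded_at_0 g -> bounded_at_0 (fun y => f y * g y)%C.
Proof.
move=> [B HB] [D HD]; exists (B * D).
apply: filter_imp (filter_and _ _ HB HD) => y [H1 H2].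
rewrite Cmod_mult; apply: Rmult_le_compat => //; exact: Cmod_ge_0.
Qed.

Lemma bounded_at_0_lim (f : R -> C) (l : C) :
  filterlim f (at_right 0) (locally l) -> bounded_at_0 f.
Proof.
move=> H; exists (Cmod l + 1).
have K : filterlim (fun y => Cmod (f y)) (at_right 0) (locally (Cmod l)).
  exact: filterlim_comp H (continuous_Cmod l).
apply: filter_imp (filterlim_Rabs _ _ _ _ _ Rlt_0_1 K) => y /Rabs_def2; lra.
Qed.

Lemma bounded_at_0_RtoC_lim (f : R -> R) (l : R) :
  filterlim f (at_right 0) (locally l) -> bounded_at_0 (fun y => RtoC (f y)).
Proof.
by move=> H; apply: (bounded_at_0_lim _ (RtoC l)); exact: filterlim_RtoC.
Qed.

Lemma bounded_at_0_RtoC (f : R -> R) (B : R) :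
  at_right 0 (fun y => Rabs (f y) <= B) -> bounded_at_0 (fun y => RtoC (f y)).
Proof. by move=> H; exists B; apply: filter_imp H => y; rewrite Cmod_R. Qed.

(** * A one-sided model of an end point: chi' = y^(rho - 1) h with h > 0 up to y = 0 *)

Section OneSided.

Context (rho mu L : R) (chi h dh : R -> R) (v dv : R -> C) (h0 M : R) (v0 : C)
  (hrho : 1 <= rho) (hL : 0 < L)
  (hchi : forall y, 0 < y < L -> is_derive chi y (Rpower y (rho - 1) * h y))
  (hchi0 : filterlim chi (at_right 0) (locally 0))
  (hpos : forall y, 0 < y < L -> 0 < h y)
  (hder : forall y, 0 < y < L -> C1_primitive (V := R_NormedModule) h dh y)
  (h0pos : 0 < h0)
  (hlim : filterlim h (at_right 0) (locally h0))
  (hdh : at_right 0 (fun y => Rabs (dh y) <= M))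
  (vder : forall y, 0 < y < L -> C1_primitive (V := C_R_NormedModule) v dv y)
  (hv0 : filterlim v (at_right 0) (locally v0))
  (hdv : bounded_at_0 dv).

Lemma at_right_0_L : at_right 0 (fun y => 0 < y < L).
Proof. exact: (at_right_0_intro _ L). Qed.

Lemma h_linear : at_right 0 (fun y => Rabs (h y - h0) <= M * y).
Proof.
have [eps [He H]] := at_right_0_elim _ (filter_and _ _ hdh at_right_0_L).
apply: (at_right_0_intro _ eps) => // y Hy.
have := C1_primitive_norm_le_right R_CompleteNormedModule h dh (fun y => M * y) (fun _ => M) y h0 (M * 0) (proj1 Hy).
rewrite Rmult_0_r Rminus_0_r; apply => // [x Hx|x Hx|x Hx|].
- have Hx' : 0 < x < eps by lra.
  by have [_ ?] := H x Hx'; exact: hder.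
- split; last exact: continuous_const.
  by auto_derive => //; ring.
- have Hx' : 0 < x < eps by lra.
  by have [] := H x Hx'.
- rewrite -{2}(Rmult_0_r M); apply: filterlim_const_mult; exact: filterlim_at_right_0_id.
Qed.

Lemma continuous_h (y : R) : 0 < y < L -> continuous h y.
Proof. by move=> /hder [D _]; apply: (ex_derive_continuous (V := R_NormedModule)); exists (dh y). Qed.

Lemma chi_incr (x y : R) : 0 < x -> x < y -> y < L -> chi x < chi y.
Proof.
move=> Hx Hxy Hy; apply: (is_derive_pos_lt chi (fun y => Rpower y (rho - 1) * h y)) => // t Ht.
  apply: hchi; lra.
apply: Rmult_lt_0_compat; [exact: Rpower_pos | apply: hpos; lra].
Qed.

Lemma chi_pos (y : R) : 0 < y < L -> 0 < chi y.
Proof.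
(* The limit at 0 gives only chi (y / 2) >= 0; strictness comes from monotonicity between y / 2 and
   y. *)
move=> Hy; apply: Rle_lt_trans (_ : chi (y / 2) < _); last by apply: chi_incr; lra.
have K : Rbar_le 0 (chi (y / 2)); last by [].
apply: (filterlim_le (F := at_right 0) chi (fun _ => chi (y / 2))) => //; last exact: filterlim_const.
apply: (at_right_0_intro _ (y / 2)); first lra.
move=> t Ht; apply: Rlt_le; apply: chi_incr; lra.
Qed.

(** The singular factors of [k_j] cancel once everything is written in terms
    of [chi(y) / y^rho], which has a positive limit and a bounded derivative
    at [0]. *)
Definition ratio (y : R) : R := chi y / Rpower y rho.

Lemma ratio_pos (y : R) : 0 < y < L -> 0 < ratio y.
Proof. move=> Hy; apply: Rdiv_lt_0_compat; [exact: chi_pos | exact: Rpower_pos]. Qed.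

(** Integrating |h - h0| <= M y against y^(rho - 1) bounds chi - (h0 / rho) y^rho by M / (rho + 1)
    y^(rho + 1); it remains to divide by y^rho. *)
Lemma ratio_linear :
  at_right 0 (fun y => Rabs (ratio y - h0 / rho) <= M / (rho + 1) * y).
Proof.
have [eps [He H]] := at_right_0_elim _ (filter_and _ _ h_linear at_right_0_L).
apply: (at_right_0_intro _ eps) => // y Hy.
have Hp b : 0 < rho + b -> filterlim (fun y => Rpower y (rho + b)) (at_right 0) (locally 0) by move=> ?; exact: Rpower_at_right_0.
have D (c b x : R) : 0 < b -> 0 < x -> is_derive (fun y => c / b * Rpower y b) x (c * Rpower x (b - 1)).
  move=> Hb Hx; evar_last; first exact: is_derive_scal _ _ _ _ (is_derive_Rpower b x Hx).
  rewrite /scal /= /mult /=; field; lra.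
have Hcr (b x : R) : 0 < x -> continuous (fun y => Rpower y b) x by move=> ?; exact: continuous_Rpower.
have := C1_primitive_norm_le_right R_CompleteNormedModule
  (fun y => chi y - h0 / rho * Rpower y rho) (fun y => Rpower y (rho - 1) * h y - h0 * Rpower y (rho - 1))
  (fun y => M / (rho + 1) * Rpower y (rho + 1)) (fun y => M * Rpower y (rho + 1 - 1)) y 0 0 (proj1 Hy).
rewrite /minus opp_zero plus_zero_r Rminus_0_r => K.
have {}K : Rabs (chi y - h0 / rho * Rpower y rho) <= M / (rho + 1) * Rpower y (rho + 1).
  apply: K => [x Hx|x Hx|x Hx||].
  - split.
      apply: (is_derive_minus (V := R_NormedModule)); last by apply: D; lra.
      have Hx' : 0 < x < eps by lra.
      by apply: hchi; have [] := H x Hx'.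
    apply: (continuous_minus (V := R_NormedModule)).
      apply: (continuous_mult (K := R_AbsRing)); first by apply: Hcr; lra.
      have Hx' : 0 < x < eps by lra.
      by apply: continuous_h; have [] := H x Hx'.
    apply: (continuous_scal_r (V := R_NormedModule)); apply: Hcr; lra.
  - split; first by apply: D; lra.
    apply: (continuous_scal_r (V := R_NormedModule)); apply: Hcr; lra.
  - have Hx' : 0 < x < eps by lra.
    have [H1 _] := H x Hx'.
    have -> : M * Rpower x (rho + 1 - 1) = Rpower x (rho - 1) * (M * x).
      rewrite (_ : rho + 1 - 1 = rho - 1 + 1); last ring.
      rewrite (Rpower_plus (rho - 1) 1) Rpower_1; [ring | lra].
    rewrite (_ : Rpower x (rho - 1) * h x - h0 * Rpower x (rho - 1) = Rpower x (rho - 1) * (h x - h0)); last ring.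
    rewrite /norm /= /abs /= Rabs_mult (Rabs_pos_eq (Rpower _ _)); last exact/Rlt_le/Rpower_pos.
    apply: Rmult_le_compat_l => //; exact/Rlt_le/Rpower_pos.
  - rewrite [X in locally X](_ : 0 = 0 - h0 / rho * 0); last ring.
    apply: (filterlim_comp_2 chi (fun y => opp (h0 / rho * Rpower y rho)) plus (G := locally 0) (H := locally (opp (h0 / rho * 0))) (I := locally (plus 0 (opp (h0 / rho * 0))))) => //.
      refine (filterlim_comp _ _ _ _ Ropp _ _ _ (filterlim_const_mult _ _ _ 0 _ _) (filterlim_opp (V := R_NormedModule) _)).
      apply: Rpower_at_right_0; lra.
    exact: (filterlim_plus (V := R_NormedModule)).
  - rewrite [X in locally X](_ : 0 = M / (rho + 1) * 0); last ring.
    apply: filterlim_const_mult; apply: Hp; lra.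
have Hyr := Rpower_pos y rho.
rewrite (_ : ratio y - h0 / rho = (chi y - h0 / rho * Rpower y rho) / Rpower y rho); last by rewrite /ratio; field; lra.
rewrite Rabs_div; last lra.
rewrite (Rabs_pos_eq (Rpower _ _)); last lra.
apply: (Rmult_le_reg_r (Rpower y rho)) => //.
rewrite /Rdiv Rmult_assoc Rinv_l ?Rmult_1_r; last lra.
apply: Rle_trans K _; rewrite Rpower_plus Rpower_1; last lra.
right; rewrite /Rdiv; ring.
Qed.

Lemma ratio_lim : filterlim ratio (at_right 0) (locally (h0 / rho)).
Proof. exact: filterlim_at_right_0_linear ratio_linear. Qed.

Definition dratio (y : R) : R := (h y - rho * ratio y) / y.

Lemma ratio_C1 (y : R) : 0 < y < L -> C1_primitive (V := R_NormedModule) ratio dratio y.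
Proof.
move=> Hy; have Hyr := Rpower_pos y rho.
have D : is_derive ratio y (dratio y).
  evar_last.
    apply: is_derive_div; [exact: hchi | apply: is_derive_Rpower; lra | lra].
  rewrite /dratio /ratio Rpower_minus Rpower_1; last lra.
  field; lra.
split => //.
apply: (continuous_mult (K := R_AbsRing)); last by apply: continuous_Rinv; lra.
apply: (continuous_minus (V := R_NormedModule)); first exact: continuous_h.
apply: (continuous_scal_r (V := R_NormedModule)).
by apply: (ex_derive_continuous (V := R_NormedModule)); exists (dratio y).
Qed.

(** The numerator h - rho * [ratio] equals (h - h0) - rho ([ratio] - h0 / rho), and both terms are
    O(y), which compensates the division by y. *)
Lemma dratio_bounded : bounded_at_0 (fun y => RtoC (dratio y)).
Proof.
apply: (bounded_at_0_RtoC _ (M + rho * (M / (rho + 1)))).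
apply: filter_imp (filter_and _ _ at_right_0_L (filter_and _ _ h_linear ratio_linear)) => y [Hy [H1 H2]].
rewrite /dratio (_ : h y - rho * ratio y = (h y - h0) - rho * (ratio y - h0 / rho)); last by field; lra.
rewrite Rabs_div; last lra.
rewrite (Rabs_pos_eq y); last lra.
apply: (Rmult_le_reg_r y); first lra.
rewrite /Rdiv Rmult_assoc Rinv_l ?Rmult_1_r; last lra.
apply: Rle_trans (Rabs_triang _ _) _; rewrite Rabs_Ropp Rabs_mult (Rabs_pos_eq rho); last lra.
have := Rmult_le_compat_l rho _ _ (Rle_trans _ _ _ Rle_0_1 hrho) H2; rewrite /Rdiv; lra.
Qed.

Definition Phi (y : R) : R := Rpower (chi y) (/ rho).
(** The chain rule yields chi^(1/rho - 1) y^(rho - 1) h / rho; rewritten with [ratio] it has no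
    power of y left, and its positive limit at 0 is visible. *)
Definition dPhi (y : R) : R := / rho * Rpower (ratio y) (/ rho - 1) * h y.

Lemma chi_ratio (y : R) : chi y = ratio y * Rpower y rho.
Proof. rewrite /ratio; have := Rpower_pos y rho => H; field; lra. Qed.

Lemma Phi_ratio (y : R) : 0 < y < L -> Phi y = y * Rpower (ratio y) (/ rho).
Proof.
move=> Hy; rewrite /Phi chi_ratio -Rpower_mult_distr; [|exact: ratio_pos|exact: Rpower_pos].
rewrite Rpower_mult Rinv_r ?Rpower_1; try lra; ring.
Qed.

Lemma dPhi_pos (y : R) : 0 < y < L -> 0 < dPhi y.
Proof.
move=> Hy; apply: Rmult_lt_0_compat; last exact: hpos.
apply: Rmult_lt_0_compat; [apply: Rinv_0_lt_compat; lra | exact: Rpower_pos].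
Qed.

Lemma Phi_pos (y : R) : 0 < Phi y.
Proof. exact: Rpower_pos. Qed.

Lemma is_derive_Phi (y : R) : 0 < y < L -> is_derive Phi y (dPhi y).
Proof.
move=> Hy; evar_last.
  apply: (is_derive_comp (fun x => Rpower x (/ rho)) chi); last exact: hchi.
  apply: is_derive_Rpower; exact: chi_pos.
have Hyr := Rpower_pos y rho.
rewrite /scal /= /mult /= /dPhi chi_ratio -Rpower_mult_distr //; last exact: ratio_pos.
rewrite (_ : Rpower (Rpower y rho) (/ rho - 1) = / Rpower y (rho - 1)).
  by have := Rpower_pos y (rho - 1) => H; field; lra.
rewrite Rpower_mult -Rpower_Ropp; congr Rpower; field; lra.
Qed.

Lemma continuous_ratio_Rpower (a y : R) : 0 < y < L -> continuous (fun y => Rpower (ratio y) a) y.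
Proof.
move=> Hy; have [D _] := ratio_C1 y Hy.
apply: (continuous_comp ratio (fun x => Rpower x a)).
  by apply: (ex_derive_continuous (V := R_NormedModule)); exists (dratio y).
apply: continuous_Rpower; exact: ratio_pos.
Qed.

Lemma ratio_Rpower_lim (a : R) :
  filterlim (fun y => Rpower (ratio y) a) (at_right 0) (locally (Rpower (h0 / rho) a)).
Proof.
have H : 0 < h0 / rho by apply: Rdiv_lt_0_compat; lra.
exact: filterlim_comp ratio_lim (continuous_Rpower a _ H).
Qed.

Lemma inv_h_lim : filterlim (fun y => / h y) (at_right 0) (locally (/ h0)).
Proof. by apply: filterlim_comp hlim (continuous_Rinv h0 _); lra. Qed.

Definition inv_dPhi (y : R) : R := rho * (Rpower (ratio y) (1 - / rho) * / h y).

Lemma inv_dPhi_eq (y : R) : 0 < y < L -> / dPhi y = inv_dPhi y.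
Proof.
move=> Hy; have Hh := hpos y Hy; have Hr := ratio_pos y Hy.
rewrite /dPhi /inv_dPhi (_ : 1 - / rho = - (/ rho - 1)) ?Rpower_Ropp; last ring.
have := Rpower_pos (ratio y) (/ rho - 1) => H; field; lra.
Qed.

Lemma inv_dPhi_lim : exists l, filterlim inv_dPhi (at_right 0) (locally l).
Proof.
eexists; apply: filterlim_const_mult; apply: filterlim_Rmult; [exact: ratio_Rpower_lim | exact: inv_h_lim].
Qed.

Lemma continuous_inv_dPhi (y : R) : 0 < y < L -> continuous inv_dPhi y.
Proof.
move=> Hy; apply: (continuous_scal_r (V := R_NormedModule)).
apply: (continuous_mult (K := R_AbsRing)); first exact: continuous_ratio_Rpower.
apply: continuous_comp; first exact: continuous_h.
apply: continuous_Rinv; have := hpos y Hy; lra.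
Qed.

Lemma Phi_lim : filterlim Phi (at_right 0) (locally 0).
Proof.
apply: (filterlim_ext_loc (fun y => y * Rpower (ratio y) (/ rho))).
  by apply: filter_imp at_right_0_L => y Hy; rewrite Phi_ratio.
have K := filterlim_Rmult _ _ (at_right 0) _ _ _ filterlim_at_right_0_id (ratio_Rpower_lim (/ rho)).
rewrite Rmult_0_l in K; exact: K.
Qed.

Lemma Phi_incr (x y : R) : 0 < x -> x < y -> y < L -> Phi x < Phi y.
Proof.
move=> Hx Hxy Hy; apply: Rlt_Rpower_l; first by apply: Rinv_0_lt_compat; lra.
by split; [apply: chi_pos; lra | exact: chi_incr].
Qed.

Lemma Phi_surj (y s : R) : 0 < y < L -> 0 < s <= Phi y -> exists x, 0 < x <= y /\ Phi x = s.
Proof.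
move=> Hy [Hs [Hs' | ->]]; last by exists y; split => //; lra.
have H : at_right 0 (fun x => Phi x < s).
  by apply: filter_imp (filterlim_Rabs _ _ _ _ _ Hs Phi_lim) => x /Rabs_def2; lra.
have [e [He {}H]] := at_right_0_elim _ H.
pose x0 := Rmin (e / 2) (y / 2).
have Hx0 : 0 < x0 by apply: Rmin_pos; lra.
have Hx1 : x0 <= e / 2 by apply: Rmin_l.
have Hx2 : x0 <= y / 2 by apply: Rmin_r.
have Hl : Phi x0 < s by apply: H; lra.
have [x [Hx E]] : {x | x0 <= x <= y /\ Phi x - s = 0}.
  apply: Ranalysis5.IVT_interv; [move=> t Ht | lra | lra | lra].
  apply: continuity_pt_minus; last by apply: continuity_pt_const => ? ?.
  apply/continuity_pt_filterlim; apply: (ex_derive_continuous (V := R_NormedModule)).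
  eexists; apply: is_derive_Phi; lra.
by exists x; split; lra.
Qed.

(** The function k_j in the variable y, up to sign. Its exponent is (rho - mu) / rho = (1 - mu) /
    rho + (1 - 1 / rho): the first part comes from y^(mu - 1) Phi^(1 - mu), the second from 1 /
    Phi'. *)
Definition weight (y : R) : C :=
  (RtoC (rho * (Rpower (ratio y) ((rho - mu) / rho) * / h y)) * v y)%C.

Lemma weight_eq (y : R) :
  0 < y < L ->
  (RtoC (Rpower y (mu - 1) * Rpower (Phi y) (1 - mu) * / dPhi y) * v y)%C = weight y.
Proof.
move=> Hy; rewrite /weight; congr (RtoC _ * _)%C.
have Hr := ratio_pos y Hy.
rewrite inv_dPhi_eq // /inv_dPhi Phi_ratio // -Rpower_mult_distr; [|lra|exact: Rpower_pos].
rewrite Rpower_mult.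
have -> : (rho - mu) / rho = / rho * (1 - mu) + (1 - / rho) by field; lra.
rewrite Rpower_plus (_ : mu - 1 = - (1 - mu)) ?Rpower_Ropp; last ring.
have := Rpower_pos y (1 - mu) => H; field; split; last lra.
have := hpos y Hy; lra.
Qed.

Definition dweight (y : R) : C :=
  (RtoC (rho * ((rho - mu) / rho * Rpower (ratio y) ((rho - mu) / rho - 1) * dratio y * / h y
         + Rpower (ratio y) ((rho - mu) / rho) * (- (dh y) * (/ h y * / h y)))) * v y
   + RtoC (rho * (Rpower (ratio y) ((rho - mu) / rho) * / h y)) * dv y)%C.

Lemma weight_C1 (y : R) : 0 < y < L -> C1_primitive (V := C_R_NormedModule) weight dweight y.
Proof.
move=> Hy; have Hh := hpos y Hy; have [D1 C1] := ratio_C1 y Hy.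
have [D2 C2] := hder y Hy; have [D3 C3] := vder y Hy.
have Hinv : continuous (fun y => / h y) y.
  by apply: continuous_comp; [exact: continuous_h | apply: continuous_Rinv; lra].
have Hv : continuous (U := C_UniformSpace) v y.
  by apply: (ex_derive_continuous (V := C_R_NormedModule)); exists (dv y).
split.
- apply: is_derive_Cmult => //; apply: is_derive_RtoC; apply: is_derive_scal.
  evar_last.
    apply: is_derive_mult; last exact: Rmult_comm.
      apply: (is_derive_comp (fun x => Rpower x ((rho - mu) / rho)) ratio); last exact: D1.
      apply: is_derive_Rpower; exact: ratio_pos.
    exact: (is_derive_inv h y _ D2 (Rgt_not_eq _ _ Hh)).
  rewrite /plus /mult /scal /= /mult /=; field; lra.
- have HR a := continuous_ratio_Rpower a y Hy.
  apply: continuous_Cplus; apply: continuous_Cmult => //; apply: continuous_RtoC; apply: (continuous_scal_r (V := R_NormedModule)).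
    apply: (continuous_plus (V := R_NormedModule)).
      apply: (continuous_mult (K := R_AbsRing)) => //.
      apply: (continuous_mult (K := R_AbsRing)) => //.
      exact: (continuous_scal_r (V := R_NormedModule)).
    apply: (continuous_mult (K := R_AbsRing)) => //.
    apply: (continuous_mult (K := R_AbsRing)); first exact: (continuous_opp (V := R_NormedModule)).
    exact: (continuous_mult (K := R_AbsRing)).
  exact: (continuous_mult (K := R_AbsRing)).
Qed.

Lemma dweight_bounded : bounded_at_0 dweight.
Proof.
have B1 a := bounded_at_0_RtoC_lim _ _ (ratio_Rpower_lim a).
have B2 := bounded_at_0_RtoC_lim _ _ inv_h_lim.
have B3 := dratio_bounded.
have B4 := bounded_at_0_RtoC _ _ hdh.
have B5 := bounded_at_0_lim _ _ hv0.
have Bc c : bounded_at_0 (fun _ => RtoC c) by exists (Cmod c); apply: filter_forall => y; right.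
pose a := (rho - mu) / rho.
(* [dweight] with each factor embedded in C separately, so that closure of boundedness under sums
   and products settles it. *)
have [B HB] : bounded_at_0 (fun y => RtoC rho * (RtoC a * RtoC (Rpower (ratio y) (a - 1)) * RtoC (dratio y) * RtoC (/ h y)
   + RtoC (Rpower (ratio y) a) * (RtoC (-1) * RtoC (dh y) * (RtoC (/ h y) * RtoC (/ h y)))) * v y
   + RtoC rho * (RtoC (Rpower (ratio y) a) * RtoC (/ h y)) * dv y)%C.
  by repeat first [assumption | apply: B1 | apply: Bc | apply: bounded_at_0_plus | apply: bounded_at_0_mult].
exists B; apply: filter_imp HB => y.
rewrite /dweight -/a (_ : - dh y = -1 * dh y); last ring.
by rewrite !(RtoC_mult, RtoC_plus).
Qed.

Lemma weight_lim : exists l, filterlim weight (at_right 0) (locally l).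
Proof.
have [l Hl] : exists l, filterlim (fun y => rho * (Rpower (ratio y) ((rho - mu) / rho) * / h y)) (at_right 0) (locally l).
  eexists; apply: filterlim_const_mult; apply: filterlim_Rmult; [exact: ratio_Rpower_lim | exact: inv_h_lim].
exists (RtoC l * v0)%C.
by apply: filterlim_Cmult => //; exact: filterlim_RtoC.
Qed.

Lemma kappa_exists (l : R) (G : R -> R) :
  0 < l < L -> (forall y, 0 < y < L -> G (Phi y) = y) ->
  exists (kappa dkappa : R -> C) (kappa0 : C),
    (forall y, 0 < y < L -> kappa (Phi y) = weight y) /\
    (exists s1, Phi l < s1 /\
      forall s, 0 < s < s1 -> C1_primitive (V := C_R_NormedModule) kappa dkappa s) /\
    filterlim kappa (at_right 0) (locally kappa0) /\
    bounded_at_0 dkappa.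
Proof.
move=> Hl HG.
(* A point beyond l: it makes [kappa] of class C^1 on an open interval containing Phi l = s_j, so
   derivatives at s_j are two-sided. *)
pose l' := (l + L) / 2.
have Hl' : l < l' < L by rewrite /l'; lra.
have Hsurj s : 0 < s <= Phi l' -> 0 < G s < L /\ Phi (G s) = s /\ G s <= l'.
  move=> Hs; have Hl0 : 0 < l' < L by lra.
  have [x [Hx E]] := Phi_surj l' s Hl0 Hs.
  by rewrite -E HG; [split; [|split] => //; lra | lra].
have HdG y : 0 < y < L -> is_derive G (Phi y) (inv_dPhi y).
  move=> Hy; rewrite -inv_dPhi_eq //.
  apply: (is_derive_inverse Phi dPhi G 0 L) => //; [exact: is_derive_Phi | exact: dPhi_pos].
(* Any s below Phi e' is attained at some x <= e' < e, and G returns this x. *)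
have HG0 : filterlim G (at_right 0) (at_right 0).
  move=> Q HQ; have [e [He {}HQ]] := at_right_0_elim _ HQ.
  pose e' := Rmin (e / 2) (l / 2).
  have He' : 0 < e' by apply: Rmin_pos; lra.
  have E1 : e' <= e / 2 by apply: Rmin_l.
  have E2 : e' <= l / 2 by apply: Rmin_r.
  apply: (at_right_0_intro _ (Phi e')); first exact: Phi_pos.
  have Hl0 : 0 < e' < L by lra.
  move=> s Hs; have Hs' : 0 < s <= Phi e' by lra.
  have [x [Hx <-]] := Phi_surj e' s Hl0 Hs'.
  rewrite HG; [apply: HQ; lra | lra].
exists (fun s => weight (G s)), (fun s => RtoC (inv_dPhi (G s)) * dweight (G s))%C.
have [k0 Hk0] := weight_lim; exists k0.
split; first by move=> y Hy; rewrite HG.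
split; [|split].
- exists (Phi l'); split; first by apply: Phi_incr; lra.
  move=> s Hs.
  have Hs' : 0 < s <= Phi l' by lra.
  have [Hy [E _]] := Hsurj s Hs'.
  move: (G s) Hy E => y Hy E; subst s.
  have Hy1 := HdG y Hy; have EG := HG y Hy.
  have [Dw Cw] := weight_C1 y Hy.
  have CG : continuous G (Phi y) by apply: (ex_derive_continuous (V := R_NormedModule)); exists (inv_dPhi y).
  split.
    evar_last.
      apply: (is_derive_comp (V := C_R_NormedModule) weight G); last exact: Hy1.
      by rewrite EG; exact: Dw.
    rewrite EG /scal /= /prod_scal /scal /= /mult /= /Cmult /RtoC /=.
    by case: (dweight y) => p1 p2 /=; congr (_, _); ring.
  apply: continuous_Cmult.
    apply: continuous_RtoC; apply: continuous_comp => //; rewrite EG; exact: continuous_inv_dPhi.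
  by apply: continuous_comp => //; rewrite EG.
- exact: filterlim_comp HG0 Hk0.
- have [m Hm] := inv_dPhi_lim.
  have [B HB] := bounded_at_0_mult _ _ (bounded_at_0_RtoC_lim _ _ Hm) dweight_bounded.
  exists B; exact: (HG0 _ HB).
Qed.

Lemma Phi_rho (y : R) : 0 < y < L -> Rpower (Phi y) rho = chi y.
Proof.
move=> Hy; rewrite /Phi Rpower_mult Rinv_l ?Rpower_1 //; [exact: chi_pos | lra].
Qed.

Lemma dchi_Phi (y : R) :
  0 < y < L -> Rpower y (rho - 1) * h y = rho * Rpower (Phi y) (rho - 1) * dPhi y.
Proof.
move=> Hy; rewrite -(is_derive_unique _ _ _ (hchi y Hy)); apply: is_derive_unique.
apply: (is_derive_ext_loc (fun t => Rpower (Phi t) rho)).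
  by apply: filter_imp (locally_interval 0 L y Hy) => t Ht; exact: Phi_rho.
evar_last.
  apply: (is_derive_comp (fun x => Rpower x rho) Phi); last exact: is_derive_Phi.
  apply: is_derive_Rpower; exact: Phi_pos.
by rewrite /scal /= /mult /= Rmult_comm.
Qed.

Lemma chart_exists (l : R) :
  0 < l < L ->
  exists (Phi dPhi G : R -> R) (kappa dkappa : R -> C) (kappa0 : C) (s1 : R),
    (forall y, 0 < y < L ->
      Phi y = Rpower (chi y) (/ rho) /\ 0 < chi y /\ 0 < Phi y /\ Rpower (Phi y) rho = chi y /\
      Rpower y (rho - 1) * h y = rho * Rpower (Phi y) (rho - 1) * dPhi y /\
      is_derive Phi y (dPhi y) /\ 0 < dPhi y /\
      G (Phi y) = y /\ is_derive G (Phi y) (/ dPhi y) /\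
      kappa (Phi y) =
        (RtoC (Rpower y (mu - 1)) * v y * RtoC (Rpower (Phi y) (1 - mu) * / dPhi y))%C) /\
    (forall x y, 0 < x -> x < y -> y < L -> Phi x < Phi y) /\
    filterlim Phi (at_right 0) (locally 0) /\
    (forall s, 0 < s <= Phi l -> exists y, 0 < y <= l /\ Phi y = s) /\
    Phi l < s1 /\
    (forall s, 0 < s < s1 -> C1_primitive (V := C_R_NormedModule) kappa dkappa s) /\
    filterlim kappa (at_right 0) (locally kappa0) /\
    bounded_at_0 dkappa.
Proof.
move=> Hl.
pose G s := iota (T := R_CompleteNormedModule) (fun y : R => 0 < y < L /\ Phi y = s).
have HG y : 0 < y < L -> G (Phi y) = y.
  move=> Hy; apply: (iota_unique (V := R_CompleteNormedModule)) => // x [Hx E].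
  case: (Rtotal_order x y) => [H | [// | H]].
    have := Phi_incr x y (proj1 Hx) H (proj2 Hy); lra.
  have := Phi_incr y x (proj1 Hy) H (proj2 Hx); lra.
have [kappa [dkappa [kappa0 [Hk [[s1 [Hs1 Hk1]] [Hk2 Hk3]]]]]] := kappa_exists l G Hl HG.
exists Phi, dPhi, G, kappa, dkappa, kappa0, s1; split; last first.
  split; first exact: Phi_incr.
  split; first exact: Phi_lim.
  by split; [move=> s Hs; exact: Phi_surj | ].
move=> y Hy; split => //; split; first exact: chi_pos.
split; first exact: Phi_pos.
split; first exact: Phi_rho.
split; first exact: dchi_Phi.
split; first exact: is_derive_Phi.
split; first exact: dPhi_pos.
split; first exact: HG.
split; first by apply: (is_derive_inverse Phi dPhi G 0 L) => //; [exact: is_derive_Phi | exact: dPhi_pos].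
by rewrite Hk // -weight_eq // !RtoC_mult; ring.
Qed.

End OneSided.

(** * Integration by parts against the half-line integral *)

Lemma within_locally_singleton (D Q : R -> Prop) (x : R) :
  D x -> within D (locally x) Q -> Q x.
Proof. by move=> Dx H; exact: (locally_singleton _ _ H Dx). Qed.

(** [filterdiff] quantifies over all limits of its filter, so for [within D] one must know that x is
    the only one. *)
Lemma is_filter_lim_within (D : R -> Prop) (x y : R) :
  D x -> is_filter_lim (T := R_UniformSpace) (within D (locally x)) y -> x = y.
Proof.
move=> Dx H; apply: (is_filter_lim_locally_unique (V := R_NormedModule)) => Q HQ.
case: (Req_dec x y) => [-> // | Hne].
have Hd : 0 < Rabs (x - y) by apply: Rabs_pos_lt; lra.
have := within_locally_singleton D _ x Dx (H _ (locally_ball y (mkposreal _ Hd))).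
rewrite /ball /= /AbsRing_ball /= /abs /minus /plus /opp /=; rewrite -/(x - y); lra.
Qed.

Lemma is_derive_on_interior (V : NormedModule R_AbsRing) (D : R -> Prop) (f : R -> V) (x : R) (l : V) :
  locally x D -> is_derive_on D f x l -> is_derive f x l.
Proof.
move=> HD [Hl H]; split => // y Hy eps.
have E := is_filter_lim_locally_unique (V := R_NormedModule) _ _ Hy; subst y.
have Hx : is_filter_lim (T := R_UniformSpace) (within D (locally x)) x.
  move=> Q HQ; by apply: filter_imp HQ.
have A : locally x (fun y => D y -> norm (minus (minus (f y) (f x)) (scal (minus y x) l)) <= eps * norm (minus y x)) := H x Hx eps.
by refine (filter_imp (F := locally x) _ _ _ (filter_and (F := locally x) _ _ HD A)) => y [Dy]; apply.
Qed.

(** Transfers an ordinary derivative to a function that agrees with f only on D; this is how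
    [phi_inv], [k] and [phi], which are understood only on an interval, get their derivatives. *)
Lemma is_derive_on_intro (V : NormedModule R_AbsRing) (D : R -> Prop) (f g : R -> V) (x : R) (l : V) :
  D x -> f x = g x -> within D (locally x) (fun y => f y = g y) ->
  is_derive f x l -> is_derive_on D g x l.
Proof.
move=> Dx Ex Hfg [Hl H]; split => // y Hy eps.
have E := is_filter_lim_within D x y Dx Hy; subst y.
have Hx : is_filter_lim (T := R_UniformSpace) (locally x) x by [].
have A : locally x (fun y => D y -> f y = g y) := Hfg.
refine (filter_imp (F := locally x) _ _ _ (filter_and (F := locally x) _ _ A (H x Hx eps))) => y [H1 H2] Dy.
by rewrite -Ex -H1.
Qed.

Lemma is_derive_on_le (V : NormedModule R_AbsRing) (D : R -> Prop) (f : R -> V) (x : R) (l : V) (eps : posreal) :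
  D x -> is_derive_on D f x l ->
  within D (locally x) (fun y => norm (minus (minus (f y) (f x)) (scal (y - x) l)) <= eps * Rabs (y - x)).
Proof.
move=> Dx [_ H].
have Hx : is_filter_lim (T := R_UniformSpace) (within D (locally x)) x.
  move=> Q HQ; by apply: filter_imp HQ.
exact: H.
Qed.

(** At an isolated point of D every l would be a derivative, hence the condition that x is a limit
    point. Uniqueness is what determines the [iota] in [Derive_on]. *)
Lemma is_derive_on_unique (V : NormedModule R_AbsRing) (D : R -> Prop) (f : R -> V) (x : R) (l1 l2 : V) :
  D x -> (forall eps : posreal, exists y, D y /\ y <> x /\ Rabs (y - x) < eps) ->
  is_derive_on D f x l1 -> is_derive_on D f x l2 -> l1 = l2.
Proof.
move=> Dx Hlim H1 H2.
suff Hn : norm (minus l1 l2) <= 0.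
  have E : minus l1 l2 = zero by apply: norm_eq_zero; apply: Rle_antisym Hn (norm_ge_0 _).
  by rewrite -(plus_zero_r l2) -E /minus plus_comm -plus_assoc plus_opp_l plus_zero_r.
apply: le_epsilon => e He; rewrite Rplus_0_l.
have He2 : 0 < e / 2 by lra.
have [d Hd] := filter_and _ _ (is_derive_on_le V D f x l1 (mkposreal _ He2) Dx H1) (is_derive_on_le V D f x l2 (mkposreal _ He2) Dx H2).
have [y [Dy [Hyx Hy]]] := Hlim d.
have [K1 K2] : norm (minus (minus (f y) (f x)) (scal (y - x) l1)) <= e / 2 * Rabs (y - x) /\
   norm (minus (minus (f y) (f x)) (scal (y - x) l2)) <= e / 2 * Rabs (y - x).
  by have [A B] := Hd y Hy Dy; split; [exact: A | exact: B].
have Hp : 0 < Rabs (y - x) by apply: Rabs_pos_lt; lra.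
have -> : minus l1 l2 = scal (/ (y - x)) (scal (y - x) (minus l1 l2)).
  rewrite scal_assoc (_ : mult (/ (y - x)) (y - x) = 1); first by rewrite (scal_one (K := R_AbsRing)).
  by rewrite /mult /=; field; lra.
apply: Rle_trans (norm_scal _ _) _.
change (Rabs (/ (y - x)) * norm (scal (y - x) (minus l1 l2)) <= e).
rewrite Rabs_inv; apply: (Rmult_le_reg_l (Rabs (y - x))) => //.
rewrite -Rmult_assoc Rinv_r ?Rmult_1_l; last lra.
set A := minus (f y) (f x) in K1 K2.
have -> : scal (y - x) (minus l1 l2) = minus (minus A (scal (y - x) l2)) (minus A (scal (y - x) l1)).
  rewrite scal_minus_distr_l /minus opp_plus !opp_opp.
  rewrite (plus_comm (scal _ l1)) (plus_comm A) -plus_assoc (plus_assoc A) plus_opp_r plus_zero_l //.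
apply: Rle_trans (norm_triangle _ _) _; rewrite norm_opp; lra.
Qed.

Lemma Derive_on_eq (V : CompleteNormedModule R_AbsRing) (D : R -> Prop) (f : R -> V) (x : R) (l : V) :
  D x -> (forall eps : posreal, exists y, D y /\ y <> x /\ Rabs (y - x) < eps) ->
  is_derive_on D f x l -> Derive_on D f x = l.
Proof.
move=> Dx Hlim H; apply: iota_unique => // y Hy; exact: is_derive_on_unique Hlim Hy H.
Qed.

Lemma segment_limit_point (a b x : R) (eps : posreal) :
  a < b -> segment a b x -> exists y, segment a b y /\ y <> x /\ Rabs (y - x) < eps.
Proof.
move=> Hab Hx; have He := cond_pos eps.
case: (Rlt_dec x b) => H.
- exists (x + Rmin (eps / 2) (b - x)).
  have K : 0 < Rmin (eps / 2) (b - x) by apply: Rmin_pos; lra.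
  have K1 := Rmin_l (eps / 2) (b - x); have K2 := Rmin_r (eps / 2) (b - x).
  rewrite /segment in Hx *; split; [lra | split; [lra | rewrite Rabs_pos_eq; lra]].
- exists (x - Rmin (eps / 2) (b - a)).
  have K : 0 < Rmin (eps / 2) (b - a) by apply: Rmin_pos; lra.
  have K1 := Rmin_l (eps / 2) (b - a); have K2 := Rmin_r (eps / 2) (b - a).
  rewrite /segment in Hx *; split; [lra | split; [lra | rewrite Rabs_left; lra]].
Qed.

(** * The integral near an end point in the variable s *)

Section Contribution.

Context (rho : index -> R) (j : index) (omega mu : R)
  (hrho : 1 <= rho j) (homega : 0 < omega) (hmu : 0 < mu < 1).

Let H (s : R) : C := ray_int rho j omega (mu - 1) s 0.
Let F (s : R) : C := pow_osc rho j omega (mu - 1) (RtoC s).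

(** Integration by parts against the primitive [- H] of
    [s^(mu - 1) e^(+- i omega s^rho)]. *)
Lemma parts_at_0 (kappa dkappa : R -> C) (kappa0 : C) (S S1 : R) :
  0 < S < S1 ->
  (forall s, 0 < s < S1 -> C1_primitive (V := C_R_NormedModule) kappa dkappa s) ->
  filterlim kappa (at_right 0) (locally kappa0) ->
  bounded_at_0 dkappa ->
  exists (X : C) (Y : R) (N : R -> C),
    is_RInt_gen (V := C_R_NormedModule) (fun s => - H s * dkappa s)%C (at_right 0) (at_left S) X /\
    is_RInt_gen (V := R_NormedModule) (fun s => Rpower s (mu - 1) * Cmod (dkappa s)) (at_right 0) (at_left S) Y /\
    Cmod X <= / rho j * Gamma (/ rho j) * Rpower omega (- / rho j) * Y /\
    (forall s, 0 < s < S1 -> is_derive (V := C_R_NormedModule) N s (F s * kappa s)%C) /\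
    N S = (- H S * kappa S)%C /\
    filterlim N (at_right 0) (locally (X -
      RtoC (/ rho j * Gamma (mu / rho j) * Rpower omega (- (mu / rho j)))
      * Cexp (0%R, mu * (sgn j * (PI / (2 * rho j))))%R * kappa0)%C).
Proof.
move=> HS Hk Hk0 [B HB].
set c := / rho j * Gamma (/ rho j) * Rpower omega (- / rho j).
have Hmu1 : mu - 1 <= 0 by lra.
have HD s : 0 < s -> is_derive (V := C_R_NormedModule) (fun s => - H s)%C s (F s).
  move=> Hs; evar_last.
    apply: (is_derive_opp (V := C_R_NormedModule)); exact: (is_derive_ray_int rho j omega hrho homega (mu - 1) s Hmu1 Hs).
  rewrite -[RHS]opp_opp; reflexivity.
have HC s : 0 < s -> continuous (U := C_UniformSpace) (fun s => - H s)%C s.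
  by move=> Hs; apply: (ex_derive_continuous (V := C_R_NormedModule)); exists (F s); exact: HD.
pose f s := (- H s * dkappa s)%C.
pose g s := Rpower s (mu - 1) * Cmod (dkappa s).
have Cf s : 0 < s < S1 -> continuous (U := C_UniformSpace) f s.
  move=> Hs; have [_ Cd] := Hk s Hs; apply: continuous_Cmult => //; apply: HC; lra.
have Cg s : 0 < s < S1 -> continuous (U := R_UniformSpace) g s.
  move=> Hs; have [_ Cd] := Hk s Hs; apply: (continuous_mult (K := R_AbsRing)).
    apply: continuous_Rpower; lra.
  exact: (continuous_comp dkappa Cmod s Cd (continuous_Cmod _)).
pose P := RInt (V := C_R_CompleteNormedModule) f S.
pose Q := RInt (V := R_CompleteNormedModule) g S.
have HP s : 0 < s < S1 -> C1_primitive (V := C_R_NormedModule) P f s.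
  by move=> Hs; exact: (RInt_C1_primitive C_R_CompleteNormedModule f 0 S1 S s).
have HQ s : 0 < s < S1 -> C1_primitive (V := R_NormedModule) Q g s.
  by move=> Hs; exact: (RInt_C1_primitive R_CompleteNormedModule g 0 S1 S s).
have HPS : P S = zero (G := C_R_NormedModule) by exact: (RInt_point (V := C_R_CompleteNormedModule)).
have HQS : Q S = 0 by exact: (RInt_point (V := R_CompleteNormedModule)).
have Hg0 s : 0 <= g s by apply: Rmult_le_pos; [exact/Rlt_le/Rpower_pos | exact: Cmod_ge_0].
(* Near 0 the integrand of Q is at most B s^(mu - 1), integrable because mu > 0; here only
   boundedness of [dkappa] is called upon. *)
have [lQ HlQ] : exists l, filterlim (U := R_CompleteNormedModule) Q (at_right 0) (locally l).
  have [e [He HBe]] := at_right_0_elim _ HB.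
  apply: (filterlim_dominated _ _ _ _ Q (fun t => B * (/ mu * Rpower t mu)) (fun x => 0 < x < Rmin e S1) (B * (/ mu * 0))).
  - apply: (at_right_0_intro _ (Rmin e S1)) => //; apply: Rmin_pos; lra.
  - apply: (C1_primitive_norm_le_abs R_CompleteNormedModule _ g _ (fun t => B * Rpower t (mu - 1))) => [x y z|x Hx|x Hx|x Hx].
    + lra.
    + apply: HQ; have := Rmin_r e S1; lra.
    + split.
        apply: is_derive_scal; evar_last.
          apply: is_derive_scal; apply: is_derive_Rpower; lra.
        rewrite /scal /= /mult /=; field; lra.
      apply: (continuous_scal_r (V := R_NormedModule)); apply: continuous_Rpower; lra.
    + rewrite /norm /= /abs /= Rabs_pos_eq // /g Rmult_comm.
      apply: Rmult_le_compat_r; first exact/Rlt_le/Rpower_pos.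
      apply: HBe; have := Rmin_l e S1; lra.
  - apply: filterlim_const_mult; apply: filterlim_const_mult; apply: Rpower_at_right_0; lra.
have Hfg s : 0 < s < S1 -> norm (V := C_R_NormedModule) (f s) <= c * g s.
  move=> Hs; rewrite norm_C Cmod_mult Cmod_opp /g -Rmult_assoc (Rmult_comm c).
  apply: Rmult_le_compat_r; first exact: Cmod_ge_0.
  apply: (ray_int_le rho j omega hrho homega (mu - 1) s Hmu1); lra.
have HcQ s : 0 < s < S1 -> C1_primitive (V := R_NormedModule) (fun s => c * Q s) (fun s => c * g s) s.
  move=> Hs; have [D Cn] := HQ s Hs; split; first exact: is_derive_scal.
  exact: (continuous_scal_r (V := R_NormedModule)).
have HlcQ : filterlim (fun s => c * Q s) (at_right 0) (locally (c * lQ)) by exact: filterlim_const_mult.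
have [lP HlP] : exists l, filterlim (U := C_R_CompleteNormedModule) P (at_right 0) (locally l).
  apply: (filterlim_dominated _ _ _ _ P (fun s => c * Q s) (fun x => 0 < x < S1) (c * lQ)) => //.
  - apply: (at_right_0_intro _ S1) => //; lra.
  - by apply: (C1_primitive_norm_le_abs C_R_CompleteNormedModule _ f _ (fun t => c * g t)) => // x y z; lra.
have HS0 : 0 < S by lra.
have left_lim (V : CompleteNormedModule R_AbsRing) (A a : R -> V) : (forall s, 0 < s < S1 -> C1_primitive A a s) ->
    filterlim A (at_left S) (locally (A S)).
  move=> HA; have [D _] := HA S HS.
  have Cn : continuous A S by apply: ex_derive_continuous; exists (a S).
  apply: filterlim_filter_le_1 Cn; exact: filter_le_within.
(* As P' = - H [dkappa] and (- H)' = F, the function - H [kappa] - P has derivative F [kappa]. Since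
   P S = 0, its value at S is the boundary term, and its limit at 0 combines X = - lP with the Gamma
   limit of H. *)
exists (minus (P S) lP), (minus (Q S) lQ), (fun s => - H s * kappa s - P s)%C.
split; [|split; [|split; [|split; [|split]]]].
- refine (is_RInt_gen_interval C_R_CompleteNormedModule P f 0 S lP (P S) HS0 _ HlP (left_lim C_R_CompleteNormedModule P f HP)).
  move=> x Hx; apply: HP; lra.
- refine (is_RInt_gen_interval R_CompleteNormedModule Q g 0 S lQ (Q S) HS0 _ HlQ (left_lim R_CompleteNormedModule Q g HQ)).
  move=> x Hx; apply: HQ; lra.
- rewrite -norm_C (_ : c * minus (Q S) lQ = c * Q S - c * lQ); last by rewrite /minus /plus /opp /=; ring.
  apply: (C1_primitive_norm_le_right C_R_CompleteNormedModule P f (fun s => c * Q s) (fun s => c * g s)) => // x Hx;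
    [apply: HP | apply: HcQ | apply: Hfg]; lra.
- move=> s Hs; have [D1 C1] := Hk s Hs; have [D2 C2] := HP s Hs.
  have Hs0 : 0 < s by lra.
  evar_last.
    apply: (is_derive_minus (V := C_R_NormedModule)); last exact: D2.
    exact: (is_derive_Cmult _ _ _ _ _ (HD s Hs0) D1).
  rewrite /f; change (F s * kappa s + - H s * dkappa s - - H s * dkappa s = F s * kappa s)%C; ring.
- rewrite HPS; change (- H S * kappa S - RtoC 0 = - H S * kappa S)%C; ring.
- rewrite HPS; set L := (RtoC _ * Cexp _)%C.
  have Hmu2 : 0 < mu <= 1 by lra.
  have HL : filterlim H (at_right 0) (locally L) := ray_int_at_0 rho j omega hrho homega mu Hmu2.
  have -> : (minus zero lP - L * kappa0 = - L * kappa0 + - lP)%C.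
    change ((RtoC 0 - lP) - L * kappa0 = - L * kappa0 + - lP)%C; ring.
  have K : filterlim (fun s => - H s * kappa s)%C (at_right 0) (locally (- L * kappa0)%C).
    apply: filterlim_Cmult => //.
    exact: (filterlim_comp _ _ _ H Copp _ _ _ HL (filterlim_opp (V := C_R_NormedModule) L)).
  apply: (filterlim_comp_2 (fun s => - H s * kappa s)%C (fun s => - P s)%C Cplus K _ (filterlim_plus (V := C_R_NormedModule) _ _)).
  refine (filterlim_comp _ _ _ P Copp _ _ _ HlP (filterlim_opp (V := C_R_NormedModule) _)).
Qed.

End Contribution.

(** * The two end points *)

Lemma rpow_pos (x a : R) : 0 < x -> rpow x a = Rpower x a.
Proof. by move=> H; rewrite /rpow; case: Req_EM_T => // E; lra. Qed.

Lemma locally_segment (a b x : R) : a < x < b -> locally x (segment a b).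
Proof.
move=> H; apply: filter_imp (locally_interval a b x H) => t Ht; rewrite /segment; lra.
Qed.

Lemma Rabs_sgn (j : index) (x : R) : Rabs (sgn j * x) = Rabs x.
Proof.
case: j => /=; first by rewrite Rmult_1_l.
by rewrite (_ : -1 * x = - x) ?Rabs_Ropp //; ring.
Qed.

Lemma end_in_segment (p : index -> R) (j : index) :
  p one < p two -> segment (p one) (p two) (p j).
Proof. rewrite /segment; case: j; lra. Qed.

Lemma pair_of_minus (a : index -> R) (j : index) (x : R) :
  pair_of (x - a one) (a two - x) j = sgn j * (x - a j).
Proof. case: j => /=; ring. Qed.

Lemma sgn_mult_sgn (j : index) (x : R) : sgn j * (sgn j * x) = x.
Proof. by rewrite -Rmult_assoc sgn_sqr Rmult_1_l. Qed.

(** The coordinate in which either end point becomes 0 with the interval on its right; the only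
    trace of orientation is [sgn j]. *)
Definition from_end (p : index -> R) (j : index) (y : R) : R := p j + sgn j * y.

Lemma from_end_inside (p : index -> R) (j : index) (y : R) :
  0 < y < p two - p one -> p one < from_end p j y < p two.
Proof. rewrite /from_end; case: j => /=; lra. Qed.

Lemma from_end_dist (p : index -> R) (j : index) (x : R) :
  from_end p j (sgn j * (x - p j)) = x.
Proof. rewrite /from_end sgn_mult_sgn; ring. Qed.

Lemma dist_from_end (p : index -> R) (j : index) (y : R) :
  sgn j * (from_end p j y - p j) = y.
Proof. by rewrite /from_end (_ : p j + sgn j * y - p j = sgn j * y) ?sgn_mult_sgn //; ring. Qed.

Lemma is_derive_from_end (p : index -> R) (j : index) (y : R) :
  is_derive (from_end p j) y (sgn j).
Proof. rewrite /from_end; auto_derive => //; ring. Qed.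

(** Turns C^1 regularity on the closed interval, one-sided at the ends, into two-sided derivatives
    for y > 0 and limits as y -> 0+, the form in which the one-sided model takes its data. *)
Lemma C1_on_from_end (V : NormedModule R_AbsRing) (p : index -> R) (j : index) (f : R -> V) :
  p one < p two -> C1_on (p one) (p two) f ->
  exists df : R -> V,
    (forall y, 0 < y < p two - p one ->
      is_derive (fun y => f (from_end p j y)) y (scal (sgn j) (df (from_end p j y))) /\
      continuous (fun y => df (from_end p j y)) y) /\
    filterlim (fun y => f (from_end p j y)) (at_right 0) (locally (f (p j))) /\
    filterlim (fun y => df (from_end p j y)) (at_right 0) (locally (df (p j))).
Proof.
move=> Hp [df [Hd Hc]]; exists df.
have Hpj : segment (p one) (p two) (p j) := end_in_segment p j Hp.
have Hw : filterlim (from_end p j) (at_right 0) (within (segment (p one) (p two)) (locally (p j))).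
  move=> Q [e He].
  have Hm : 0 < Rmin e (p two - p one) by apply: Rmin_pos; [exact: cond_pos | lra].
  apply: (at_right_0_intro _ (Rmin e (p two - p one))) => // y Hy.
  have H1 := Rmin_l e (p two - p one); have H2 := Rmin_r e (p two - p one).
  have Hs : Rabs (sgn j * y) < e by rewrite Rabs_sgn Rabs_pos_eq; lra.
  apply: He.
    by rewrite /ball /= /AbsRing_ball /= /abs /minus /plus /opp /= /from_end (_ : p j + sgn j * y + - p j = sgn j * y) //; ring.
  have Hy' : 0 < y < p two - p one by lra.
  have := from_end_inside p j y Hy'; rewrite /segment; lra.
split; [|split].
- move=> y Hy; have Hx := from_end_inside p j y Hy.
  have Hloc := locally_segment _ _ _ Hx.
  have Hseg : segment (p one) (p two) (from_end p j y) by rewrite /segment; lra.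
  split.
    apply: is_derive_comp; last exact: is_derive_from_end.
    exact: is_derive_on_interior Hloc (Hd _ Hseg).
  apply: continuous_comp.
    by apply: (ex_derive_continuous (V := R_NormedModule)); exists (sgn j); exact: is_derive_from_end.
  move=> Q HQ; have A : locally (from_end p j y) (fun x => segment (p one) (p two) x -> Q (df x)) := Hc _ Hseg Q HQ.
  refine (filter_imp (F := locally (from_end p j y)) _ _ _ (filter_and (F := locally (from_end p j y)) _ _ Hloc A)) => x [H1 H2]; exact: H2.
- apply: filterlim_comp Hw _.
  apply: (filterdiff_continuous_aux (U := R_NormedModule)).
    by eexists; exact: (Hd _ Hpj).
  move=> Q HQ; by apply: filter_imp HQ.
- exact: filterlim_comp Hw (Hc _ Hpj).
Qed.

(** Near p_j the power that belongs to the other end point is (L - y)^a, which is smooth at y = 0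
    and can be absorbed into the regular factors. *)
Lemma Rpower_far_end (L a y : R) :
  y < L -> C1_primitive (V := R_NormedModule) (fun y => Rpower (L - y) a) (fun y => - (a * Rpower (L - y) (a - 1))) y.
Proof.
move=> Hy; split.
  evar_last.
    apply: (is_derive_comp (fun x => Rpower x a) (fun y => L - y)).
      apply: is_derive_Rpower; lra.
    by auto_derive.
  rewrite /scal /= /mult /=; ring.
apply: (continuous_opp (V := R_NormedModule)); apply: (continuous_scal_r (V := R_NormedModule)).
apply: (continuous_comp (fun y => L - y) (fun x => Rpower x (a - 1))); last by apply: continuous_Rpower; lra.
by apply: (ex_derive_continuous (V := R_NormedModule)); auto_derive.
Qed.

Lemma Rpower_far_end_lim (L a : R) :
  0 < L -> filterlim (fun y => Rpower (L - y) a) (at_right 0) (locally (Rpower L a)).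
Proof.
move=> HL; have [D _] := Rpower_far_end L a 0 HL.
have Cn : continuous (fun y => Rpower (L - y) a) 0.
  by apply: (ex_derive_continuous (V := R_NormedModule)); eexists; exact: D.
by move: Cn; rewrite /continuous Rminus_0_r => Cn; exact: filterlim_comp filterlim_at_right_0_id Cn.
Qed.

Definition other (j : index) : index := pair_of two one j.

Lemma weights_from_end (p : index -> R) (j : index) (a : index -> R) (y : R) :
  0 < y < p two - p one ->
  rpow (from_end p j y - p one) (a one) * rpow (p two - from_end p j y) (a two) =
  Rpower y (a j) * Rpower (p two - p one - y) (a (other j)).
Proof.
move=> Hy; have Hx := from_end_inside p j y Hy.
rewrite !rpow_pos; try lra; rewrite /from_end; case: j {Hx} => /=.
  by congr (Rpower _ _ * Rpower _ _); ring.
by rewrite Rmult_comm; congr (Rpower _ _ * Rpower _ _); ring.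
Qed.

Lemma endpoint_chart (p rho mu : index -> R) (psi : R -> R) (U : R -> C) (j : index) (l : R) :
  p one < p two -> (forall j, 1 <= rho j) ->
  assumption_P (p one) (p two) (rho one) (rho two) psi ->
  assumption_A (p one) (p two) (mu one) (mu two) U ->
  0 < l < p two - p one ->
  exists (Phi dPhi G : R -> R) (kappa dkappa : R -> C) (kappa0 : C) (s1 : R),
    (forall y, 0 < y < p two - p one ->
      phi p psi rho j (from_end p j y) = Phi y /\ 0 < Phi y /\
      psi (from_end p j y) = psi (p j) + sgn j * Rpower (Phi y) (rho j) /\
      is_derive psi (from_end p j y) (rho j * Rpower (Phi y) (rho j - 1) * dPhi y) /\
      is_derive Phi y (dPhi y) /\ 0 < dPhi y /\
      G (Phi y) = y /\ is_derive G (Phi y) (/ dPhi y) /\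
      kappa (Phi y) =
        (U (from_end p j y) * RtoC (Rpower (Phi y) (1 - mu j) * / dPhi y))%C) /\
    (forall x y, 0 < x -> x < y -> y < p two - p one -> Phi x < Phi y) /\
    filterlim Phi (at_right 0) (locally 0) /\
    (forall s, 0 < s <= Phi l -> exists y, 0 < y <= l /\ Phi y = s) /\
    Phi l < s1 /\
    (forall s, 0 < s < s1 -> C1_primitive (V := C_R_NormedModule) kappa dkappa s) /\
    filterlim kappa (at_right 0) (locally kappa0) /\
    bounded_at_0 dkappa.
Proof.
move=> Hp Hrho [Cpsi [psit [Cpsit [Hpos Hdpsi]]]] [ut [Cut [HU _]]] Hl.
set L := p two - p one in Hl *.
have HL : 0 < L by rewrite /L; lra.
have [_ [_ [psi_lim _]]] := C1_on_from_end _ p j psi Hp Cpsi.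
have [dps [Dps [Lps Ldps]]] := C1_on_from_end _ p j psit Hp Cpsit.
have [du [Du [Lu Ldu]]] := C1_on_from_end _ p j ut Hp Cut.
pose b := rho (other j) - 1.
pose c := mu (other j) - 1.
(* The data of the one-sided model. The two signs in the y-derivative of chi cancel, so chi' is psi'
   itself, which is y^(rho_j - 1) h(y); h and v are [psit] and [ut] times the powers of the far
   end. *)
pose chi y := sgn j * (psi (from_end p j y) - psi (p j)).
pose h y := Rpower (L - y) b * psit (from_end p j y).
pose dh y := - (b * Rpower (L - y) (b - 1)) * psit (from_end p j y)
  + Rpower (L - y) b * (sgn j * dps (from_end p j y)).
pose v y := (RtoC (Rpower (L - y) c) * ut (from_end p j y))%C.
pose dv y := (RtoC (- (c * Rpower (L - y) (c - 1))) * ut (from_end p j y)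
  + RtoC (Rpower (L - y) c) * (RtoC (sgn j) * du (from_end p j y)))%C.
have Hin y : 0 < y < L -> p one <= from_end p j y <= p two.
  by move=> Hy; have := from_end_inside p j y Hy; lra.
have Dpsi y : 0 < y < L -> is_derive psi (from_end p j y) (Rpower y (rho j - 1) * h y).
  move=> Hy; have := Hdpsi _ (Hin y Hy).
  move=> /(is_derive_on_interior _ _ _ _ _ (locally_segment _ _ _ (from_end_inside p j y Hy))).
  by rewrite (weights_from_end p j (fun i => rho i - 1) y Hy) Rmult_assoc.
have hchi y : 0 < y < L -> is_derive chi y (Rpower y (rho j - 1) * h y).
  move=> Hy; evar_last.
    apply: is_derive_scal; apply: (is_derive_minus (V := R_NormedModule)); last exact: is_derive_const.
    exact: (is_derive_comp psi (from_end p j) y _ _ (Dpsi y Hy) (is_derive_from_end p j y)).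
  rewrite /scal /= /mult /= /minus /plus /opp /zero /= Ropp_0 Rplus_0_r; exact: sgn_mult_sgn.
have hchi0 : filterlim chi (at_right 0) (locally 0).
  rewrite [X in locally X](_ : 0 = sgn j * (psi (p j) - psi (p j))); last ring.
  apply: filterlim_const_mult; exact: filterlim_minus_const.
have hpos y : 0 < y < L -> 0 < h y.
  move=> Hy; apply: Rmult_lt_0_compat; [exact: Rpower_pos | exact: Hpos (Hin y Hy)].
have hder y : 0 < y < L -> C1_primitive (V := R_NormedModule) h dh y.
  move=> Hy; have [D1 C1] := Dps y Hy; have [|D2 C2] := Rpower_far_end L b y; first lra.
  have C0 : continuous (fun y => psit (from_end p j y)) y.
    by apply: (ex_derive_continuous (V := R_NormedModule)); eexists; exact: D1.
  have C3 : continuous (fun y => Rpower (L - y) b) y.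
    by apply: (ex_derive_continuous (V := R_NormedModule)); eexists; exact: D2.
  split; first by exact: (is_derive_mult _ _ _ _ _ D2 D1 Rmult_comm).
  apply: (continuous_plus (V := R_NormedModule)); apply: (continuous_mult (K := R_AbsRing)) => //.
  exact: (continuous_scal_r (V := R_NormedModule)).
have h0pos : 0 < Rpower L b * psit (p j).
  apply: Rmult_lt_0_compat; first exact: Rpower_pos.
  exact: Hpos (end_in_segment p j Hp).
have hlim : filterlim h (at_right 0) (locally (Rpower L b * psit (p j))).
  apply: filterlim_Rmult => //; exact: Rpower_far_end_lim.
have [M hdh] : exists M, at_right 0 (fun y => Rabs (dh y) <= M).
  have K : filterlim dh (at_right 0) (locally (- (b * Rpower L (b - 1)) * psit (p j) + Rpower L b * (sgn j * dps (p j)))).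
    apply: filterlim_Rplus; apply: filterlim_Rmult => //; try exact: Rpower_far_end_lim.
      apply: (filterlim_comp _ _ _ _ Ropp _ _ _ _ (filterlim_opp (V := R_NormedModule) _)).
      apply: filterlim_const_mult; exact: Rpower_far_end_lim.
    exact: filterlim_const_mult.
  have [B HB] := bounded_at_0_RtoC_lim _ _ K; exists B.
  by apply: filter_imp HB => y; rewrite Cmod_R.
have vder y : 0 < y < L -> C1_primitive (V := C_R_NormedModule) v dv y.
  move=> Hy; have [D1 C1] := Du y Hy; have [|D2 C2] := Rpower_far_end L c y; first lra.
  have C0 : continuous (U := C_UniformSpace) (fun y => ut (from_end p j y)) y.
    by apply: (ex_derive_continuous (V := C_R_NormedModule)); eexists; exact: D1.
  have C3 : continuous (fun y => Rpower (L - y) c) y.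
    by apply: (ex_derive_continuous (V := R_NormedModule)); eexists; exact: D2.
  split.
    evar_last; first exact: (is_derive_Cmult _ _ _ _ _ (is_derive_RtoC _ _ _ D2) D1).
    by rewrite /dv scal_R_Cmult.
  apply: continuous_Cplus; apply: continuous_Cmult => //; try exact: continuous_RtoC.
  by apply: continuous_Cmult => //; exact: continuous_const.
have hv0 : filterlim v (at_right 0) (locally (RtoC (Rpower L c) * ut (p j))%C).
  apply: filterlim_Cmult => //; apply: filterlim_RtoC; exact: Rpower_far_end_lim.
have hdv : bounded_at_0 dv.
  apply: bounded_at_0_plus; apply: bounded_at_0_mult; try exact: bounded_at_0_lim Lu.
  - apply: bounded_at_0_RtoC_lim.
    apply: (filterlim_comp _ _ _ _ Ropp _ _ _ _ (filterlim_opp (V := R_NormedModule) _)).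
    apply: filterlim_const_mult; exact: Rpower_far_end_lim.
  - apply: bounded_at_0_RtoC_lim; exact: Rpower_far_end_lim.
  - apply: bounded_at_0_mult; last exact: bounded_at_0_lim Ldu.
    apply: (bounded_at_0_lim _ (RtoC (sgn j))); exact: filterlim_const.
have [Phi [dPhi [G [kappa [dkappa [kappa0 [s1 [H1 H2]]]]]]]] :=
  chart_exists (rho j) (mu j) L chi h dh v dv _ M _ (Hrho j) HL hchi hchi0 hpos hder h0pos hlim hdh vder hv0 hdv l Hl.
exists Phi, dPhi, G, kappa, dkappa, kappa0, s1; split => // y Hy.
have [E1 [P1 [P2 [E2 [E3 [D1 [P3 [E4 [D2 E5]]]]]]]]] := H1 y Hy.
have Echi := pair_of_minus (fun i => psi (p i)) j (psi (from_end p j y)).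
rewrite -/(chi y) in Echi.
split; first by rewrite /phi Echi rpow_pos.
split => //; split; first by rewrite E2 /chi sgn_mult_sgn; ring.
split; first by rewrite -E3; exact: Dpsi.
do 4 (split => //).
rewrite E5; congr (_ * _)%C; rewrite HU; last by have := from_end_inside p j y Hy.
rewrite (weights_from_end p j (fun i => mu i - 1) y Hy) /v !RtoC_mult -/L -/c; ring.
Qed.

(** Equations arising from module operations may be typed in a structure over [C]; [ring] is run
    after restating them at [C]. *)
Ltac ring_C := lazymatch goal with |- @eq _ ?a ?b => change (@eq C a b); ring end.

Lemma on_I_dist (p : index -> R) (q : R) (j : index) (x : R) :
  on_I p q j x <-> 0 <= sgn j * (x - p j) <= sgn j * (q - p j).
Proof. rewrite /on_I; case: j; rewrite /segment /=; split; lra. Qed.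

Lemma between_from_end (p : index -> R) (j : index) (x y l : R) :
  y <= l ->
  Rmin (from_end p j l) (from_end p j y) <= x <= Rmax (from_end p j l) (from_end p j y) ->
  y <= sgn j * (x - p j) <= l.
Proof.
rewrite /from_end => Hy; case: j => /=; rewrite /Rmin /Rmax; case: Rle_dec; lra.
Qed.

(** * The functions k_j and the terms A, R_1, R_2 in terms of the chart *)

Section Endpoint.

Context (p rho mu : index -> R) (psi : R -> R) (U : R -> C) (q omega : R) (j : index)
  (hrho : 1 <= rho j) (hmu : 0 < mu j < 1) (hq : p one < q < p two) (homega : 0 < omega)
  (hg : forall x, p one < x < p two ->
    continuous (U := C_UniformSpace) (fun x => U x * e_psi psi omega x)%C x)
  (Phi dPhi G : R -> R) (kappa dkappa : R -> C) (kappa0 : C) (s1 : R).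

Let L := p two - p one.
Let l := sgn j * (q - p j).
Let S := Phi l.

Context
  (chart : forall y, 0 < y < L ->
      phi p psi rho j (from_end p j y) = Phi y /\ 0 < Phi y /\
      psi (from_end p j y) = psi (p j) + sgn j * Rpower (Phi y) (rho j) /\
      is_derive psi (from_end p j y) (rho j * Rpower (Phi y) (rho j - 1) * dPhi y) /\
      is_derive Phi y (dPhi y) /\ 0 < dPhi y /\
      G (Phi y) = y /\ is_derive G (Phi y) (/ dPhi y) /\
      kappa (Phi y) =
        (U (from_end p j y) * RtoC (Rpower (Phi y) (1 - mu j) * / dPhi y))%C)
  (incr : forall x y, 0 < x -> x < y -> y < L -> Phi x < Phi y)
  (Phi0 : filterlim Phi (at_right 0) (locally 0))
  (surj : forall s, 0 < s <= S -> exists y, 0 < y <= l /\ Phi y = s)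
  (hs1 : S < s1)
  (hk : forall s, 0 < s < s1 -> C1_primitive (V := C_R_NormedModule) kappa dkappa s)
  (hk0 : filterlim kappa (at_right 0) (locally kappa0))
  (hbd : bounded_at_0 dkappa).

Lemma dist_q : 0 < l < L.
Proof. rewrite /l /L; case: (j) => /=; lra. Qed.

Lemma from_end_q : from_end p j l = q.
Proof. exact: from_end_dist. Qed.

Lemma s_end_Phi : s_end p psi rho q j = S.
Proof. by rewrite /s_end -from_end_q; have [-> _] := chart l dist_q. Qed.

Lemma S_pos : 0 < S.
Proof. by have [_ [H _]] := chart l dist_q. Qed.

Lemma Phi_le (x y : R) : 0 < x <= y -> y < L -> Phi x <= Phi y.
Proof.
move=> [Hx [Hxy | ->]] Hy; last by right.
apply: Rlt_le; exact: incr.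
Qed.

(** The convention 0^a = 0 of [rpow] matters here: [Rpower] would give 1. The value 0 is what
    excludes p_j in the uniqueness part of [phi_inv_Phi]. *)
Lemma phi_end : phi p psi rho j (p j) = 0.
Proof.
rewrite /phi (pair_of_minus (fun i => psi (p i)) j (psi (p j))) Rminus_diag Rmult_0_r /rpow.
case: Req_EM_T => // _; case: Req_EM_T => // E.
have H : 0 < / rho j by apply: Rinv_0_lt_compat; lra.
lra.
Qed.

Lemma phi_inv_Phi (y : R) : 0 < y <= l -> phi_inv p psi rho q j (Phi y) = from_end p j y.
Proof.
move=> Hy; have Hl := dist_q; have Hy' : 0 < y < L by lra.
have [E [P _]] := chart y Hy'.
apply: (iota_unique (V := R_CompleteNormedModule)) => [x [Hx Ex] |].
- have {}Hx := proj1 (on_I_dist _ _ _ _) Hx; rewrite -/l in Hx.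
  rewrite -(from_end_dist p j x) in Ex *.
  move: (sgn j * (x - p j)) Hx Ex => z Hz Ez.
  case: (Req_dec z 0) => [Hz0 | Hz0].
    move: Ez; rewrite Hz0 /from_end Rmult_0_r Rplus_0_r phi_end; lra.
  have Hz' : 0 < z < L by lra.
  have [Ezz _] := chart z Hz'; rewrite Ezz in Ez.
  case: (Rtotal_order z y) => [H | [-> // | H]].
    have := incr z y (proj1 Hz') H (proj2 Hy'); lra.
  have := incr y z (proj1 Hy') H (proj2 Hz'); lra.
- split => //; apply/on_I_dist; rewrite dist_from_end -/l; lra.
Qed.

Lemma locally_pos (s : R) : 0 < s -> locally s (fun t => 0 < t).
Proof. exact: open_gt. Qed.

(** On [0, S] the inverse agrees with [from_end p j] after G. The latter is differentiable on both
    sides even at S, and [from_end] supplies the factor [sgn j] that passes into k_j. *)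
Lemma Derive_phi_inv (y : R) :
  0 < y <= l ->
  Derive_on (V := R_CompleteNormedModule) (segment 0 S) (phi_inv p psi rho q j) (Phi y)
  = sgn j * / dPhi y.
Proof.
move=> Hy; have Hl := dist_q; have Hy' : 0 < y < L by lra.
have [_ [P [_ [_ [_ [_ [EG [DG _]]]]]]]] := chart y Hy'.
have Hseg : segment 0 S (Phi y) by have := Phi_le y l Hy (proj2 Hl); rewrite /segment -/S; lra.
apply: Derive_on_eq => //.
  move=> eps; apply: segment_limit_point => //; exact: S_pos.
apply: (is_derive_on_intro R_NormedModule _ (fun s => from_end p j (G s))) => //.
- by rewrite EG phi_inv_Phi.
- refine (filter_imp (F := locally (Phi y)) _ _ _ (locally_pos _ P)) => s Hs [_ HsS].
  have [z [Hz <-]] := surj s (conj Hs HsS).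
  have Hz' : 0 < z < L by lra.
  have [_ [_ [_ [_ [_ [_ [-> _]]]]]]] := chart z Hz'.
  by rewrite phi_inv_Phi.
- evar_last.
    apply: (is_derive_comp (from_end p j) G); [exact: is_derive_from_end | exact: DG].
  by rewrite /scal /= /mult /= Rmult_comm.
Qed.

Lemma k_pos_kappa (s : R) :
  0 < s <= S -> k_pos p psi U rho mu q j s = (RtoC (sgn j) * kappa s)%C.
Proof.
move=> Hs; have [y [Hy <-]] := surj s Hs; have Hl := dist_q; have Hy' : 0 < y < L by lra.
have [_ [P [_ [_ [_ [_ [_ [_ ->]]]]]]]] := chart y Hy'.
rewrite /k_pos s_end_Phi Derive_phi_inv // phi_inv_Phi // rpow_pos // !RtoC_mult; ring.
Qed.

Lemma k_kappa (s : R) : 0 < s <= S -> k p psi U rho mu q j s = (RtoC (sgn j) * kappa s)%C.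
Proof.
move=> Hs; rewrite /k; case: Req_EM_T => [E | _]; [lra | exact: k_pos_kappa].
Qed.

Lemma k_0 : k p psi U rho mu q j 0 = (RtoC (sgn j) * kappa0)%C.
Proof.
rewrite /k; case: Req_EM_T => // _.
refine (iota_filterlim_locally (V := C_R_CompleteNormedModule) (F := at_right 0) (k_pos p psi U rho mu q j) _ _).
apply: (filterlim_ext_loc (fun s => RtoC (sgn j) * kappa s)%C).
  apply: (at_right_0_intro _ S); first exact: S_pos.
  by move=> s Hs; rewrite k_pos_kappa //; lra.
apply: filterlim_Cmult => //; exact: filterlim_const.
Qed.

Lemma k'_dkappa (s : R) :
  0 < s < S -> k' p psi U rho mu q j s = (RtoC (sgn j) * dkappa s)%C.
Proof.
move=> Hs; rewrite /k' s_end_Phi.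
have Hseg : segment 0 S s by rewrite /segment; lra.
refine (Derive_on_eq C_R_CompleteNormedModule (segment 0 S) (k p psi U rho mu q j) s (RtoC (sgn j) * dkappa s)%C Hseg _ _).
  move=> eps; apply: segment_limit_point => //; exact: S_pos.
apply: (is_derive_on_intro C_R_NormedModule _ (fun s => RtoC (sgn j) * kappa s)%C) => //.
- by rewrite k_kappa //; lra.
- refine (filter_imp (F := locally s) _ _ _ (locally_pos _ (proj1 Hs))) => t Ht [_ HtS].
  by rewrite k_kappa.
- apply: is_derive_Cmult_l; have Hs' : 0 < s < s1 by lra.
  by have [] := hk s Hs'.
Qed.

Lemma Derive_phi_q :
  Derive_on (V := R_CompleteNormedModule) (on_I p q j) (phi p psi rho j) q = sgn j * dPhi l.
Proof.
have Hl := dist_q; have [E [_ [_ [_ [D _]]]]] := chart l Hl; rewrite from_end_q in E.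
have Hq : on_I p q j q by apply/on_I_dist; rewrite -/l; lra.
apply: Derive_on_eq => //.
  move=> eps; move: Hq; rewrite /on_I; case: (j) => /= Hq; apply: segment_limit_point => //; lra.
apply: (is_derive_on_intro R_NormedModule _ (fun x => Phi (sgn j * (x - p j)))) => //.
- exists (mkposreal l (proj1 Hl)) => x.
  rewrite /ball /= /AbsRing_ball /= /abs /minus /plus /opp /= => Hx.
  move=> /on_I_dist; rewrite -/l => Hd.
  have Hpos : 0 < sgn j * (x - p j).
    have : Rabs (sgn j * (x - q)) < l by rewrite Rabs_sgn; exact: Hx.
    move=> /Rabs_def2; rewrite (_ : sgn j * (x - q) = sgn j * (x - p j) - l); [lra | rewrite /l; ring].
  have Hx' : 0 < sgn j * (x - p j) < L by lra.
  by have [<- _] := chart _ Hx'; rewrite from_end_dist.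
- evar_last.
    apply: (is_derive_comp Phi (fun x => sgn j * (x - p j))); first exact: D.
    by auto_derive.
  by rewrite /scal /= /mult /=; ring.
Qed.

Lemma e_psi_Phi (y : R) :
  0 < y < L ->
  e_psi psi omega (from_end p j y) =
  (e_psi psi omega (p j) * osc rho j omega (RtoC (Phi y)))%C.
Proof.
move=> Hy; have [_ [P [E _]]] := chart y Hy.
rewrite /e_psi /osc E Cpower_RtoC // -Cexp_plus; congr Cexp.
rewrite RtoC_plus !RtoC_mult; ring.
Qed.

Lemma Cmod_e_psi (x : R) : Cmod (e_psi psi omega x) = 1.
Proof.
rewrite /e_psi Cmod_Cexp (_ : Re _ = 0) ?exp_0 //.
rewrite /Cmult /=; ring.
Qed.

Lemma Cmod_sgn : Cmod (RtoC (sgn j)) = 1.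
Proof. by rewrite Cmod_R -(Rmult_1_r (sgn j)) Rabs_sgn Rabs_R1. Qed.

(** The factor [sgn j] carried by k_j' meets the factor [- sgn j] in front of the integral, so the
    sign is - for both j. *)
Lemma R1_term_eq (X : C) :
  is_RInt_gen (V := C_R_NormedModule)
    (fun s => - ray_int rho j omega (mu j - 1) s 0 * dkappa s)%C (at_right 0) (at_left S) X ->
  R1_term p psi U rho mu q j omega = (- e_psi psi omega (p j) * X)%C.
Proof.
move=> HX; rewrite /R1_term s_end_Phi.
suff -> : int_oo (V := C_R_CompleteNormedModule)
       (fun s => phi_osc rho mu j s omega * k' p psi U rho mu q j s)%C 0 S = (RtoC (sgn j) * X)%C.
  rewrite RtoC_opp; transitivity (- (RtoC (sgn j) * RtoC (sgn j)) * e_psi psi omega (p j) * X)%C; first ring.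
  rewrite -RtoC_mult sgn_sqr; ring.
refine (is_RInt_gen_unique (V := C_R_CompleteNormedModule) _ _ _).
have K : is_RInt_gen (V := C_R_NormedModule) (fun s => scal (sgn j) (- ray_int rho j omega (mu j - 1) s 0 * dkappa s)%C)
    (at_right 0) (at_left S) (scal (sgn j) X) by refine (is_RInt_gen_scal _ _ _ HX).
rewrite scal_R_Cmult in K.
refine (is_RInt_gen_ext (V := C_R_NormedModule) (Fa := at_right 0) (Fb := at_left S) _ _ _ _ K).
apply: filter_imp (filter_prod_interval 0 S (fun s => 0 < s < S) S_pos (fun s Hs => Hs)) => ab Hab x Hx.
have Hx' : 0 < x < S by apply: Hab; lra.
rewrite scal_R_Cmult k'_dkappa // /phi_osc.
change (int_Lambda rho j x (fun z => Cpower z (mu j - 1) * osc rho j omega z)%C) with (ray_int rho j omega (mu j - 1) x 0).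
ring_C.
Qed.

Lemma R1_integral_eq (Y : R) :
  is_RInt_gen (V := R_NormedModule)
    (fun s => Rpower s (mu j - 1) * Cmod (dkappa s)) (at_right 0) (at_left S) Y ->
  int_oo (V := R_CompleteNormedModule)
    (fun s : R => rpow s (mu j - 1) * Cmod (k' p psi U rho mu q j s)) 0 (s_end p psi rho q j) = Y.
Proof.
move=> HY; rewrite s_end_Phi.
refine (is_RInt_gen_unique (V := R_CompleteNormedModule) _ _ _).
refine (is_RInt_gen_ext (V := R_NormedModule) (Fa := at_right 0) (Fb := at_left S) _ _ _ _ HY).
apply: filter_imp (filter_prod_interval 0 S (fun s => 0 < s < S) S_pos (fun s Hs => Hs)) => ab Hab x Hx.
have Hx' : 0 < x < S by apply: Hab; lra.
by rewrite k'_dkappa // Cmod_mult Cmod_sgn Rmult_1_l rpow_pos //; lra.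
Qed.

Lemma R2_term_le :
  Cmod (R2_term p psi U rho mu q j omega)
    <= (rho j - mu j) / rho j * Gamma (/ rho j)
       * Cmod (U q * RtoC (/ Derive_on (V := R_CompleteNormedModule)
                               (on_I p q j) (phi p psi rho j) q))%C
       * rpow (phi p psi rho j q) (- rho j)
       * Rpower omega (- (1 + / rho j)).
Proof.
have Hl := dist_q; have HS := S_pos.
have [E [P [_ [_ [_ [PD [_ [_ Ek]]]]]]]] := chart l Hl; rewrite from_end_q in E Ek.
rewrite /R2_term s_end_Phi Derive_phi_q E -/S rpow_pos //.
change (int_Lambda rho j S (fun z => Cpower z (mu j - rho j - 1) * osc rho j omega z)%C) with (ray_int rho j omega (mu j - rho j - 1) S 0).
rewrite k_kappa; last lra.
rewrite !Cmod_mult Cmod_opp Cmod_Ci Cmod_e_psi Cmod_sgn /S Ek Cmod_mult !Cmod_R -/S.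
have Ha : mu j - rho j - 1 <= 0 by lra.
have K := ray_int_le rho j omega hrho homega (mu j - rho j - 1) S Ha HS.
have Hw := Rinv_0_lt_compat _ homega.
have Hr : 0 < / rho j by apply: Rinv_0_lt_compat; lra.
have HA : 0 < Rpower S (1 - mu j) * / dPhi l.
  apply: Rmult_lt_0_compat; [exact: Rpower_pos | exact: Rinv_0_lt_compat].
rewrite (Rabs_pos_eq (/ omega)); last lra.
rewrite (Rabs_pos_eq (Rpower S _ * _)); last lra.
have -> : Rabs ((mu j - rho j) / rho j) = (rho j - mu j) / rho j.
  rewrite (_ : (mu j - rho j) / rho j = - ((rho j - mu j) / rho j)); last by field; lra.
  rewrite Rabs_Ropp Rabs_pos_eq //; apply: Rmult_le_pos; lra.
have -> : Rabs (/ (sgn j * dPhi l)) = / dPhi l.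
  rewrite Rabs_inv Rabs_sgn Rabs_pos_eq //; lra.
set u := Cmod (U q); have Hu : 0 <= u by exact: Cmod_ge_0.
set g := Gamma (/ rho j) in K *.
set c := (rho j - mu j) / rho j.
have Hc : 0 <= c by apply: Rmult_le_pos; lra.
have Hs (a : R) := Rpower_pos S a.
have Ew : Rpower omega (- (1 + / rho j)) = / omega * Rpower omega (- / rho j).
  by rewrite Ropp_plus_distr Rpower_plus Rpower_Ropp Rpower_1.
have Es : Rpower S (mu j - rho j - 1) = / Rpower S (1 - mu j) * Rpower S (- rho j).
  by rewrite -Rpower_Ropp -Rpower_plus; congr Rpower; ring.
(* Nonnegativity of the Gamma factor is read off from [K], whose left side is a modulus. *)
have Hg : 0 <= g * Rpower omega (- / rho j).
  have := Rle_trans _ _ _ (Cmod_ge_0 _) K => K0.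
  have K1 : 0 < Rpower S (mu j - rho j - 1) * / rho j by apply: Rmult_lt_0_compat => //; exact: Hs.
  apply: (Rmult_le_reg_l _ _ _ K1); rewrite Rmult_0_r; lra.
(* [ray_int_le] brings a factor 1 / rho_j that the stated bound does not have; it is at most 1. *)
have Hr1 : / rho j <= 1 by rewrite -Rinv_1; apply: Rinv_le_contravar; lra.
set H2 := Cmod (ray_int _ _ _ _ _ _) in K *.
have K2 : H2 <= Rpower S (mu j - rho j - 1) * (g * Rpower omega (- / rho j)).
  apply: Rle_trans K _; apply: Rmult_le_compat_l; first exact/Rlt_le/Hs.
  rewrite -[X in _ <= X]Rmult_1_l !Rmult_assoc; apply: Rmult_le_compat_r => //.
apply: Rle_trans (_ : c * u * (Rpower S (1 - mu j) * / dPhi l) * / omega * (Rpower S (mu j - rho j - 1) * (g * Rpower omega (- / rho j))) <= _).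
  apply: Rle_trans (_ : c * u * (Rpower S (1 - mu j) * / dPhi l) * / omega * H2 <= _); first by right; ring.
  apply: Rmult_le_compat_l => //.
  apply: Rmult_le_pos; last lra.
  apply: Rmult_le_pos; last lra.
  exact: Rmult_le_pos.
rewrite Ew Es; right; have := Hs (1 - mu j) => H; field; repeat split; lra.
Qed.

(** Multiplying H by [sgn j] before integrating by parts leaves the same factor i / (omega rho_j)
    for both j. In the term without integral, S^(mu_j - rho_j) S^(1 - mu_j) = S^(1 - rho_j) combines
    with psi'(q) = rho_j S^(rho_j - 1) Phi'(l) to an expression that does not depend on j. *)
Lemma boundary_term (d : R) :
  is_derive psi q d ->
  (RtoC (sgn j) * e_psi psi omega (p j) * ray_int rho j omega (mu j - 1) S 0 * kappa S
   = - RtoC (sgn j) * R2_term p psi U rho mu q j omega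
     + Ci * U q * e_psi psi omega q * RtoC (/ (omega * d)))%C.
Proof.
move=> Hd; have Hl := dist_q; have HS := S_pos.
have [E [P [_ [D [_ [PD [_ [_ Ek]]]]]]]] := chart l Hl; rewrite from_end_q in E D Ek.
have Ed : d = rho j * Rpower S (rho j - 1) * dPhi l.
  by rewrite -(is_derive_unique _ _ _ Hd); exact: is_derive_unique D.
have BP := ray_int_by_parts rho j omega hrho homega (mu j) S hmu HS.
rewrite /R2_term s_end_Phi k_kappa; last lra.
change (int_Lambda rho j S (fun z => Cpower z (mu j - rho j - 1) * osc rho j omega z)%C) with (ray_int rho j omega (mu j - rho j - 1) S 0).
set H := ray_int _ _ _ (mu j - 1) _ _ in BP *; set H2 := ray_int _ _ _ (mu j - rho j - 1) _ _ in BP *.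
have EH : (RtoC (sgn j) * H = Ci * RtoC (/ (omega * rho j)) * (pow_osc rho j omega (mu j - rho j) (RtoC S) + RtoC (mu j - rho j) * H2))%C.
  transitivity (- (Ci * Ci) * (RtoC (/ (omega * rho j)) * (RtoC omega * RtoC (rho j))) * (RtoC (sgn j) * H))%C.
    rewrite -!RtoC_mult Rinv_l; last by apply: Rgt_not_eq; apply: Rmult_lt_0_compat; lra.
    rewrite (_ : Ci * Ci = RtoC (-1))%C; last by rewrite /Ci /Cmult /RtoC /=; congr (_, _); ring.
    rewrite -RtoC_opp (_ : - -1 = 1); last ring; ring.
  transitivity (- (Ci * RtoC (/ (omega * rho j))) * (RtoC (sgn j) * Ci * RtoC omega * RtoC (rho j) * H))%C; first ring.
  rewrite BP; ring.
transitivity (e_psi psi omega (p j) * (RtoC (sgn j) * H) * kappa S)%C; first ring.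
rewrite EH.
have EF : (e_psi psi omega (p j) * pow_osc rho j omega (mu j - rho j) (RtoC S) = RtoC (Rpower S (mu j - rho j)) * e_psi psi omega q)%C.
  rewrite -from_end_q e_psi_Phi // -/S /pow_osc Cpower_RtoC //; ring.
have EW : (RtoC (Rpower S (mu j - rho j)) * kappa S * RtoC (/ (omega * rho j)) = U q * RtoC (/ (omega * d)))%C.
  rewrite /S Ek -/S.
  transitivity (U q * RtoC (Rpower S (mu j - rho j) * (Rpower S (1 - mu j) * / dPhi l) * / (omega * rho j)))%C.
    rewrite !RtoC_mult; ring.
  congr (_ * RtoC _)%C.
  have K : Rpower S (mu j - rho j) * Rpower S (1 - mu j) = / Rpower S (rho j - 1).
    by rewrite -Rpower_Ropp -Rpower_plus; congr Rpower; ring.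
  transitivity (Rpower S (mu j - rho j) * Rpower S (1 - mu j) * (/ dPhi l * / (omega * rho j))); first ring.
  rewrite K Ed; have := Rpower_pos S (rho j - 1) => HR; field; repeat split; lra.
have Ss : (RtoC (sgn j) * RtoC (sgn j) = 1)%C by rewrite -RtoC_mult sgn_sqr.
have Er : RtoC ((mu j - rho j) / rho j) = (RtoC (mu j - rho j) * RtoC (/ (omega * rho j)) * RtoC omega)%C.
  rewrite -!RtoC_mult; congr RtoC; field; lra.
have Eo : (RtoC omega * RtoC (/ omega) = 1)%C by rewrite -RtoC_mult Rinv_r //; lra.
transitivity (Ci * (RtoC (Rpower S (mu j - rho j)) * kappa S * RtoC (/ (omega * rho j))) * e_psi psi omega q
  + Ci * RtoC (/ (omega * rho j)) * RtoC (mu j - rho j) * H2 * e_psi psi omega (p j) * kappa S)%C.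
  transitivity (Ci * RtoC (/ (omega * rho j)) * kappa S * (e_psi psi omega (p j) * pow_osc rho j omega (mu j - rho j) (RtoC S))
    + Ci * RtoC (/ (omega * rho j)) * RtoC (mu j - rho j) * H2 * e_psi psi omega (p j) * kappa S)%C; first ring.
  rewrite EF; ring.
rewrite EW Er.
transitivity (Ci * (U q * RtoC (/ (omega * d))) * e_psi psi omega q
  + (RtoC (sgn j) * RtoC (sgn j)) * (RtoC omega * RtoC (/ omega)) * (Ci * RtoC (/ (omega * rho j)) * RtoC (mu j - rho j) * H2 * e_psi psi omega (p j) * kappa S))%C.
  rewrite Ss Eo; ring.
ring.
Qed.

Lemma endpoint_contribution (d : R) :
  is_derive psi q d ->
  filterlim (fun y => RInt (V := C_R_CompleteNormedModule) (fun x => U x * e_psi psi omega x)%C q (from_end p j y))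
    (at_right 0)
    (locally (- RtoC (sgn j) * (A_term p psi U rho mu q j omega + R1_term p psi U rho mu q j omega
               + R2_term p psi U rho mu q j omega)
             + Ci * U q * e_psi psi omega q * RtoC (/ (omega * d)))%C) /\
  Cmod (R1_term p psi U rho mu q j omega)
    <= / rho j * Gamma (/ rho j)
       * int_oo (V := R_CompleteNormedModule)
           (fun s : R => rpow s (mu j - 1) * Cmod (k' p psi U rho mu q j s))
           0 (s_end p psi rho q j)
       * Rpower omega (- / rho j).
Proof.
move=> Hd; have Hl := dist_q; have HS := S_pos.
have HSs : 0 < S < s1 by lra.
have [X [Y [N [HX [HY [HXY [DN [NS N0]]]]]]]] :=
  parts_at_0 rho j omega (mu j) hrho homega hmu kappa dkappa kappa0 S s1 HSs hk hk0 hbd.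
have ER1 := R1_term_eq X HX.
split; last first.
  rewrite ER1 Cmod_mult Cmod_opp Cmod_e_psi Rmult_1_l (R1_integral_eq Y HY).
  apply: Rle_trans HXY _; right; ring.
(* A primitive of the original integrand on the side of p_j: its factor [sgn j] compensates the
   derivative of the distance to p_j. *)
pose Q x := (RtoC (sgn j) * e_psi psi omega (p j) * N (Phi (sgn j * (x - p j))))%C.
have HQ t : 0 < t <= l -> is_derive (V := C_R_NormedModule) Q (from_end p j t)
    (U (from_end p j t) * e_psi psi omega (from_end p j t))%C.
  move=> Ht; have Ht' : 0 < t < L by lra.
  have [_ [P [_ [_ [DP [PD [_ [_ Ek]]]]]]]] := chart t Ht'.
  have Hs : 0 < Phi t < s1 by have := Phi_le t l Ht (proj2 Hl); rewrite -/S; lra.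
  evar_last.
    apply: is_derive_Cmult_l.
    apply: (is_derive_comp (V := C_R_NormedModule) N (fun x => Phi (sgn j * (x - p j)))).
      by rewrite dist_from_end; exact: DN.
    apply: (is_derive_comp Phi (fun x => sgn j * (x - p j))).
      by rewrite dist_from_end; exact: DP.
    by auto_derive.
  rewrite e_psi_Phi // Ek scal_R_Cmult /pow_osc Cpower_RtoC //.
  set A := RtoC (scal _ _); have EA : A = RtoC (sgn j * 1 * dPhi t) by [].
  have E1 : (RtoC (sgn j) * A * RtoC (Rpower (Phi t) (mu j - 1)) * RtoC (Rpower (Phi t) (1 - mu j) * / dPhi t) = 1)%C.
    rewrite EA -!RtoC_mult; congr RtoC.
    transitivity ((sgn j * sgn j) * (Rpower (Phi t) (mu j - 1) * Rpower (Phi t) (1 - mu j))); first by field; lra.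
    rewrite sgn_sqr -Rpower_plus (_ : mu j - 1 + (1 - mu j) = 0) ?Rpower_O //; ring.
  transitivity ((RtoC (sgn j) * A * RtoC (Rpower (Phi t) (mu j - 1)) * RtoC (Rpower (Phi t) (1 - mu j) * / dPhi t))
    * (U (from_end p j t) * (e_psi psi omega (p j) * osc rho j omega (RtoC (Phi t)))))%C.
    ring_C.
  rewrite E1; ring.
have HI y : 0 < y <= l ->
    RInt (V := C_R_CompleteNormedModule) (fun x => U x * e_psi psi omega x)%C q (from_end p j y)
    = (RtoC (sgn j) * e_psi psi omega (p j) * (N (Phi y) - N S))%C.
  move=> Hy; apply: (is_RInt_unique (V := C_R_CompleteNormedModule)).
  have K := C1_primitive_is_RInt C_R_CompleteNormedModule Q (fun x => U x * e_psi psi omega x)%C q (from_end p j y).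
  have EQ : (RtoC (sgn j) * e_psi psi omega (p j) * (N (Phi y) - N S))%C = minus (G := C_R_NormedModule) (Q (from_end p j y)) (Q q).
    rewrite /Q dist_from_end -/l -/S.
    change (RtoC (sgn j) * e_psi psi omega (p j) * (N (Phi y) - N S) =
      RtoC (sgn j) * e_psi psi omega (p j) * N (Phi y) - RtoC (sgn j) * e_psi psi omega (p j) * N S)%C; ring.
  rewrite EQ; apply: K => x; rewrite -{1 2}from_end_q => Hx.
  have Hx' := between_from_end p j x y l (proj2 Hy) Hx.
  have Hx1 : 0 < sgn j * (x - p j) <= l by lra.
  have Hx2 : 0 < sgn j * (x - p j) < L by lra.
  rewrite -(from_end_dist p j x); split; first exact: HQ.
  apply: hg; exact: from_end_inside.
have HPhi : filterlim Phi (at_right 0) (at_right 0).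
  move=> W [e He].
  have K1 : at_right 0 (fun y => ball 0 e (Phi y)) := Phi0 _ (locally_ball 0 e).
  have HL : 0 < L by lra.
  have K2 : at_right 0 (fun y => 0 < y < L) by exact: (at_right_0_intro _ L).
  refine (filter_imp (F := at_right 0) _ _ _ (filter_and (F := at_right 0) _ _ K1 K2)) => y [Hy1 Hy2].
  by apply: He => //; have [_ []] := chart y Hy2.
apply: (filterlim_ext_loc (fun y => RtoC (sgn j) * e_psi psi omega (p j) * (N (Phi y) - N S))%C).
  apply: (at_right_0_intro _ l); first lra.
  by move=> y Hy; rewrite HI //; lra.
(* Up to signs and the factor e^(i omega psi(p_j)), the limit of N at 0 contains R_1 through X and A
   through the Gamma term, while N S is the boundary term at q. *)
set N1 := (X - _)%C in N0.
have E : (RtoC (sgn j) * e_psi psi omega (p j) * (N1 - N S) = - RtoC (sgn j) * (A_term p psi U rho mu q j omega + R1_term p psi U rho mu q j omega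
               + R2_term p psi U rho mu q j omega)
             + Ci * U q * e_psi psi omega q * RtoC (/ (omega * d)))%C.
  transitivity (RtoC (sgn j) * e_psi psi omega (p j) * N1 + (RtoC (sgn j) * e_psi psi omega (p j) * ray_int rho j omega (mu j - 1) S 0 * kappa S))%C.
    rewrite NS; ring.
  rewrite (boundary_term d Hd) ER1 /A_term k_0 /Theta /N1.
  have -> : Cexp (RtoC (sgn j) * Ci * RtoC (PI / 2 * (mu j / rho j)))%C = Cexp (0%R, mu j * (sgn j * (PI / (2 * rho j))))%R.
    by congr Cexp; rewrite /Cmult /RtoC /=; congr (_, _); [ring | field; lra].
  set EE := Cexp _.
  have -> : RtoC (sgn j / rho j * Gamma (mu j / rho j)) = (RtoC (sgn j) * RtoC (/ rho j * Gamma (mu j / rho j)))%C.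
    by rewrite -RtoC_mult; congr RtoC; rewrite /Rdiv; ring.
  rewrite (RtoC_mult (/ rho j * Gamma (mu j / rho j)) (Rpower _ _)).
  have Ss : (RtoC (sgn j) * RtoC (sgn j) = 1)%C by rewrite -RtoC_mult sgn_sqr.
  set gg := RtoC (/ rho j * Gamma (mu j / rho j)); set ww := RtoC (Rpower omega _).
  transitivity (RtoC (sgn j) * e_psi psi omega (p j) * X - (RtoC (sgn j) * RtoC (sgn j)) * RtoC (sgn j) * e_psi psi omega (p j) * (gg * ww * EE * kappa0)
    + (- RtoC (sgn j) * R2_term p psi U rho mu q j omega + Ci * U q * e_psi psi omega q * RtoC (/ (omega * d))))%C.
    rewrite Ss; ring.
  ring.
rewrite -E; apply: filterlim_Cmult_const.
apply: (filterlim_comp_2 (fun y => N (Phi y)) (fun _ => - N S)%C Cplus _ (filterlim_const _) (filterlim_plus (V := C_R_NormedModule) _ _)).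
exact: filterlim_comp HPhi N0.
Qed.

End Endpoint.

(** * Assembly over the whole interval *)

Lemma C1_on_continuous (V : NormedModule R_AbsRing) (a b x : R) (f : R -> V) :
  C1_on a b f -> a < x < b -> continuous f x.
Proof.
move=> [df [Hd _]] Hx; apply: ex_derive_continuous; exists (df x).
apply: is_derive_on_interior (locally_segment _ _ _ Hx) _.
apply: Hd; rewrite /segment; lra.
Qed.

Lemma integrand_continuous (a b mu1 mu2 omega x : R) (psi : R -> R) (U : R -> C) :
  C1_on (V := R_NormedModule) a b psi -> assumption_A a b mu1 mu2 U -> a < x < b ->
  continuous (U := C_UniformSpace) (fun x => U x * e_psi psi omega x)%C x.
Proof.
move=> Hpsi [ut [Cut [HU _]]] Hx.
apply: continuous_Cmult.
- apply: (continuous_ext_loc _ (fun t => RtoC (Rpower (t - a) (mu1 - 1) * Rpower (b - t) (mu2 - 1)) * ut t)%C).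
    apply: filter_imp (locally_interval a b x Hx) => t Ht.
    rewrite HU ?rpow_pos //; lra.
  apply: continuous_Cmult; last exact: C1_on_continuous Cut Hx.
  apply: continuous_RtoC; apply: (continuous_mult (K := R_AbsRing)).
  + apply: (continuous_comp (fun t => t - a) (fun y => Rpower y (mu1 - 1))); last by apply: continuous_Rpower; lra.
    by apply: (ex_derive_continuous (V := R_NormedModule)); auto_derive.
  + apply: (continuous_comp (fun t => b - t) (fun y => Rpower y (mu2 - 1))); last by apply: continuous_Rpower; lra.
    by apply: (ex_derive_continuous (V := R_NormedModule)); auto_derive.
- apply: continuous_comp; last exact: continuous_Cexp.
  apply: continuous_Cmult; first exact: continuous_const.
  apply: continuous_RtoC; exact: (C1_on_continuous R_NormedModule a b x psi Hpsi Hx).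
Qed.

Lemma filterlim_dist_left (a : R) : filterlim (fun x => x - a) (at_right a) (at_right 0).
Proof.
move=> Q [e He]; exists e => x Hx Hax; apply: He; last lra.
move: Hx; rewrite /ball /= /AbsRing_ball /= /abs /minus /plus /opp /=.
by rewrite Ropp_0 Rplus_0_r.
Qed.

Lemma filterlim_dist_right (b : R) : filterlim (fun x => b - x) (at_left b) (at_right 0).
Proof.
move=> Q [e He]; exists e => x Hx Hax; apply: He; last lra.
move: Hx; rewrite /ball /= /AbsRing_ball /= /abs /minus /plus /opp /=.
rewrite Ropp_0 Rplus_0_r -Rabs_Ropp => Hx.
by rewrite (_ : b - x = - (x + - b)) //; ring.
Qed.

Theorem theorem2p2
  (p : index -> R) (hp : p one < p two)
  (rho mu : index -> R)
  (hrho : forall j : index, 1 <= rho j)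
  (hmu : forall j : index, 0 < mu j < 1)
  (psi : R -> R) (U : R -> C)
  (hpsi : assumption_P (p one) (p two) (rho one) (rho two) psi)
  (hU : assumption_A (p one) (p two) (mu one) (mu two) U)
  (q : R) (hq : p one < q < p two)
  (omega : R) (homega : 0 < omega) :
  int_oo (V := C_R_CompleteNormedModule)
    (fun x : R => (U x * e_psi psi omega x)%C) (p one) (p two)
  = ((A_term p psi U rho mu q one omega
      + R1_term p psi U rho mu q one omega
      + R2_term p psi U rho mu q one omega)
     + (A_term p psi U rho mu q two omega
        + R1_term p psi U rho mu q two omega
        + R2_term p psi U rho mu q two omega))%C
  /\
  (forall j : index,
    Cmod (R1_term p psi U rho mu q j omega)
    <= / rho j * Gamma (/ rho j)
       * int_oo (V := R_CompleteNormedModule)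
           (fun s : R => rpow s (mu j - 1) * Cmod (k' p psi U rho mu q j s))
           0 (s_end p psi rho q j)
       * Rpower omega (- / rho j))
  /\
  (forall j : index,
    Cmod (R2_term p psi U rho mu q j omega)
    <= (rho j - mu j) / rho j * Gamma (/ rho j)
       * Cmod (U q * RtoC (/ Derive_on (V := R_CompleteNormedModule)
                               (on_I p q j) (phi p psi rho j) q))%C
       * rpow (phi p psi rho j q) (- rho j)
       * Rpower omega (- (1 + / rho j))).
Proof.
have hg x : p one < x < p two -> continuous (U := C_UniformSpace) (fun x => U x * e_psi psi omega x)%C x.
  by move=> Hx; apply: integrand_continuous Hx; [exact: (proj1 hpsi) | exact: hU].
have [d Hd] : exists d, is_derive psi q d.
  have [[dpsi [H _]] _] := hpsi; exists (dpsi q).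
  apply: is_derive_on_interior (locally_segment _ _ _ hq) _; apply: H; rewrite /segment; lra.
(* The boundary contribution at q occurs with the same sign in the limits of P at both ends, so it
   drops out of their difference. *)
set W := (Ci * U q * e_psi psi omega q * RtoC (/ (omega * d)))%C.
pose T j := (A_term p psi U rho mu q j omega + R1_term p psi U rho mu q j omega + R2_term p psi U rho mu q j omega)%C.
pose P := RInt (V := C_R_CompleteNormedModule) (fun x => U x * e_psi psi omega x)%C q.
have Main j : filterlim (fun y => P (from_end p j y)) (at_right 0) (locally (- RtoC (sgn j) * T j + W)%C) /\
  Cmod (R1_term p psi U rho mu q j omega)
    <= / rho j * Gamma (/ rho j)
       * int_oo (V := R_CompleteNormedModule)
           (fun s : R => rpow s (mu j - 1) * Cmod (k' p psi U rho mu q j s))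
           0 (s_end p psi rho q j)
       * Rpower omega (- / rho j) /\
  Cmod (R2_term p psi U rho mu q j omega)
    <= (rho j - mu j) / rho j * Gamma (/ rho j)
       * Cmod (U q * RtoC (/ Derive_on (V := R_CompleteNormedModule)
                               (on_I p q j) (phi p psi rho j) q))%C
       * rpow (phi p psi rho j q) (- rho j)
       * Rpower omega (- (1 + / rho j)).
  have Hl : 0 < sgn j * (q - p j) < p two - p one by case: (j) => /=; lra.
  have [Phi [dPhi [G [kappa [dkappa [kappa0 [s1 [chart [incr [Phi0 [surj [hs1 [hk [hk0 hbd]]]]]]]]]]]]]] :=
    endpoint_chart p rho mu psi U j _ hp hrho hpsi hU Hl.
  have [H1 H2] := endpoint_contribution p rho mu psi U q omega j (hrho j) (hmu j) hq homega hg
    Phi dPhi G kappa dkappa kappa0 s1 chart incr Phi0 surj hs1 hk hk0 hbd d Hd.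
  split => //; split => //.
  exact: (R2_term_le p rho mu psi U q omega j (hrho j) (hmu j) hq homega Phi dPhi G kappa chart incr surj).
split; last by split => j; have [_ []] := Main j.
have L1 : filterlim P (at_right (p one)) (locally (- RtoC 1 * T one + W)%C).
  apply: (filterlim_ext (fun x => P (from_end p one (x - p one)))) => [x|].
    by rewrite /from_end /=; congr P; ring.
  exact: filterlim_comp (filterlim_dist_left (p one)) (proj1 (Main one)).
have L2 : filterlim P (at_left (p two)) (locally (- RtoC (-1) * T two + W)%C).
  apply: (filterlim_ext (fun x => P (from_end p two (p two - x)))) => [x|].
    by rewrite /from_end /=; congr P; ring.
  exact: filterlim_comp (filterlim_dist_right (p two)) (proj1 (Main two)).
have HI := is_RInt_gen_interval C_R_CompleteNormedModule P (fun x => U x * e_psi psi omega x)%C (p one) (p two) _ _ hp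
  (fun x Hx => RInt_C1_primitive C_R_CompleteNormedModule _ (p one) (p two) q x hq Hx hg) L1 L2.
transitivity (minus (G := C_R_NormedModule) (- RtoC (-1) * T two + W)%C (- RtoC 1 * T one + W)%C).
  exact: (is_RInt_gen_unique (V := C_R_CompleteNormedModule) _ _ HI).
change ((- RtoC (-1) * T two + W) - (- RtoC 1 * T one + W) = T one + T two)%C.
rewrite -RtoC_opp (_ : - -1 = 1); last ring.
ring.
Qed.
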